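(* Let $\mathcal A$ be a graded quiver, $d\in\mathbb Z$, and let $s_{d+1}F,s_{d+1}G\in\mathrm{Multi}_d(\mathcal A)^{C}[d+1]$. Then, for all types $\bar{\bar x}=(\bar x^1,\dots,\bar x^n)$, $\bar{\bar y}=(\bar y^1,\dots,\bar y^m)$: (1) for $v\in\{1,\dots,n\}$ and $j\in\{2,\dots,\lg(\bar x^v)\}$, $$\mathsf j_{\bar{\bar x}\sqcup_{v,j,inn}\bar{\bar y}}\big(s_{d+1}F^{\bar{\bar x}}\circ^{inn}_{v,j}s_{d+1}G^{\bar{\bar y}}\big)=\mathsf j_{\bar{\bar x}}(s_{d+1}F^{\bar{\bar x}})\circ_{G,p,q}\pi_{\mathcal A}\big(\mathsf j_{\bar{\bar y}}(s_{d+1}G^{\bar{\bar y}})\big),$$ where $\circ_{G,p,q}$ is Gerstenhaber insertion in the slot of the $(j-1)$-st input of the block $\bar x^v$ of $\mathsf j_{\bar{\bar x}}(s_{d+1}F^{\bar{\bar x}})$ (the slot with $\lg(\bar x^1)+\dots+\lg(\bar x^v)-j$ inputs to its right); (2) for $v\in\{1,\dots,m-1\}$ and $j\in\{2,\dots,\lg(\bar x^1)\}$, $$\mathsf j_{\bar{\bar x}\sqcup_{v,j,out}\bar{\bar y}}\big(s_{d+1}F^{\bar{\bar x}}\circ^{out}_{v,j}s_{d+1}G^{\bar{\bar y}}\big)=-(-1)^{(|F|+d+1)(|G|+d+1)}\,\mathsf j_{\bar{\bar y}}(s_{d+1}G^{\bar{\bar y}})\circ_{G,p,q}\pi_{\mathcal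 A^*}\big(\mathsf j_{\bar{\bar x}}(s_{d+1}F^{\bar{\bar x}})\big),$$ where $\circ_{G,p,q}$ is Gerstenhaber insertion in the slot of the $\mathcal A^*[d]$-input number $v$ of $\mathsf j_{\bar{\bar y}}(s_{d+1}G^{\bar{\bar y}})$. Both are identities of maps with values in $(\mathcal A\oplus\mathcal A^*[d-1])[1]$, i.e. they hold for the $\mathcal A[1]$-valued and for the $\mathcal A^*[d]$-valued parts. (If the objects do not match as required for the composition, both sides are zero.)
   Context: **Conventions.** $\Bbbk$ is a field of characteristic different from $2,3$; $\otimes=\otimes_\Bbbk$. For a graded space $V$, $V[n]^i=V^{n+i}$ and $s_n:V\to V[n]$ (also $V[m]\to V[m+n]$) is the identity on underlying sets, of degree $-n$; $s=s_1$. Elements whose degree is used are homogeneous. The Koszul sign rule is used everywhere: $(f\otimes g)(v\otimes w)=(-1)^{|g||v|}f(v)\otimes g(w)$, and exchanging two adjacent homogeneous elements $v,w$ produces $(-1)^{|v||w|}$. $V^*$ is the graded dual. Products are products of graded spaces. A graded quiver $\mathcal A$ has a set of objects and graded spaces ${}_y\mathcal A_x$; $\mathcal A^*$ has the same objects and ${}_y\mathcal A^*_x=({}_x\mathcal A_y)^*$. Elements $s_{d-1}g$ of $\mathcal A^*[d-1]$ are viewed as linear forms on $\mathcal A[1-d]$ by the isomorphism $\mathcal Hom(V,W)[k]\to\mathcal Hom(V[-k],W)$, $s_kg\mapsto(s_{-k}v\mapsto(-1)^{k|g|}g(v))$ with $k=d-1$. For a tuple $\bar x=(x_1,\dots,x_n)$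 of objects ($n\ge1$): $\lg(\bar x)=n$, $\mathrm{lt}(\bar x)=x_1$, $\mathrm{rt}(\bar x)=x_n$, $\mathcal A[1]^{\otimes\bar x}={}_{x_1}\mathcal A_{x_2}[1]\otimes\cdots\otimes{}_{x_{n-1}}\mathcal A_{x_n}[1]$ ($=\Bbbk$ if $n=1$); $\sqcup$ is concatenation; $\bar x_{<i}$, $\bar x_{\le i}$, $\bar x_{>i}$, $\bar x_{\ge i}$ are the subtuples of entries with index $<i$, $\le i$, $>i$, $\ge i$. A *type* is a finite nonempty sequence $\bar{\bar x}=(\bar x^1,\dots,\bar x^n)$ of nonempty tuples, with $\lg(\bar x^1)\ge2$ if $n=1$. $\overline{sa}^i$ denotes a homogeneous pure tensor in $\mathcal A[1]^{\otimes\bar x^i}$, $|\overline{sa}^i|$ its total degree. $t=s_d:\mathcal A^*\to\mathcal A^*[d]$. **$\mathrm{Multi}$.** $\mathrm{Multi}_d(\mathcal A)$ is the product over all types of the graded spaces of (sums of homogeneous) linear maps $$F^{\bar{\bar x}}:\mathcal A[1]^{\otimes\bar x^1}\otimes\cdots\otimes\mathcal A[1]^{\otimes\bar x^n}\to{}_{\mathrm{lt}(\bar x^1)}\mathcal A_{\mathrm{rt}(\bar x^2)}[-d]\otimes\cdots\otimes{}_{\mathrm{lt}(\bar x^n)}\mathcal A_{\mathrm{rt}(\bar x^1)}[-d].$$ $\mathrm{Multi}_d(\mathcal A)^C$ is the subspace of cyclically invariant elements: $F^{(\bar x^1,\dots,\bar x^n)}=\tau_{out}\circ F^{(\bar x^2,\dots,\bar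 x^n,\bar x^1)}\circ\tau_{in}$, where $\tau_{in}$ moves the first input block to the end and $\tau_{out}$ moves the last output factor to the front, with Koszul signs. $s_{d+1}F$ is identified with the family of maps $(\mathrm{id}^{\otimes(n-1)}\otimes s_{d+1})\circ F^{\bar{\bar x}}$; $|F|$ is the degree of $F$ in $\mathrm{Multi}_d(\mathcal A)$. **Diagrams with two discs.** A disc of type $(\bar x^1,\dots,\bar x^n)$ is a circle with outgoing arrows labelled $1,\dots,n$ clockwise; the sector between outgoing arrows $i-1$ and $i$ (arrow $0$ is arrow $n$) contains $\lg(\bar x^i)-1$ incoming arrows, separated by the objects $x^i_1,x^i_2,\dots$ read counterclockwise; the incoming arrow between $x^i_j,x^i_{j+1}$ is the input ${}_{x^i_j}\mathcal A_{x^i_{j+1}}[1]$, the outgoing arrow $i$ is the $i$-th output. Outgoing arrow $i$ of one disc may be connected to an incoming arrow between $u,u'$ of another disc if $\mathrm{lt}(\bar x^i)=u$, $\mathrm{rt}(\bar x^{i+1})=u'$ (with $\bar x^{n+1}=\bar x^1$). A two-disc diagram consists of a disc filled with $G$ and a disc filled with $F$, one outgoing arrow of the $G$-disc being connected to one incoming arrow of the $F$-disc, together with a chosen free outgoing arrow (root). The free outgoing arrows are labelled clockwise $1,\dots,N$, the root being $N$; the type $(\bar z^1,\dots,\bar z^N)$ lists the objects read counterclockwise between free outgoing arrows $i-1$ and $i$. The bold arrow of each disc is its arrow on the path to the root. A disc acts by $(\mathrm{id}^\otimes\otimes s_{d+1}\otimes\mathrm{id}^\otimes)\circ F$, with $s_{d+1}$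 at the bold output, if its bold arrow is outgoing; if it is incoming, it acts by the map $(-1)^{(d+1)|F|}F\circ(\mathrm{id}^\otimes\otimes s_{d+1}\otimes\mathrm{id}^\otimes)$, with $s_{d+1}:\mathcal A[-d]\to\mathcal A[1]$ at the bold input, multiplied by $(-1)^{(|F|+d+1)(d+1)}$. The evaluation takes the inputs in the order of the type, permutes (Koszul signs) so that the inputs of the $G$-disc are leftmost in the order of its inputs, applies the $G$-disc, permutes so that the inputs of the $F$-disc are leftmost in order, applies the $F$-disc, and permutes the outputs into the order $1,\dots,N$; the result is of the form $(\mathrm{id}^{\otimes(N-1)}\otimes s_{d+1})\circ H$, i.e. an element $s_{d+1}H$. *Inner composition* $s_{d+1}F^{\bar{\bar x}}\circ^{inn}_{v,j}s_{d+1}G^{\bar{\bar y}}$, for $\mathrm{lt}(\bar y^m)=x^v_{j-1}$, $\mathrm{rt}(\bar y^1)=x^v_j$: the evaluation of the diagram connecting output $m$ of the $G$-disc to the input of the $F$-disc between $x^v_{j-1}$ and $x^v_j$, root = output $n$ of $F$; its type is $\bar{\bar x}\sqcup_{v,j,inn}\bar{\bar y}=(\bar x^1,\dots,\bar x^{v-1},\bar y^1\sqcup\bar x^v_{>j},\bar y^2,\dots,\bar y^{m-1},\bar x^v_{<j-1}\sqcup\bar y^m,\bar x^{v+1},\dots,\bar x^n)$ (with the single block $\bar x^v_{<j-1}\sqcup\bar y^1\sqcup\bar x^v_{>j}$ if $m=1$). *Outer composition* $s_{d+1}F^{\bar{\bar x}}\circ^{out}_{v,j}s_{d+1}G^{\bar{\bar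 y}}$, for $\mathrm{lt}(\bar y^v)=x^1_{j-1}$, $\mathrm{rt}(\bar y^{v+1})=x^1_j$: the evaluation of the diagram connecting output $v$ of the $G$-disc to the input of the $F$-disc between $x^1_{j-1}$ and $x^1_j$, root = output $m$ of $G$; its type is $\bar{\bar x}\sqcup_{v,j,out}\bar{\bar y}=(\bar y^1,\dots,\bar y^{v-1},\bar x^1_{<j-1}\sqcup\bar y^v,\bar x^2,\dots,\bar x^n,\bar y^{v+1}\sqcup\bar x^1_{>j},\bar y^{v+2},\dots,\bar y^m)$. **The map $\mathsf j$.** It is a linear map $\mathrm{Multi}_d(\mathcal A)[d+1]\to C(\mathcal A\oplus\mathcal A^*[d-1])[1]$, where $C(\mathcal Q)[1]$ is the space of families of multilinear maps on composable elements of $\mathcal Q[1]$ with values in $\mathcal Q[1]$; note $(\mathcal A\oplus\mathcal A^*[d-1])[1]=\mathcal A[1]\oplus\mathcal A^*[d]$. Words of block type $\bar{\bar x}=(\bar x^1,\dots,\bar x^n)$ are $w=(\overline{sa}^n,tf^{n-1},\overline{sa}^{n-1},\dots,tf^1,\overline{sa}^1)$ with $\overline{sa}^i\in\mathcal A[1]^{\otimes\bar x^i}$, $tf^i\in{}_{\mathrm{rt}(\bar x^{i+1})}\mathcal A^*_{\mathrm{lt}(\bar x^i)}[d]$. One sets $\mathsf j(s_{d+1}\phi)=s\psi$, where the $\mathcal A$-valued part of $\psi(w)$ is $$(-1)^\epsilon\big(\bigotimes_{i=1}^{n-1}(f^i\circ s_d)\otimes s_d\big)\big(\phi^{\bar{\bar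 x}}(\overline{sa}^1,\dots,\overline{sa}^n)\big),$$ $$\epsilon=\sum_{i=1}^{n-1}|tf^i|\sum_{k=i+1}^n|\overline{sa}^k|+|\phi|\sum_{i=1}^{n-1}|tf^i|+d(n-1)+\sum_{1\le i<k\le n}|\overline{sa}^i||\overline{sa}^k|+\sum_{1\le i<k\le n-1}|tf^i||tf^k|,$$ and the $\mathcal A^*[d-1]$-valued part of $\psi(w)$ (zero for $n=1$) is, with $\bar{\bar x}'=(\bar x^1\sqcup\bar x^n,\bar x^2,\dots,\bar x^{n-1})$, the form whose value on $s_{1-d}b$, for $sb\in{}_{\mathrm{rt}(\bar x^1)}\mathcal A_{\mathrm{lt}(\bar x^n)}[1]$, is $$(-1)^\delta\big(\bigotimes_{i=1}^{n-1}(f^i\circ s_d)\big)\big(\phi^{\bar{\bar x}'}(\overline{sa}^1\otimes sb\otimes\overline{sa}^n,\overline{sa}^2,\dots,\overline{sa}^{n-1})\big),$$ $$\delta=\epsilon+d\big(|\phi|+\sum_{i=1}^n|\overline{sa}^i|\big)+(|\overline{sa}^n|+|sb|)\sum_{i=2}^{n-1}|\overline{sa}^i|+|\overline{sa}^n||sb|.$$ **Components.** $\mathsf j_{\bar{\bar x}}(s_{d+1}\phi^{\bar{\bar x}})$ is the component of $\mathsf j(s_{d+1}\phi)$ on words of block type $\bar{\bar x}$: its $\mathcal A[1]$-valued part is built from $\phi^{\bar{\bar x}}$ and its $\mathcal A^*[d]$-valued part from $\phi^{\bar{\bar x}'}$. Accordingly, on the left sides of (1) and (2), with $\bar{\bar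 z}=(\bar z^1,\dots,\bar z^N)$ the composed type, the $\mathcal A[1]$-valued part is built from the composition of $F^{\bar{\bar x}}$ with $G^{\bar{\bar y}}$, and the $\mathcal A^*[d]$-valued part from the composition of type $\bar{\bar z}'=(\bar z^1\sqcup\bar z^N,\bar z^2,\dots,\bar z^{N-1})$ of $F^{\bar{\bar x}'}$ with $G^{\bar{\bar y}}$ in (1), respectively of $F^{\bar{\bar x}}$ with $G^{\bar{\bar y}'}$ in (2), connecting the same two arrows (the output from the $G$-disc and the input of the $F$-disc between $x^v_{j-1},x^v_j$, respectively $x^1_{j-1},x^1_j$), the free outputs being labelled so that the first block is the sector containing $b$. In (1), $\pi_{\mathcal A}(\mathsf j_{\bar{\bar y}}(s_{d+1}G^{\bar{\bar y}}))$ is the $\mathcal A[1]$-valued map built from $G^{\bar{\bar y}}$. In (2), $\pi_{\mathcal A^*}(\mathsf j_{\bar{\bar x}}(s_{d+1}F^{\bar{\bar x}}))$ is the $\mathcal A^*[d]$-valued map built from $F^{\bar{\bar x}}$, on words with blocks $(\bar x^1_{\le j-1},\bar x^2,\dots,\bar x^n,\bar x^1_{\ge j})$, $\bar x^1$ being split at the input receiving the output of $G$. **Gerstenhaber insertion.** For multilinear maps $sf,sg$ on $\mathcal Q[1]$, the insertion of $sg$ at position $i$ is $(-1)^{|sg|\sum_{r<i}|sq_r|}\,sf(sq_1,\dots,sq_{i-1},sg(sq_i,\dots),\dots)$.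
   Formalization: In outer compositions the root shift is applied last, keeping the sign (-1)^{(|F|+d+1)(d+1)}; read literally, (2) fails for d, |F| even. In the A*[d]-valued parts the relabelled composition keeps its inner or outer sign even if the root changes disc. *)

(* Defs.v *)
From HB Require Import structures.
From mathcomp Require Import all_boot all_algebra generic_quotient.
From mathcomp Require Import boolp functions zify.

Set Implicit Arguments.
Unset Strict Implicit.
Unset Printing Implicit Defensive.

Import GRing.Theory.
Local Open Scope ring_scope.
Local Open Scope quotient_scope.

(** * Graded quivers and their homogeneous elements *)

(* [A y x i] is the degree [i] component of the graded space from [x] to
   [y]. *)
Definition quiver (k : fieldType) (O : choiceType) := O -> O -> int -> lmodType k.

Section Arrows.
Variables (k : fieldType) (O : choiceType) (A : quiver k O).

Definition fiber (p : O * O * int) : lmodType k := A p.1.1 p.1.2 p.2.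

(* A homogeneous element together with its endpoints and its degree. *)
Definition arrow := {p : O * O * int & fiber p}.
HB.instance Definition _ := Choice.on arrow.

Definition Arrow y x i (a : A y x i) : arrow := @Tagged _ (y, x, i) fiber a.
Definition tgt (a : arrow) : O := (tag a).1.1.
Definition src (a : arrow) : O := (tag a).1.2.
Definition deg (a : arrow) : int := (tag a).2.

(* The component of [a] in [A y x i]; it is [0] off the support of [a]. *)
Definition component y x i (a : arrow) : A y x i :=
  @untag _ fiber (A y x i) 0 (y, x, i) id a.

(* Total degree of a word seen in A[1], resp. in A[-d]. *)
Definition sdeg (w : seq arrow) : int := \sum_(a <- w) (deg a - 1).
Definition odeg (d : int) (w : seq arrow) : int := \sum_(a <- w) (deg a + d).

Definition endpoints (a : arrow) : O * O := (tgt a, src a).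

(** * Tensors

  [tensors] is the tensor algebra of the direct sum of all the graded pieces
  of [A]: formal linear combinations of words of arrows, two of them being
  identified when no multilinear map separates them.  Each tensor product
  occurring below is the subspace of [tensors] spanned by words with
  prescribed endpoints. *)

Definition multilinear (W : lmodType k) (h : seq arrow -> W) : Prop :=
  forall (l r : seq arrow) y x i, linear (fun a : A y x i => h (l ++ Arrow a :: r)).

Definition presum := seq (k * seq arrow).

Definition presum_eval (W : lmodType k) (h : seq arrow -> W) (s : presum) : W :=
  \sum_(c <- s) c.1 *: h c.2.

Definition teq (s t : presum) : bool :=
  `[< forall (W : lmodType k) (h : seq arrow -> W),
        multilinear h -> presum_eval h s = presum_eval h t >].

Lemma teq_refl : reflexive teq. Proof. by move=> s; apply/asboolP. Qed.

Lemma teq_sym : symmetric teq.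
Proof.
by move=> s t; apply/asboolP/asboolP => e W h /e ->.
Qed.

Lemma teq_trans : transitive teq.
Proof.
by move=> t s u /asboolP e /asboolP f; apply/asboolP => W h H; rewrite e // f.
Qed.

Canonical teq_equiv := EquivRel teq teq_refl teq_sym teq_trans.

Definition tensors := {eq_quot teq_equiv}.
HB.instance Definition _ := Choice.on tensors.

Definition of_presum (s : presum) : tensors := \pi_tensors s.

(* For multilinear [h], [tlift h] is the induced linear map; for other [h] it is
   meaningless. *)
Definition tlift (W : lmodType k) (h : seq arrow -> W) (u : tensors) : W :=
  presum_eval h (repr u).

Lemma tlift_of_presum (W : lmodType k) (h : seq arrow -> W) s :
  multilinear h -> tlift h (of_presum s) = presum_eval h s.
Proof.
move=> H; have /eqP : repr (of_presum s) == s %[mod tensors] by rewrite reprK.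
by move=> /eqmodP /asboolP; apply.
Qed.

Lemma tensors_ext (u v : tensors) :
  (forall (W : lmodType k) (h : seq arrow -> W),
     multilinear h -> tlift h u = tlift h v) -> u = v.
Proof.
move=> e; rewrite -[u]reprK -[v]reprK; apply/eqmodP/asboolP => W h H.
exact: e.
Qed.

Definition tzero : tensors := of_presum [::].
Definition topp (u : tensors) : tensors :=
  of_presum [seq (- c.1, c.2) | c <- repr u].
Definition tadd (u v : tensors) : tensors := of_presum (repr u ++ repr v).
Definition tscale (a : k) (u : tensors) : tensors :=
  of_presum [seq (a * c.1, c.2) | c <- repr u].

Section LiftOps.
Variables (W : lmodType k) (h : seq arrow -> W) (H : multilinear h).

Lemma tlift_zero : tlift h tzero = 0.
Proof. by rewrite tlift_of_presum // /presum_eval big_nil. Qed.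

Lemma tlift_opp u : tlift h (topp u) = - tlift h u.
Proof.
rewrite tlift_of_presum // /tlift /presum_eval big_map -sumrN.
by apply: eq_bigr => c _; rewrite scaleNr.
Qed.

Lemma tlift_add u v : tlift h (tadd u v) = tlift h u + tlift h v.
Proof. by rewrite tlift_of_presum // /tlift /presum_eval big_cat. Qed.

Lemma tlift_scale a u : tlift h (tscale a u) = a *: tlift h u.
Proof.
rewrite tlift_of_presum // /tlift /presum_eval big_map scaler_sumr.
by apply: eq_bigr => c _; rewrite scalerA.
Qed.

End LiftOps.

Lemma taddA : associative tadd.
Proof. by move=> u v t; apply: tensors_ext => W h H; rewrite !tlift_add // addrA. Qed.
Lemma taddC : commutative tadd.
Proof. by move=> u v; apply: tensors_ext => W h H; rewrite !tlift_add // addrC. Qed.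
Lemma tadd0 : left_id tzero tadd.
Proof.
by move=> u; apply: tensors_ext => W h H; rewrite tlift_add // tlift_zero // add0r.
Qed.
Lemma taddN : left_inverse tzero topp tadd.
Proof.
move=> u; apply: tensors_ext => W h H.
by rewrite tlift_add // tlift_opp // tlift_zero // addNr.
Qed.
HB.instance Definition _ := GRing.isZmodule.Build tensors taddA taddC tadd0 taddN.

Lemma tscaleA a b u : tscale a (tscale b u) = tscale (a * b) u.
Proof. by apply: tensors_ext => W h H; rewrite !tlift_scale // scalerA. Qed.
Lemma tscale1 : left_id 1 tscale.
Proof. by move=> u; apply: tensors_ext => W h H; rewrite tlift_scale // scale1r. Qed.
Lemma tscaleDr : right_distributive tscale +%R.
Proof.
move=> a u v; apply: tensors_ext => W h H.
by rewrite tlift_scale // !tlift_add // !tlift_scale // scalerDr.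
Qed.
Lemma tscaleDl u : {morph tscale^~ u : a b / a + b}.
Proof.
move=> a b; apply: tensors_ext => W h H.
by rewrite tlift_add // !tlift_scale // scalerDl.
Qed.
HB.instance Definition _ :=
  GRing.Zmodule_isLmodule.Build k tensors tscaleA tscale1 tscaleDr tscaleDl.

Definition pure (w : seq arrow) : tensors := of_presum [:: (1, w)].

Lemma tlift_linear (W : lmodType k) (h : seq arrow -> W) :
  multilinear h -> linear (tlift h).
Proof.
move=> H a u v; change (a *: u + v) with (tadd (tscale a u) v).
by rewrite tlift_add // tlift_scale.
Qed.

Lemma tlift_pure (W : lmodType k) (h : seq arrow -> W) w :
  multilinear h -> tlift h (pure w) = h w.
Proof. by move=> H; rewrite tlift_of_presum // /presum_eval big_seq1 scale1r. Qed.

Lemma pure_multilinear : multilinear pure.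
Proof.
move=> l r y x i a u v; apply: tensors_ext => W h H.
change (tlift h (pure (l ++ Arrow (a *: u + v) :: r)) =
  tlift h (tadd (tscale a (pure (l ++ Arrow u :: r))) (pure (l ++ Arrow v :: r)))).
by rewrite tlift_add // tlift_scale // !tlift_pure // H.
Qed.

Definition spanned (P : pred (seq arrow)) (u : tensors) : Prop :=
  exists2 s : presum, all (fun c => P c.2) s & u = \sum_(c <- s) c.1 *: pure c.2.

(** * Multi_d(A) *)

Definition lt_obj (x : seq O) : option O := ohead x.
Definition rt_obj (x : seq O) : option O := ohead (rev x).
Definition pairs (x : seq O) : seq (O * O) := zip x (behead x).

(* Blocks are numbered from 1. *)
Definition blk (T : Type) (xx : seq (seq T)) (i : nat) : seq T := nth [::] xx i.-1.

Definition is_type (xx : seq (seq O)) : bool :=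
  [&& xx != [::], all (fun x => x != [::]) xx
    & (size xx == 1)%N ==> (1 < size (blk xx 1))%N].

(* [w] is the concatenation of words in A[1]^(x x^1), ..., A[1]^(x x^n). *)
Definition of_type (xx : seq (seq O)) (w : seq arrow) : bool :=
  map endpoints w == flatten (map pairs xx).

Definition out_of_type (xx : seq (seq O)) (us : seq arrow) : bool :=
  [seq (Some (tgt u), Some (src u)) | u <- us]
    == zip (map lt_obj xx) (map rt_obj (rot 1 xx)).

(* [F xx] is the component of type [xx], a function of the word obtained by
   concatenating its input blocks. *)
Definition multi_family := seq (seq O) -> seq arrow -> tensors.

(* [F] belongs to Multi_d(A) and is homogeneous of degree [e].  The map [F xx],
   defined on words of type [xx], is extended by zero to all other words. *)
Record multi (d e : int) (F : multi_family) : Prop := Multi {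
  multi_linear : forall xx, multilinear (F xx);
  multi_support : forall xx w, ~~ (is_type xx && of_type xx w) -> F xx w = 0;
  multi_values : forall xx w,
    spanned (fun us => out_of_type xx us && (odeg d us == e + sdeg w)) (F xx w)
}.

Definition cyclic (d : int) (F : multi_family) : Prop :=
  forall xx w1 w2, is_type xx ->
    of_type (take 1 xx) w1 -> of_type (behead xx) w2 ->
    F xx (w1 ++ w2) =
      (-1) ^ (sdeg w1 * sdeg w2) *:
        tlift (fun us => let n1 := (size us).-1 in
                (-1) ^ (odeg d (take n1 us) * odeg d (drop n1 us)) *:
                  pure (rotr 1 us))
             (F (rot 1 xx) (w2 ++ w1)).

End Arrows.

Arguments tensors {k O} A.
Arguments multi_family {k O} A.

Lemma map_blk_iota (T : Type) (s : seq (seq T)) a b :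
  (a + b <= size s)%N -> [seq blk s i | i <- iota a.+1 b] = take b (drop a s).
Proof.
move=> h; have hb : (b <= size (drop a s))%N by rewrite size_drop leq_subRL ?(leq_trans (leq_addr b a)).
apply: (@eq_from_nth _ [::]); first by rewrite size_map size_iota size_takel.
move=> i; rewrite size_map size_iota => ib.
by rewrite (nth_map 0%N) ?size_iota // nth_iota // nth_take // nth_drop.
Qed.

(** * Diagrams with two discs *)

(* Exponent of the Koszul sign of the permutation taking the word [s] of
   distinct letters to its rearrangement [t]. *)
Definition koszul (I : eqType) (dg : I -> int) (s t : seq I) : int :=
  \sum_(i <- s)
    \sum_(j <- s | (index i s < index j s)%N && (index j t < index i t)%N)
      dg i * dg j.

(* Arms of a diagram whose G-disc is connected to the input of the F-disc
   between x^v_(j-1) and x^v_j.  [InF i] and [InG i] are the i-th input blocks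
   of the discs, [InL] and [InR] the inputs of the v-th block of F before and
   after the connected one, [OutF i] and [OutG i] the i-th outputs. *)
Inductive arm :=
  InF of nat | InL | InR | InG of nat | OutF of nat | OutG of nat.

Definition arm_code (a : arm) : nat * nat :=
  match a with
  | InF i => (0, i) | InL => (1, 0) | InR => (2, 0)
  | InG i => (3, i) | OutF i => (4, i) | OutG i => (5, i)
  end%N.
Definition arm_decode (c : nat * nat) : arm :=
  match c.1 with
  | 0 => InF c.2 | 1 => InL | 2 => InR
  | 3 => InG c.2 | 4 => OutF c.2 | _ => OutG c.2
  end%N.
Lemma arm_codeK : cancel arm_code arm_decode. Proof. by case. Qed.
HB.instance Definition _ := Equality.copy arm (can_type arm_codeK).

Section TwoDiscs.
Variables (k : fieldType) (O : choiceType) (A : quiver k O) (d : int).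
(* Types of the discs F and G; the output [c] of G is connected to the input
   of F between the entries [j.-1] and [j] of the block [v]. *)
Variables (xx yy : seq (seq O)) (c v j : nat).

Let n := size xx.
Let m := size yy.

(* The outputs of G met after the output [c], clockwise. *)
Definition after : seq nat := iota c.+1 (m - c) ++ iota 1 c.-1.

(* The free outputs clockwise, starting after the n-th output of F. *)
Definition frees : seq arm :=
  map OutF (iota 1 v.-1) ++ map OutG after ++ map OutF (iota v (n - v).+1).

(* The i-th sector lies between the free outputs i-1 and i; its inputs are
   read counterclockwise. *)
Definition sectors : seq (seq arm) :=
  [seq [:: InF i] | i <- iota 1 v.-1]
  ++ (if after is i0 :: l then
        [:: InG i0; InR] :: [seq [:: InG i] | i <- l] ++ [:: [:: InL; InG c]]
      else [:: [:: InL; InG c; InR]])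
  ++ [seq [:: InF i] | i <- iota v.+1 (n - v)].

(* The labellings of the free outputs are the rotations of [frees]: the
   rotation making [r] the last output, and the one making the sector of the
   arm [a] the first block. *)
Definition rooted_at (r : arm) : nat := (index r frees).+1.
Definition starting_at (a : arm) : nat := find (fun s => a \in s) sectors.

Definition objects (a : arm) : seq O :=
  match a with
  | InF i => blk xx i
  | InL => take (j - 2) (blk xx v)
  | InR => drop j (blk xx v)
  | InG i => blk yy i
  | _ => [::]
  end.

Definition arity (a : arm) : nat :=
  match a with
  | InF i => (size (blk xx i)).-1
  | InG i => (size (blk yy i)).-1
  | _ => size (objects a)
  end.

Definition diagram_type (t : nat) : seq (seq O) :=
  [seq flatten (map objects s) | s <- rot t sectors].

Definition letter (i : nat) (w : seq (arrow A)) : seq (arrow A) :=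
  take 1 (drop i.-1 w).

(* The map H such that s_(d+1) H is the evaluation of the diagram filled with
   [F], of degree [eF], and [G], its free outputs being labelled by the
   rotation [t].
   The shift at the root is the outermost map, so it does not occur in H.  The
   other shift is at the output [c] of G in an inner composition, and at the
   input of F in an outer composition.  In the latter case s_(d+1) F acts by
   (-1)^((d+1)|F|) F o (id (x) s_(d+1) (x) id), and the exchange of this map,
   of degree |F| - (d+1), with the shift at the root produces the sign
   (-1)^((|F|+d+1)(d+1)).  These signs belong to the composition (inner or
   outer) and do not depend on the labelling [t]. *)
Definition diagram (inner : bool) (eF : int) (F G : seq (arrow A) -> tensors A)
    (t : nat) (w : seq (arrow A)) : tensors A :=
  let inputs := flatten (rot t sectors) in
  let outputs := rot t frees in
  let piece (a : arm) := nth [::] (reshape (map arity inputs) w) (index a inputs) in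
  let gin := map InG (iota 1 m) in
  let fin1 := rcons (map InF (iota 1 v.-1)) InL in
  let fin2 := InR :: map InF (iota v.+1 (n - v)) in
  let gout := map OutG (iota 1 m) in
  let fout := map OutF (iota 1 n) in
  let gfree := [seq a <- gout | a != OutG c] in
  let words (l : seq arm) := flatten (map piece l) in
  (-1) ^ koszul (fun a => sdeg (piece a)) inputs (gin ++ fin1 ++ fin2) *:
  tlift (fun us : seq (arrow A) =>
    if size us != m then 0 else
    let dg (a : arm) :=
      match a with
      | OutG i => odeg d (letter i us) - (if inner && (i == c) then d + 1 else 0)
      | _ => sdeg (piece a)
      end in
    let shift :=
      if inner then (d + 1) * odeg d (take c.-1 us)
      else (d + 1) * eF + (eF + d + 1) * (d + 1) + (d + 1) * sdeg (words fin1) in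
    (-1) ^ (shift + koszul dg (gout ++ fin1 ++ fin2)
                              (fin1 ++ OutG c :: fin2 ++ gfree)) *:
    tlift (fun ws : seq (arrow A) =>
      if size ws != n then 0 else
      let out (a : arm) :=
        match a with
        | OutG i => letter i us
        | OutF i => letter i ws
        | _ => [::]
        end in
      (-1) ^ koszul (fun a => odeg d (out a)) (fout ++ gfree) outputs *:
      pure (flatten (map out outputs)))
      (F (words fin1 ++ letter c us ++ words fin2)))
    (G (words gin)).

End TwoDiscs.

Arguments diagram {k O A} d xx yy c v j inner eF F G t w.

Section Compositions.
Variables (k : fieldType) (O : choiceType) (A : quiver k O) (d eF : int).
Variables (F G : multi_family A).
Implicit Types (xx yy : seq (seq O)) (v j : nat).

(* (x^1 |_| x^n, x^2, ..., x^(n-1)), for n >= 2. *)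
Definition prime xx : seq (seq O) :=
  (blk xx 1 ++ blk xx (size xx)) :: take (size xx - 2) (behead xx).

Definition inn_rot xx yy v : nat :=
  rooted_at xx yy (size yy) v (OutF (size xx)).

(* It is the type read off the diagram, see [inn_typeE]. *)
Definition inn_type xx yy v j : seq (seq O) :=
  let m := size yy in
  take v.-1 xx
  ++ (if m == 1%N then
        [:: take (j - 2) (blk xx v) ++ blk yy 1 ++ drop j (blk xx v)]
      else
        (blk yy 1 ++ drop j (blk xx v)) :: take (m - 2) (behead yy)
          ++ [:: take (j - 2) (blk xx v) ++ blk yy m])
  ++ drop v xx.

Definition inn_comp xx yy v j : seq (arrow A) -> tensors A :=
  diagram d xx yy (size yy) v j true eF (F xx) (G yy) (inn_rot xx yy v).

(* The inner composition of F^(x') and G^y along the same two arrows, its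
   first block being the sector containing the input b of F^(x') that lies
   between x^1 and x^n.  There is no F^(x') if n = 1. *)
Definition inn_comp' xx yy v j : seq (arrow A) -> tensors A :=
  if (size xx < 2)%N then fun=> 0 else
  let last_block := v == size xx in
  let v' := if last_block then 1%N else v in
  let j' := if last_block then (size (blk xx 1) + j)%N else j in
  let b := if last_block then InL else if v == 1%N then InR else InF 1 in
  diagram d (prime xx) yy (size yy) v' j' true eF (F (prime xx)) (G yy)
    (starting_at (prime xx) yy (size yy) v' b).

Definition out_rot xx yy v : nat := rooted_at xx yy v 1 (OutG (size yy)).

Definition out_type xx yy v j : seq (seq O) :=
  take v.-1 yy
  ++ (take (j - 2) (blk xx 1) ++ blk yy v) :: behead xx
  ++ (blk yy v.+1 ++ drop j (blk xx 1)) :: drop v.+1 yy.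

Definition out_comp xx yy v j : seq (arrow A) -> tensors A :=
  diagram d xx yy v 1 j false eF (F xx) (G yy) (out_rot xx yy v).

(* Here b lies in the first block y^1 |_| y^m of G^(y'). *)
Definition out_comp' xx yy v j : seq (arrow A) -> tensors A :=
  diagram d xx (prime yy) v 1 j false eF (F xx) (G (prime yy))
    (starting_at xx (prime yy) v 1 (InG 1)).

Lemma objects_InF xx yy v j a b : (a + b <= size xx)%N ->
  [seq flatten (map (objects xx yy v j) s) | s <- [seq [:: InF i] | i <- iota a.+1 b]]
    = take b (drop a xx).
Proof.
move=> h; rewrite -map_blk_iota // -map_comp.
by apply: eq_map => i /=; rewrite cats0.
Qed.

Lemma objects_InG xx yy v j a b : (a + b <= size yy)%N ->
  [seq flatten (map (objects xx yy v j) s) | s <- [seq [:: InG i] | i <- iota a.+1 b]]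
    = take b (drop a yy).
Proof.
move=> h; rewrite -map_blk_iota // -map_comp.
by apply: eq_map => i /=; rewrite cats0.
Qed.

Lemma inn_typeE xx yy v j : (0 < v <= size xx)%N -> (0 < size yy)%N ->
  inn_type xx yy v j = diagram_type xx yy (size yy) v j (inn_rot xx yy v).
Proof.
move=> /andP[v0 vn] m0.
have sz : size (sectors xx yy (size yy) v) = size (frees xx yy (size yy) v).
  rewrite /sectors /frees /after subnn /= !size_cat !size_map !size_iota.
  case: (size yy) m0 => [|[|m]] //= _; rewrite ?size_cat ?size_map ?size_iota /=; lia.
rewrite /inn_type /diagram_type rot_oversize; last first.
  have last_iota : iota v (size xx - v).+1 = iota v (size xx - v) ++ [:: size xx].
    by rewrite -addn1 iotaD subnKC.
  rewrite sz /inn_rot /rooted_at /frees last_iota map_cat /= !catA.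
  rewrite index_cat size_cat /= eqxx addn0 addn1 ifN // !mem_cat.
  apply/negP => /orP[/orP[]|] /mapP[i] //; rewrite mem_iota => + [ni]; lia.
rewrite /sectors /after subnn /= !map_cat objects_InF ?drop0; last by lia.
rewrite objects_InF ?subnKC // [take (size xx - v) _]take_oversize ?size_drop //.
congr (_ ++ (_ ++ _)); case: ifP => [/eqP -> /=|m1]; first by rewrite cats0.
have -> : (size yy).-1 = (size yy - 2).+1 by lia.
rewrite /= map_cat /= !cats0 objects_InG; last by lia.
by rewrite drop1.
Qed.

Lemma out_typeE xx yy v j : (0 < size xx)%N -> (0 < v < size yy)%N ->
  out_type xx yy v j = diagram_type xx yy v 1 j (out_rot xx yy v).
Proof.
move=> n0 /andP[v0 vm].
have [p mE] : exists p, size yy = (v + p.+1)%N by exists (size yy - v).-1; lia.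
have e : after yy v = rcons (iota v.+1 p) (size yy) ++ iota 1 v.-1.
  rewrite /after mE addKn -cats1 -[p.+1]addn1 iotaD /= addn1.
  by congr ((_ ++ [:: _]) ++ _); lia.
have r : out_rot xx yy v = p.+1.
  rewrite /out_rot /rooted_at /frees /= e -cats1 !map_cat -!catA index_cat /=.
  rewrite eqxx size_map size_iota addn0 ifN //.
  apply/negP => /mapP[i]; rewrite mem_iota => + [ni]; lia.
rewrite /diagram_type r /sectors /after mE addKn /= -/(iota _ _) map_cat -!catA.
set s1 := [seq [:: InG i] | i <- iota v.+2 p].
have s1p : p.+1 = size ([:: InG v.+1; InR] :: s1) by rewrite /= size_map size_iota.
rewrite -cat_cons s1p rot_size_cat !map_cat map_cons !objects_InG /=; try lia.
rewrite objects_InF ?subnKC // drop0 !cats0 drop1.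
rewrite [take (size xx - 1) _]take_oversize ?size_behead ?subn1 //.
rewrite /s1 objects_InG; last by lia.
rewrite [take p _]take_oversize ?size_drop ?mE; last by lia.
by rewrite /out_type -!catA.
Qed.

End Compositions.

(** * The quiver A (+) A^*[d-1] *)

Section Forms.
Variables (k : fieldType) (U : lmodType k).

Definition linears : {pred U -> k^o} := fun f => `[< linear f >].

Lemma linears_submod : GRing.submod_closed linears.
Proof.
split; first by apply/asboolP => a u v; rewrite scaler0 addr0.
move=> a f g /asboolP lf /asboolP lg; apply/asboolP => b u v.
change (a *: f (b *: u + v) + g (b *: u + v) =
  b *: (a *: f u + g u) + (a *: f v + g v)).
by rewrite lf lg !scalerDr !scalerA [b * a]mulrC addrACA.
Qed.
HB.instance Definition _ :=
  GRing.isSubmodClosed.Build k (U -> k^o) linears linears_submod.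

Record form := Form {
  form_fun :> U -> k^o;
  form_linear : form_fun \in linears
}.
HB.instance Definition _ := [isSub for form_fun].
HB.instance Definition _ := [Choice of form by <:].
HB.instance Definition _ := [SubChoice_isSubLmodule of form by <:].

(* [f] as a linear form; [0] if [f] is not linear. *)
Definition to_form (f : U -> k^o) : form := insubd (0 : form) f.

End Forms.

Section Bimodule.
Variables (k : fieldType) (O : choiceType) (A : quiver k O) (d : int).

Definition qdual : quiver k O := fun y x e => form (A x y (- e)).
Definition shiftq (e : int) (B : quiver k O) : quiver k O :=
  fun y x i => B y x (e + i).
Definition dsum (B C : quiver k O) : quiver k O :=
  fun y x i => (B y x i * C y x i)%type.

Definition ext : quiver k O := dsum A (shiftq (d - 1) qdual).

End Bimodule.

(** * Families of multilinear maps and Gerstenhaber insertion *)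

Section Cochains.
Variables (k : fieldType) (O : choiceType) (Q : quiver k O).

(* [f w y x i] is the component in [Q y x i] (so in degree [i - 1] of Q[1]) of
   the value of f on the word [w] in Q[1]. *)
Definition cochain := seq (arrow Q) -> forall y x i, Q y x i.

(* Insertion of [g], homogeneous of degree [eg] as a map on words in Q[1] and
   of arity [q], in the slot of [f] with [r] inputs to its right. *)
Definition insertion (eg : int) (q r : nat) (f g : cochain) : cochain :=
  fun w y x i =>
    let p := (size w - (q + r))%N in
    let left_ := take p w in
    let mid := take q (drop p w) in
    let right_ := drop (p + q) w in
    if mid is a :: mid' then
      let sg := g mid (tgt a) (src (last a mid')) (eg + sdeg mid + 1) in
      (-1) ^ (eg * sdeg left_) *: f (left_ ++ Arrow sg :: right_) y x i
    else 0.

End Cochains.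

(** * The map j *)

Section MapJ.
Variables (k : fieldType) (O : choiceType) (A : quiver k O) (d : int).
Local Notation Q := (ext A d).

Definition toA (q : arrow Q) : arrow A :=
  Arrow (y := tgt q) (x := src q) (i := deg q) (tagged q).1.

(* The linear form f o s_d on A[-d], for q = tf. *)
Definition pairing (q : arrow Q) (a : arrow A) : k :=
  ((tagged q).2 : form (A (src q) (tgt q) (- (d - 1 + deg q)))) (component _ _ _ a).

(* Exponent of the Koszul sign in (f_1 (x) ... (x) f_n)(u_1 (x) ... (x) u_n),
   for given degrees of the f_k and the u_i. *)
Definition apply_sign (fs us : seq int) : int :=
  \sum_(0 <= l < size fs) \sum_(0 <= i < l) fs`_l * us`_i.

Section Words.
Variables (xx : seq (seq O)) (w : seq (arrow Q)).
Let n := size xx.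

(* [w] has block type [xx]: its objects read from left to right are those of
   x^n, ..., x^1. *)
Definition block_word : bool := map (@endpoints _ _ Q) w == pairs (flatten (rev xx)).

(* The i-th chunk is sa^i followed by tf^(i-1) (if i > 1). *)
Definition chunk (i : nat) : seq (arrow Q) :=
  blk (rev (reshape (rev (map size xx)) w)) i.
Definition sa (i : nat) : seq (arrow Q) := take (size (blk xx i)).-1 (chunk i).
Definition tf (i : nat) : seq (arrow Q) :=
  drop (size (blk xx i.+1)).-1 (chunk i.+1).

Definition tfs : seq (arrow Q) := flatten [seq tf i | i <- iota 1 n.-1].
Definition saA (i : nat) : seq (arrow A) := map toA (sa i).

Definition epsilon (e : int) : int :=
  \sum_(1 <= i < n) sdeg (tf i) * (\sum_(i.+1 <= l < n.+1) sdeg (sa l))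
  + e * (\sum_(1 <= i < n) sdeg (tf i))
  + d * (n%:Z - 1)
  + \sum_(1 <= i < n.+1) \sum_(i.+1 <= l < n.+1) sdeg (sa i) * sdeg (sa l)
  + \sum_(1 <= i < n) \sum_(i.+1 <= l < n) sdeg (tf i) * sdeg (tf l).

(* [b] is the degree |sb|. *)
Definition delta (e b : int) : int :=
  epsilon e
  + d * (e + \sum_(1 <= i < n.+1) sdeg (sa i))
  + (sdeg (sa n) + b) * (\sum_(2 <= i < n) sdeg (sa i))
  + sdeg (sa n) * b.

(* The scalar (f^1 o s_d (x) ...)(u_1 (x) ...) without its Koszul sign. *)
Definition contract (us : seq (arrow A)) : k :=
  \prod_(p <- zip tfs us) pairing p.1 p.2.

Definition jA (e : int) (phi : seq (arrow A) -> tensors A) y x i : A y x i :=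
  if ~~ block_word then 0 else
  (-1) ^ epsilon e *:
  tlift (fun us : seq (arrow A) =>
    if size us != n then 0 else
    if us is u :: us' then
      ((-1) ^ apply_sign (rcons [seq sdeg [:: q] | q <- tfs] (- d))
                         [seq odeg d [:: a] | a <- us] * contract us) *:
      component y x i (last u us')
    else 0)
    (phi (flatten [seq saA l | l <- iota 1 n])).

(* The underlying form g in A^* of the value s_(d-1) g.  The first sign is
   that of the isomorphism turning s_(d-1) g into a form on A[1-d]. *)
Definition jD (e : int) (phi' : seq (arrow A) -> tensors A) y x i :
    shiftq (d - 1) (qdual A) y x i :=
  if ~~ block_word || (n < 2)%N then 0 else
  to_form (fun b : A x y (- (d - 1 + i)) =>
    (-1) ^ ((d - 1) * (d - 1 + i)) *
    ((-1) ^ delta e (- (d - 1 + i) - 1) *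
     tlift (fun us : seq (arrow A) =>
       (if size us != n.-1 then 0 else
        (-1) ^ apply_sign [seq sdeg [:: q] | q <- tfs]
                          [seq odeg d [:: a] | a <- us] * contract us) : k^o)
       (phi' (saA 1 ++ Arrow b :: saA n
              ++ flatten [seq saA l | l <- iota 2 (n - 2)])))).

End Words.

(* The component of block type [xx] of j(s_(d+1) phi), for phi of degree [e],
   its two parts being built from [phi] and [phi']. *)
Definition j_parts (e : int) (xx : seq (seq O)) (phi phi' : seq (arrow A) -> tensors A) :
    cochain Q :=
  fun w y x i => (jA xx w e phi y x i, jD xx w e phi' y x i).

Definition j_comp (e : int) (xx : seq (seq O)) (F : multi_family A) : cochain Q :=
  j_parts e xx (F xx) (F (prime xx)).

Definition piA (f : cochain Q) : cochain Q := fun w y x i => ((f w y x i).1, 0).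
Definition piD (f : cochain Q) : cochain Q := fun w y x i => (0, (f w y x i).2).

End MapJ.

Arguments j_parts {k O A} d e xx phi phi' w y x i : rename.
Arguments j_comp {k O A} d e xx F w y x i : rename.

(* (x^1_(<= j-1), x^2, ..., x^n, x^1_(>= j)) *)
Definition split_block1 (O : Type) (xx : seq (seq O)) (j : nat) : seq (seq O) :=
  take j.-1 (blk xx 1) :: rcons (behead xx) (drop j.-1 (blk xx 1)).

(* Main.v *)
Require Import Defs.
From HB Require Import structures.
From mathcomp Require Import all_boot all_algebra.
From mathcomp Require Import boolp zify ring.
From Stdlib Require Import Btauto.
(* Imported again so that [prime] is the operation on types. *)
Require Import Defs.
Set Implicit Arguments.
Unset Strict Implicit.
Unset Printing Implicit Defensive.
Import GRing.Theory.
Local Open Scope ring_scope.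

(** Both identities say that an operation on outputs may be carried out in two
    orders.  On a word of block type, j(phi) is, up to a sign, the contraction of
    the outputs of phi with the forms of the word; the output that is left, if
    any, is the value in A, and if no output is left the contraction is a scalar
    depending linearly on the extra input b, that is a form ([jA_assemble] and
    [jD_assemble]).

    In an inner composition the word is cut at a subword of the type of G.  The
    forms of this subword contract all the outputs of G but the connected one,
    and as F is linear in its inputs, contracting before or after applying F
    makes no difference: F receives the vector that is the part valued in A of
    j(G) ([inner_diagram]).  In an outer composition the subword contains the
    forms contracting all the outputs of F.  What remains of F is a form in the
    connected input, which is the part valued in forms of j(F) on the split type,
    and the connected output of G is read by it in the same way as the other
    outputs of G are read by the forms of the word ([outer_diagram]).  If the
    objects do not match at the connection, F or G has no component there, or a
    form reads an element of the wrong endpoints, and both sides vanish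
    ([inner_transfer] and [outer_transfer]).

    The rest of the proof is the comparison of signs.  The permutations in the
    evaluation of a diagram move groups of consecutive arms, so their Koszul
    exponents only involve the total degrees of these groups ([koszul_flatten]
    and [tlift_diagram]).  A contraction that does not vanish determines the
    degrees of the contracted outputs, and the degrees of F and G that of the
    remaining one.  All exponents thus become quadratic polynomials in the
    degrees of the blocks, which are compared modulo 2.  There are finitely many
    such comparisons, according to whether G has one or several blocks and, for
    the part valued in forms, whether the connected block is the first, the last
    or another one: the input b fixes which sector comes first, and the cyclic
    order of the arms depends on it. *)

(** * Linear maps induced on tensors *)
Section Tensors.
Variables (k : fieldType) (O : choiceType) (A : quiver k O).
Implicit Types (W V : lmodType k) (w us l r : seq (arrow A)).

Lemma tlift_sum W (h : seq (arrow A) -> W) u :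
  tlift h u = \sum_(c <- generic_quotient.repr u) c.1 *: h c.2.
Proof. by []. Qed.

Lemma eq_tlift W (g h : seq (arrow A) -> W) u : g =1 h -> tlift g u = tlift h u.
Proof. by move=> gh; rewrite !tlift_sum; apply: eq_bigr => c _; rewrite gh. Qed.

(** [tlift h u] is a finite sum over a representative of [u], so this needs no
    multilinearity of [h]. *)
Lemma linear_tlift W V (f : W -> V) (h : seq (arrow A) -> W) u :
  linear f -> f (tlift h u) = tlift (fun w => f (h w)) u.
Proof.
move=> lf; have f0 : f 0 = 0.
  by have := lf (-1) 0 0; rewrite scaler0 addr0 scaleN1r addNr.
rewrite !tlift_sum; elim: (generic_quotient.repr u) => [|c s IH].
  by rewrite !big_nil.
by rewrite !big_cons lf IH.
Qed.

Lemma scale_linear W (c : k) : linear (fun x : W => c *: x).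
Proof. by move=> a x y; rewrite scalerDr !scalerA mulrC. Qed.

Lemma tlift_scaler W (c : k) (h : seq (arrow A) -> W) u :
  tlift (fun w => c *: h w) u = c *: tlift h u.
Proof.
by rewrite -(linear_tlift _ _ (@scale_linear W c)).
Qed.

Lemma tlift0 W (u : tensors A) : tlift (fun=> 0 : W) u = 0.
Proof. by rewrite tlift_sum big1 // => c _; rewrite scaler0. Qed.

Lemma tliftZ W (h : seq (arrow A) -> W) (c : k) u :
  multilinear h -> tlift h (c *: u) = c *: tlift h u.
Proof. by move=> mh; exact: (tlift_scale mh c u). Qed.

Lemma tlift_tlift W (h : seq (arrow A) -> W) (g : seq (arrow A) -> tensors A) u :
  multilinear h -> tlift h (tlift g u) = tlift (fun w => tlift h (g w)) u.
Proof. by move=> mh; rewrite (linear_tlift (f := tlift h)) //; apply: tlift_linear. Qed.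

Lemma tlift_sumE W (h : seq (arrow A) -> W) (s : presum A) :
  multilinear h ->
  tlift h (\sum_(c <- s) c.1 *: pure c.2) = \sum_(c <- s) c.1 *: h c.2.
Proof.
move=> mh; elim: s => [|c s IH]; first by rewrite !big_nil; apply: tlift_zero.
by rewrite !big_cons (tlift_linear mh) IH tlift_pure.
Qed.

(** Values of a family in Multi are spanned by words with prescribed endpoints and
    total degree.  Two integrands that agree on those words only may therefore be
    exchanged; all comparisons of signs below rely on the degree so obtained. *)
Lemma eq_tlift_spanned W (P : pred (seq (arrow A))) (g h : seq (arrow A) -> W) u :
  multilinear g -> multilinear h -> spanned P u ->
  (forall w, P w -> g w = h w) -> tlift g u = tlift h u.
Proof.
move=> mg mh [s Ps ->] gh; rewrite !tlift_sumE // big_seq [RHS]big_seq.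
by apply: eq_bigr => c cs; rewrite gh //; apply: (allP Ps).
Qed.

Lemma multilinear_guard W m (h : seq (arrow A) -> W) :
  multilinear h -> multilinear (fun us => if size us != m then 0 else h us).
Proof.
move=> mh l r y x i a b c; rewrite !size_cat /=.
by case: ifP => _; rewrite ?scaler0 ?addr0 // mh.
Qed.

(** A map of words that moves letters according to the lengths of words only, so
    that the place of a letter does not change with the letter. *)
Definition rearrangement (p : seq (arrow A) -> seq (arrow A)) :=
  forall l r, exists l' r', forall a, p (l ++ a :: r) = l' ++ a :: r'.

Lemma multilinear_rearrange W p (h : seq (arrow A) -> W) :
  rearrangement p -> multilinear h -> multilinear (fun us => h (p us)).
Proof.
move=> tp mh l r y x i; have [l' [r' e]] := tp l r.
by move=> a b c; rewrite !e mh.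
Qed.

Lemma component_Arrow y x i (a : A y x i) : component y x i (Arrow a) = a.
Proof.
have e : tag (Arrow a) = (y, x, i) by [].
by rewrite /component (untagE _ _ e); apply: (eq_from_Tagged (etaggedK e)).
Qed.

Lemma component_neq y x i (u : arrow A) : tag u != (y, x, i) -> component y x i u = 0.
Proof.
move=> ne; rewrite /component /untag; case: eqP => // e.
by rewrite e eqxx in ne.
Qed.

Lemma Arrow_component y x i (u : arrow A) :
  tag u = (y, x, i) -> Arrow (component y x i u) = u.
Proof. by case: u => [[[y' x'] i'] a] /= [ey ex ei]; subst; rewrite component_Arrow. Qed.

Lemma component_linear y x i y' x' i' :
  linear (fun a : A y' x' i' => component y x i (Arrow a)).
Proof.
have [[-> -> ->]|ne] := eqVneq (y', x', i') (y, x, i); move=> c a b.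
  by rewrite !component_Arrow.
by rewrite !component_neq // scaler0 addr0.
Qed.

Lemma multilinear_at W (f : seq (arrow A) -> W) l r y x i (c : k) (a : A y x i) :
  multilinear f -> f (l ++ Arrow (c *: a) :: r) = c *: f (l ++ Arrow a :: r).
Proof.
move=> mf; have := mf l r y x i c a 0; rewrite addr0 => ->.
have := mf l r y x i (-1) 0 0; rewrite scaler0 addr0 scaleN1r addNr => ->.
by rewrite addr0.
Qed.

Lemma multilinear_at0 W (f : seq (arrow A) -> W) l r y x i :
  multilinear f -> f (l ++ Arrow (0 : A y x i) :: r) = 0.
Proof. by move=> mf; rewrite -(scale0r (0 : A y x i)) multilinear_at // scale0r. Qed.

End Tensors.

(** * Signs and Koszul exponents *)
(** Signs only depend on the parity of their exponents, and parity is a ring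
    morphism to the field with two elements.  Equalities of signs thus become
    equalities of Boolean polynomials. *)
Definition parity (x : int) : bool := odd `|x|%N.

Lemma parityD x y : parity (x + y) = xorb (parity x) (parity y).
Proof.
have -> a b : xorb a b = a (+) b by case: a; case: b.
rewrite /parity; lia.
Qed.

Lemma parityM x y : parity (x * y) = parity x && parity y.
Proof. by rewrite /parity abszM oddM. Qed.

Lemma parityN x : parity (- x) = parity x.
Proof. by rewrite /parity abszN. Qed.

Lemma parity0 : parity 0 = false. Proof. by []. Qed.
Lemma parity1 : parity 1 = true. Proof. by []. Qed.

Lemma sign_parity (R : unitRingType) (x : int) : (-1 : R) ^ x = (-1) ^+ parity x.
Proof. by case: x => n; rewrite /parity signr_odd // /exprz invr_sign. Qed.

Lemma sign_mul (R : unitRingType) (x y : int) : (-1 : R) ^ x * (-1) ^ y = (-1) ^ (x + y).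
Proof.
rewrite !sign_parity -signr_addb parityD; congr (_ ^+ nat_of_bool _).
by case: (parity x); case: (parity y).
Qed.

Lemma eq_sign (R : unitRingType) (x y : int) :
  parity x = parity y -> (-1 : R) ^ x = (-1) ^ y.
Proof. by rewrite !sign_parity => ->. Qed.

Ltac parity_ring :=
  rewrite ?(parityD, parityN, parityM, parity0, parity1); btauto.

Ltac sign_congruence := apply: eq_sign; parity_ring.

Section Koszul.
Variables (I J : eqType).

(** [col] recovers the block of a letter, so the order of two letters of distinct
    blocks is the order of their blocks. *)
Lemma index_flatten_lt (f : J -> seq I) (S : seq J) (col : I -> J) a b i j :
  {in S, forall c, all (fun i => col i == c) (f c)} ->
  a \in S -> b \in S -> i \in f a -> j \in f b ->
  (index i (flatten (map f S)) < index j (flatten (map f S)))%N =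
  if a == b then (index i (f a) < index j (f a))%N else (index a S < index b S)%N.
Proof.
move=> + aS bS ia jb; have cE (s : seq J) (c : J) (h : I) : {in s, forall c, all (fun i => col i == c) (f c)} ->
    c \in s -> h \in f c -> col h = c.
  by move=> H cs hc; apply/eqP/(allP (H c cs)).
elim: S aS bS => // c S IH aS bS H.
have ca := cE _ _ _ H aS ia; have cb := cE _ _ _ H bS jb.
have memE d h : col h = d -> d \in c :: S -> h \in f d -> (h \in f c) = (c == d).
  move=> cd dS hd; apply/idP/eqP => [hc|->//].
  by rewrite -cd (cE _ _ _ H _ hc) ?mem_head.
have H' : {in S, forall c, all (fun i => col i == c) (f c)}.
  by move=> d dS; apply: H; rewrite in_cons dS orbT.
rewrite /= !index_cat (memE _ _ ca aS ia) (memE _ _ cb bS jb).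
have [ac|nac] := eqVneq c a; have [bc|nbc] := eqVneq c b.
- by rewrite -ac -bc eqxx.
- rewrite -ac (negPf nbc) ltn0Sn (leq_trans _ (leq_addr _ _)) // ac index_mem //.
- by rewrite -bc eq_sym (negPf nac) ltn0 ltnNge (leq_trans (ltnW _) (leq_addr _ _)) // index_mem bc.
rewrite ltn_add2l ltnS IH //.
  by move: aS; rewrite in_cons eq_sym (negPf nac).
by move: bS; rewrite in_cons eq_sym (negPf nbc).
Qed.

(** A permutation that moves blocks as a whole keeps the order inside each block:
    only pairs of letters in distinct blocks are exchanged, and their degrees
    add up.  Koszul exponents over an arbitrary number of letters are thereby
    reduced to permutations of a fixed number of blocks. *)
Lemma koszul_flatten (dg : I -> int) (f : J -> seq I) (col : I -> J) (S T : seq J) :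
  {in S, forall a, all (fun i => col i == a) (f a)} -> S =i T ->
  koszul dg (flatten (map f S)) (flatten (map f T)) =
  koszul (fun a => \sum_(i <- f a) dg i) S T.
Proof.
move=> H ST.
have H' : {in T, forall a, all (fun i => col i == a) (f a)}.
  by move=> a aT; apply: H; rewrite ST.
rewrite /koszul big_flatten /= big_map; apply: eq_big_seq => a aS.
under eq_bigr => i _ do rewrite big_mkcond big_flatten /= big_map.
rewrite exchange_big [RHS]big_mkcond /=; apply: eq_big_seq => b bS.
have bT : b \in T by rewrite -ST.
have aT : a \in T by rewrite -ST.
under eq_big_seq => i ia do under eq_big_seq => j jb do
  rewrite (index_flatten_lt H aS bS ia jb) (index_flatten_lt H' bT aT jb ia).
have [<-|nab] := eqVneq a b.
  rewrite !ltnn /= big1 // => i _; rewrite big1 // => j _.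
  by case: ltnP => //= h; case: ltnP => // /(ltn_trans h); rewrite ltnn.
case: ifP => _; last by rewrite big1 // => i _; rewrite big1.
by rewrite mulr_suml; apply: eq_bigr => i _; rewrite mulr_sumr.
Qed.

End Koszul.

(** * Words with prescribed blocks and their degrees *)
Section Assemble.
Variable (T : Type).
Implicit Types (SS : seq (seq T)) (TT s : seq T).

(** The word (s_n, t_(n-1), s_(n-1), ..., t_1, s_1) of the blocks s_1, ..., s_n
    separated by the letters t_1, ..., t_(n-1). *)
Fixpoint assemble SS TT : seq T :=
  match SS, TT with
  | s :: SS', t :: TT' => assemble SS' TT' ++ t :: s
  | s :: _, [::] => s
  | [::], _ => [::]
  end.

Lemma assemble_cat SS1 s SS2 TT1 TT2 : size SS1 = size TT1 ->
  assemble (SS1 ++ s :: SS2) (TT1 ++ TT2) =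
  assemble (s :: SS2) TT2 ++ assemble (rcons SS1 [::]) TT1.
Proof.
elim: SS1 TT1 => [|s1 SS1 IH] [|t TT1] //=; first by rewrite cats0.
by move=> [e]; rewrite IH // -catA.
Qed.

Lemma assemble_head s s' SS TT :
  assemble ((s ++ s') :: SS) TT = assemble (s :: SS) TT ++ s'.
Proof. by case: TT => [|t TT] //=; rewrite -catA. Qed.

Lemma size_assemble SS TT : size SS = (size TT).+1 ->
  size (assemble SS TT) = (sumn (shape SS) + size TT)%N.
Proof.
elim: SS TT => [|s SS IH] [|t TT] //=; first by case: SS IH => //= _; rewrite !addn0.
by move=> [e]; rewrite size_cat IH //=; lia.
Qed.

(** Every word of the right length is cut into blocks of prescribed sizes, so that
    it suffices to treat assembled words. *)
Lemma assemble_surj (ns : seq nat) w :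
  size w = (sumn [seq n.+1 | n <- ns]).-1 -> ns != [::] ->
  exists SS TT, [/\ w = assemble SS TT, shape SS = ns & size SS = (size TT).+1].
Proof.
elim: ns w => [|n ns IH] w // sw _; case: ns IH sw => [|n' ns] IH sw.
  by exists [:: w], [::]; split => //=; rewrite sw /= addn0.
set N := n' :: ns in IH sw; have sw' : size w = (sumn [seq p.+1 | p <- N] + n)%N.
  by rewrite sw /=; lia.
have N0 : (0 < sumn [seq p.+1 | p <- N])%N by rewrite /=; lia.
set q := (sumn [seq p.+1 | p <- N]) in sw' N0 *.
have [SS [TT [e1 e2 e3]]] := IH (take q.-1 w) ltac:(rewrite size_takel //; lia) isT.
have sd : size (drop q.-1 w) = n.+1 by rewrite size_drop; lia.
case ed : (drop q.-1 w) sd => [|t s] //= [ss].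
exists (s :: SS), (t :: TT); split => //=; last by rewrite e3.
  by rewrite -e1 -ed cat_take_drop.
by rewrite e2 ss.
Qed.

Definition chunks SS TT := [seq p.1 ++ [:: p.2] | p <- zip SS TT].

Lemma assembleE s SS TT : size SS = size TT ->
  assemble (s :: SS) TT = flatten (rev (chunks SS TT)) ++ s.
Proof.
elim: SS s TT => [|s' SS IH] s [|t TT] // [e]; rewrite /chunks.
rewrite [LHS](_ : _ = assemble (s' :: SS) TT ++ t :: s) // IH //.
by rewrite /= rev_cons -cats1 flatten_cat /= cats0 -!catA.
Qed.

Lemma reshape_rcons_take sh n s :
  reshape (rcons sh n) s = rcons (reshape sh s) (take n (drop (sumn sh) s)).
Proof.
by elim: sh s => [|m sh IH] s /=; rewrite ?drop0 // IH drop_drop addnC.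
Qed.

Lemma flattenK_cat (ss : seq (seq T)) s : reshape (shape ss) (flatten ss ++ s) = ss.
Proof.
by elim: ss => //= t ss IH; rewrite -catA take_size_cat // drop_size_cat // IH.
Qed.

Lemma reshape_assemble (ns : seq nat) SS TT :
  ns = [seq (size s).+1 | s <- SS] -> size SS = (size TT).+1 ->
  rev (reshape (rev ns) (assemble SS TT)) = head [::] SS :: chunks (behead SS) TT.
Proof.
case: SS => [|s SS] // -> [e]; rewrite assembleE //= rev_cons.
have -> : rev [seq (size u).+1 | u <- SS] = shape (rev (chunks SS TT)).
  rewrite /shape map_rev; congr rev; elim: SS TT e => [|u SS IH] [|t TT] //= [e].
  by rewrite size_cat addn1 -IH.
rewrite reshape_rcons_take flattenK_cat rev_rcons revK -size_flatten.
by rewrite drop_size_cat // take_oversize.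
Qed.

End Assemble.

Definition sumz (l : seq int) : int := \sum_(x <- l) x.

(** The second elementary symmetric function of the list. *)
Fixpoint pairsum (l : seq int) : int :=
  if l is x :: l' then x * sumz l' + pairsum l' else 0.

(** The sum of t_i s_k over i < k: the exponent of the permutation bringing the
    forms of a word of block type to its left. *)
Fixpoint crosssum (ts ss : seq int) : int :=
  match ts, ss with
  | t :: ts', s :: ss' => t * sumz ss' + crosssum ts' ss'
  | _, _ => 0
  end.

Lemma sumz_cons x l : sumz (x :: l) = x + sumz l.
Proof. exact: big_cons. Qed.
Lemma sumz_nil : sumz [::] = 0. Proof. exact: big_nil. Qed.
Lemma sumz_cat l1 l2 : sumz (l1 ++ l2) = sumz l1 + sumz l2.
Proof. exact: big_cat. Qed.
Lemma sumz_rcons l x : sumz (rcons l x) = sumz l + x.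
Proof. by rewrite -cats1 sumz_cat sumz_cons sumz_nil addr0. Qed.

Lemma pairsum_cat l1 l2 :
  pairsum (l1 ++ l2) = pairsum l1 + pairsum l2 + sumz l1 * sumz l2.
Proof.
elim: l1 => [|x l1 IH] /=; first by rewrite sumz_nil mul0r add0r addr0.
by rewrite IH sumz_cat sumz_cons; ring.
Qed.

Lemma crosssum_cat t1 t2 s1 s2 : size t1 = size s1 ->
  crosssum (t1 ++ t2) (s1 ++ s2) =
  crosssum t1 s1 + crosssum t2 s2 + sumz t1 * sumz s2.
Proof.
elim: t1 s1 => [|t t1 IH] [|s s1] //= => [_|[e]].
  by rewrite sumz_nil mul0r add0r addr0.
by rewrite IH // sumz_cat sumz_cons; ring.
Qed.

Lemma big_nat_sumz (l : seq int) : \sum_(0 <= i < size l) l`_i = sumz l.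
Proof. by rewrite /sumz [RHS](big_nth 0). Qed.

Lemma pairsumE (l : seq int) :
  \sum_(0 <= i < size l) \sum_(i.+1 <= j < size l) l`_i * l`_j = pairsum l.
Proof.
elim: l => [|x l IH]; first by rewrite big_nil.
rewrite big_nat_recl //= big_add1 /= -mulr_sumr big_nat_sumz; congr (_ + _).
by rewrite -IH; apply: eq_bigr => i _; rewrite big_add1.
Qed.

Lemma crosssumE (ts ss : seq int) : (size ts <= size ss)%N ->
  \sum_(0 <= i < size ts) ts`_i * \sum_(i.+1 <= j < size ss) ss`_j = crosssum ts ss.
Proof.
elim: ts ss => [|t ts IH] [|s ss] //= => [_|_|h]; rewrite ?big_nil //.
rewrite big_nat_recl //= big_add1 /= big_nat_sumz; congr (_ + _).
by rewrite -IH //; apply: eq_bigr => i _; rewrite big_add1.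
Qed.

Lemma apply_sign_rcons fs us f :
  apply_sign (rcons fs f) us = apply_sign fs us + f * \sum_(0 <= i < size fs) us`_i.
Proof.
rewrite /apply_sign size_rcons big_nat_recr //=; congr (_ + _).
  apply: eq_big_nat => l /andP[_ lt]; apply: eq_bigr => i _.
  by rewrite nth_rcons lt.
by rewrite mulr_sumr; apply: eq_bigr => i _; rewrite nth_rcons ltnn eqxx.
Qed.

(** Forms that read nonzero values read elements of opposite degree, which turns
    the sign of a tensor product of forms into a function of the forms alone. *)
Lemma apply_signN fs us : (forall i, (i < size fs)%N -> us`_i = - fs`_i) ->
  apply_sign fs us = - pairsum fs.
Proof.
elim/last_ind: fs us => [|fs f IH] us h; first by rewrite /apply_sign big_nil oppr0.
have h' i : (i < size fs)%N -> us`_i = - fs`_i.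
  by move=> lt; rewrite h ?size_rcons 1?ltnW // nth_rcons lt.
rewrite apply_sign_rcons (IH us h') -cats1 pairsum_cat /= sumz_cons sumz_nil.
have -> : \sum_(0 <= i < size fs) us`_i = - sumz fs.
  by rewrite -big_nat_sumz -sumrN; apply: eq_big_nat => i /andP[_ /h'].
ring.
Qed.

Lemma apply_sign_rconsN fs us f : (forall i, (i < size fs)%N -> us`_i = - fs`_i) ->
  apply_sign (rcons fs f) us = - pairsum fs - f * sumz fs.
Proof.
move=> h; rewrite apply_sign_rcons apply_signN //.
have -> : \sum_(0 <= i < size fs) us`_i = - sumz fs.
  by rewrite -big_nat_sumz -sumrN; apply: eq_big_nat => i /andP[_ /h].
ring.
Qed.

(** * The components of j as contractions of outputs with forms *)
Section Read.
Variables (k : fieldType) (O : choiceType) (A : quiver k O) (d : int).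
Local Notation Q := (ext A d).
Implicit Types (W : lmodType k) (us : seq (arrow A)) (TT : seq (arrow Q)).

Lemma pairing_linear (q : arrow Q) y x i :
  linear (fun a : A y x i => pairing q (Arrow a) : k^o).
Proof.
move=> c a b; rewrite /pairing component_linear.
by have /asboolP -> := form_linear ((tagged q).2 : Defs.form _).
Qed.

Lemma pairing_neq0 (q : arrow Q) (u : arrow A) : pairing q u != 0 ->
  tag u = (src q, tgt q, - (d - 1 + deg q)).
Proof.
apply: contraNeq => /component_neq e; rewrite /pairing e.
have /asboolP l := form_linear ((tagged q).2 : Defs.form _).
have := l (-1) 0 0; rewrite scaler0 addr0 scaleN1r => ->.
by rewrite addNr.
Qed.

Definition pairings TT us : k := \prod_(p <- zip TT us) pairing p.1 p.2.

(** Contraction of the first outputs with the forms [TT]; [h] consumes the others. *)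
Definition read W TT (h : seq (arrow A) -> W) us : W :=
  if (size us < size TT)%N then 0 else pairings TT us *: h (drop (size TT) us).

(** The consumer of the single output left by the part valued in A. *)
Definition read_component y x i us : A y x i :=
  if us is [:: u] then component y x i u else 0.

(** The consumer when no output may be left: the part valued in forms. *)
Definition read_nil us : k^o := (nilp us)%:R.

Lemma read_component_multilinear y x i : multilinear (read_component y x i).
Proof.
move=> l r y' x' i' c a b; rewrite /read_component.
by case: l => [|u [|v l]]; case: r => [|w r] /=;
  rewrite ?scaler0 ?addr0 //; apply: component_linear.
Qed.

Lemma read_nil_multilinear : multilinear read_nil.
Proof.
by move=> l r y x i c a b; rewrite /read_nil /nilp !size_cat /= addnS scaler0 addr0.
Qed.

Lemma zip_catl (S T : Type) (s : seq S) (t1 t2 : seq T) :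
  (size s <= size t1)%N -> zip s (t1 ++ t2) = zip s t1.
Proof. by elim: s t1 => [|x s IH] [|y t1] //=; [case: t2 | move=> /IH ->]. Qed.

Lemma dropl_cat (S : Type) n (s t : seq S) :
  (n <= size s)%N -> drop n (s ++ t) = drop n s ++ t.
Proof.
rewrite leq_eqVlt drop_cat => /orP[/eqP ->|->] //.
by rewrite ltnn subnn drop0 drop_size.
Qed.

Lemma read_multilinear W TT (h : seq (arrow A) -> W) :
  multilinear h -> multilinear (read TT h).
Proof.
move=> mh l r y x i c a b; rewrite /read !size_cat /=.
case: ltnP => ls; first by rewrite scaler0 addr0.
case: (ltnP (size l) (size TT)) => lT; last first.
  by rewrite /pairings !zip_catl // !dropl_cat // mh scalerDr !scalerA mulrC.
have [q [TT2 eT]] : exists q TT2, drop (size l) TT = q :: TT2.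
  by case: drop (size_drop (size l) TT) => [/= |q TT2 _]; [lia | exists q, TT2].
have -> : TT = take (size l) TT ++ q :: TT2 by rewrite -eT cat_take_drop.
set TT1 := take _ TT; have s1 : size TT1 = size l by rewrite size_takel // ltnW.
rewrite /pairings !zip_cat // !big_cat /= !big_cons /= pairing_linear.
rewrite size_cat /= s1 !drop_cat ltnNge leq_addr /= addKn /=.
rewrite !scalerA -scalerDl; congr (_ *: _).
by rewrite /GRing.scale /=; ring.
Qed.

Lemma read_cat W TT1 TT2 (h : seq (arrow A) -> W) us1 us2 : size us1 = size TT1 ->
  read (TT1 ++ TT2) h (us1 ++ us2) = pairings TT1 us1 *: read TT2 h us2.
Proof.
move=> e; rewrite /read !size_cat e ltn_add2l; case: ifP => _; first by rewrite scaler0.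
rewrite /pairings zip_cat // big_cat /= -scalerA drop_cat ltnNge e leq_addr /=.
by rewrite addKn.
Qed.

Lemma read_full W TT (h : seq (arrow A) -> W) us : size us = size TT ->
  read TT h us = pairings TT us *: h [::].
Proof. by move=> e; rewrite /read e ltnn drop_oversize // e. Qed.

Lemma read_nilE TT us : read TT read_nil us =
  (if size us == size TT then pairings TT us else 0) :> k^o.
Proof.
have [e|ne] := eqVneq (size us) (size TT).
  by rewrite read_full // /read_nil /GRing.scale /= mulr1.
rewrite /read; case: ltnP => // le; rewrite /read_nil /nilp size_drop subn_eq0.
by rewrite leqNgt ltn_neqAle eq_sym ne le scaler0.
Qed.

Lemma pairings_cons q TT u us : pairings (q :: TT) (u :: us) = pairing q u * pairings TT us.
Proof. exact: big_cons. Qed.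

Definition shifted_degrees TT := [seq sdeg [:: q] | q <- TT].

Lemma sdeg_cat (B : quiver k O) (u v : seq (arrow B)) : sdeg (u ++ v) = sdeg u + sdeg v.
Proof. exact: big_cat. Qed.
Lemma sdeg_cons (B : quiver k O) (a : arrow B) v : sdeg (a :: v) = deg a - 1 + sdeg v.
Proof. exact: big_cons. Qed.
Lemma sdeg_nil (B : quiver k O) : sdeg ([::] : seq (arrow B)) = 0.
Proof. exact: big_nil. Qed.
Lemma sdeg_flatten (B : quiver k O) (ss : seq (seq (arrow B))) :
  sdeg (flatten ss) = sumz (map (@sdeg _ _ B) ss).
Proof. by rewrite /sumz big_map /sdeg big_flatten. Qed.
Lemma odeg_cat u v : odeg d (u ++ v) = odeg d u + odeg d (v : seq (arrow A)).
Proof. exact: big_cat. Qed.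
Lemma odeg_cons (a : arrow A) v : odeg d (a :: v) = deg a + d + odeg d v.
Proof. exact: big_cons. Qed.

Lemma sumz_shifted_degrees TT : sumz (shifted_degrees TT) = sdeg TT.
Proof.
rewrite /sumz big_map /sdeg; apply: eq_bigr => q _.
by rewrite big_seq1.
Qed.

Lemma pairing_deg (q : arrow Q) (u : arrow A) : pairing q u != 0 ->
  deg u + d = - (deg q - 1).
Proof. by move=> /pairing_neq0 e; rewrite /deg e /=; ring. Qed.

(** A form of degree e on A[-d] vanishes off degree -e. *)
Lemma pairings_deg TT us : size us = size TT -> pairings TT us != 0 ->
  odeg d us = - sdeg TT.
Proof.
elim: TT us => [|q TT IH] [|u us] //=; first by rewrite /odeg /sdeg !big_nil oppr0.
move=> [e]; rewrite pairings_cons mulf_eq0 negb_or => /andP[/pairing_deg eq /(IH _ e) eT].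
by rewrite odeg_cons sdeg_cons eq eT; ring.
Qed.

Lemma pairings_degs TT us : (size TT <= size us)%N -> pairings TT us != 0 ->
  forall i, (i < size (shifted_degrees TT))%N ->
  [seq odeg d [:: a] | a <- us]`_i = - (shifted_degrees TT)`_i.
Proof.
elim: TT us => [|q TT IH] [|u us] //= su.
rewrite pairings_cons mulf_eq0 negb_or => /andP[/pairing_deg eq nz] [|i] lt /=.
  by rewrite /odeg /sdeg !big_seq1 eq.
exact: IH.
Qed.

End Read.

Arguments read_nil {k O A}.

Section Interpretation.
Variables (k : fieldType) (O : choiceType) (A : quiver k O) (d : int).
Local Notation Q := (ext A d).
Implicit Types (xx : seq (seq O)) (SS : seq (seq (arrow Q))) (TT : seq (arrow Q)).

(** The blocks [SS] have the lengths prescribed by the type [xx], that is one less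
    than the numbers of objects. *)
Definition fits xx SS TT :=
  map size xx = [seq (size s).+1 | s <- SS] /\ size SS = (size TT).+1.

Section Fitting.
Variables (xx : seq (seq O)) (SS : seq (seq (arrow Q))) (TT : seq (arrow Q)).
Hypothesis f : fits xx SS TT.

Lemma fits_size : size SS = size xx.
Proof. by case: f => e _; rewrite -(size_map size xx) e size_map. Qed.

Lemma fits_blk i : size (blk xx i) = (size (nth [::] SS i.-1)).+1 \/ (size xx <= i.-1)%N.
Proof.
case: (ltnP i.-1 (size xx)) => lt; [left|by right].
by rewrite /blk -(nth_map _ 0%N) // f.1 (nth_map [::]) // fits_size.
Qed.

Lemma chunk_assemble i :
  chunk xx (assemble SS TT) i = blk (head [::] SS :: chunks (behead SS) TT) i.
Proof. by rewrite /chunk (reshape_assemble f.1 f.2). Qed.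

Lemma sa_assemble i : (0 < i <= size xx)%N -> sa xx (assemble SS TT) i = nth [::] SS i.-1.
Proof.
case: i => // i /andP[_ lt]; rewrite /sa chunk_assemble.
have [->/=|] := fits_blk i.+1; last by rewrite leqNgt lt.
rewrite /blk /=; case: i lt => [|i] lt /=; first by rewrite nth0 take_size.
have sB : size (behead SS) = size TT by rewrite size_behead f.2.
have lt' : (i < size TT)%N by move: lt; rewrite -fits_size f.2.
case eT : (drop i TT) (size_drop i TT) => [|q T'] /= sT; first by lia.
rewrite /chunks (nth_map ([::], q)) ?size_zip ?sB ?minnn // nth_zip //=.
by rewrite nth_behead take_size_cat.
Qed.

Lemma tf_assemble i q0 : (0 < i < size xx)%N ->
  tf xx (assemble SS TT) i = [:: nth q0 TT i.-1].
Proof.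
case: i => // i /andP[_ lt]; rewrite /tf chunk_assemble.
have [->/=|] := fits_blk i.+2; last by rewrite leqNgt lt.
have sB : size (behead SS) = size TT by rewrite size_behead f.2.
have lt' : (i < size TT)%N by move: lt; rewrite -fits_size f.2.
rewrite /blk /= /chunks (nth_map ([::], q0)) ?size_zip ?sB ?minnn // nth_zip //=.
by rewrite nth_behead drop_size_cat.
Qed.

Lemma map_sa_assemble a b : (a + b <= size xx)%N ->
  [seq sa xx (assemble SS TT) l | l <- iota a.+1 b] = take b (drop a SS).
Proof.
move=> le; rewrite -map_blk_iota ?fits_size //; apply/eq_in_map => i.
by rewrite mem_iota => h; rewrite sa_assemble //; lia.
Qed.

Lemma map_saA_assemble a b : (a + b <= size xx)%N ->
  [seq saA xx (assemble SS TT) l | l <- iota a.+1 b] = map (map (@toA k O A d)) (take b (drop a SS)).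
Proof. by move=> le; rewrite -map_sa_assemble // -map_comp. Qed.

Lemma size_fits : size xx = (size TT).+1.
Proof. by rewrite -fits_size f.2. Qed.

Lemma tfs_assemble : tfs xx (assemble SS TT) = TT.
Proof.
rewrite /tfs size_fits /=.
have [/size0nil ->|] := posnP (size TT); first by [].
case: {1}TT => // q0 _ _.
rewrite (_ : [seq tf _ _ i | i <- _] = [seq [:: nth q0 TT i.-1] | i <- iota 1 (size TT)]).
  by rewrite (iotaDl 1 0) -map_comp flatten_map1 map_nth_iota0 // take_size.
apply/eq_in_map => i; rewrite mem_iota => h.
by apply: tf_assemble; rewrite size_fits; lia.
Qed.

Let S := map (@sdeg _ _ Q) SS.
Let T := shifted_degrees TT.

Lemma nth_sdeg_sa i : (0 < i <= size xx)%N -> sdeg (sa xx (assemble SS TT) i) = S`_i.-1.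
Proof.
by move=> h; rewrite sa_assemble // (nth_map [::]) // fits_size; lia.
Qed.

Lemma nth_sdeg_tf i : (0 < i < size xx)%N -> sdeg (tf xx (assemble SS TT) i) = T`_i.-1.
Proof.
rewrite size_fits => h.
have [q0 _] : exists q0 : arrow Q, True by case: (TT) h => [|q]; [case: i | exists q].
rewrite (tf_assemble q0) ?size_fits // (nth_map q0) //; lia.
Qed.

Lemma size_shifted : size T = size TT. Proof. exact: size_map. Qed.
Lemma size_sdegs : size S = (size TT).+1. Proof. by rewrite size_map f.2. Qed.

Lemma sumz_sdeg_sa a b : (b <= size xx)%N ->
  \sum_(a.+1 <= i < b.+1) sdeg (sa xx (assemble SS TT) i) = \sum_(a <= i < b) S`_i.
Proof.
move=> h; rewrite big_add1 /=; apply: eq_big_nat => i /andP[_ lt].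
by rewrite nth_sdeg_sa //; lia.
Qed.

Lemma epsilon_assemble e : epsilon xx (assemble SS TT) e =
  crosssum T S + e * sumz T + d * (size TT)%:Z + pairsum S + pairsum T.
Proof.
rewrite /epsilon size_fits; congr (_ + _ + _ + _ + _).
- rewrite -crosssumE ?size_shifted ?size_sdegs // big_add1 /=.
  apply: eq_big_nat => i /andP[_ lt]; rewrite nth_sdeg_tf ?size_fits ?sumz_sdeg_sa ?size_fits //; lia.
- rewrite -big_nat_sumz size_shifted big_add1 /=; congr (_ * _).
  by apply: eq_big_nat => i /andP[_ lt]; rewrite nth_sdeg_tf ?size_fits //; lia.
- by rewrite -addn1 PoszD addrK.
- rewrite -pairsumE size_sdegs [LHS]big_add1 /=.
  apply: eq_big_nat => i /andP[_ lt].
  rewrite -!mulr_sumr sumz_sdeg_sa ?size_fits // nth_sdeg_sa ?size_fits //; lia.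
rewrite -pairsumE size_shifted [LHS]big_add1 /=.
apply: eq_big_nat => i /andP[_ lt]; rewrite [LHS]big_add1 /=.
apply: eq_big_nat => j /andP[_ lt']; rewrite !nth_sdeg_tf ?size_fits //; lia.
Qed.

Definition jA_sign e := crosssum T S + e * sumz T + d * (size TT)%:Z + pairsum S + d * sumz T.

(** Where the contraction does not vanish, the degrees of the contracted outputs
    are opposite to those of the forms; the sign of applying the forms then
    depends on the word only and combines with epsilon. *)
Lemma jA_assemble e phi y x i :
  jA xx (assemble SS TT) e phi y x i =
  if block_word xx (assemble SS TT) then
    (-1) ^ jA_sign e *:
      tlift (read TT (read_component y x i)) (phi (flatten (map (map (@toA k O A d)) SS)))
  else 0.
Proof.
rewrite /jA; case: ifP => [/negPf -> //|/negbFE -> /=].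
rewrite map_saA_assemble // drop0 -fits_size take_size fits_size size_fits.
(* Words of the wrong length contribute nothing to either side. *)
rewrite -!tlift_scaler; apply: eq_tlift => us.
rewrite /contract tfs_assemble /read -/(pairings TT us).
have [su|nsu] := eqVneq (size us) (size TT).+1; last first.
  rewrite scaler0; case: ltnP => [|le]; rewrite ?scaler0 //.
  rewrite /read_component; case ed : (drop _ us) (size_drop (size TT) us) => [|u [|v l]] /= sd; rewrite ?scaler0 //.
  by case/eqP: nsu; lia.
case: ltnP => [|_]; first by lia.
have [u eu] : exists u, drop (size TT) us = [:: u].
  case: (drop _ us) (size_drop (size TT) us) => [|u [|v l]] /= sd; try lia.
  by exists u.
rewrite eu /=; have -> : (if us is u0 :: us' then
    ((-1) ^ apply_sign (rcons (shifted_degrees TT) (- d)) [seq odeg d [:: a] | a <- us] *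
      pairings TT us) *: component y x i (last u0 us') else 0) =
    ((-1) ^ apply_sign (rcons (shifted_degrees TT) (- d)) [seq odeg d [:: a] | a <- us] *
      pairings TT us) *: component y x i u.
  case: (us) eu => [|u0 us'] // eu; congr (_ *: component _ _ _ _).
  by have := last_cat u0 (take (size TT) (u0 :: us')) (drop (size TT) (u0 :: us')); rewrite cat_take_drop eu.
rewrite !scalerA; have [->|nz] := eqVneq (pairings TT us) 0; first by rewrite !mulr0.
rewrite mulrA; congr (_ * _ *: _).
rewrite apply_sign_rconsN; last by apply: pairings_degs; rewrite // su.
by rewrite epsilon_assemble /jA_sign sign_mul -/T; sign_congruence.
Qed.

Definition jD_sign (M : seq (seq (arrow Q))) (sn : seq (arrow Q)) e c :=
  (d - 1) * c + crosssum T S + e * sumz T + d * (size TT)%:Z + pairsum S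
  + d * (e + sumz S) + (sdeg sn + c + 1) * sumz (map (@sdeg _ _ Q) M) + sdeg sn * (c + 1).

Lemma eq_to_form (U : lmodType k) (g h : U -> k^o) : g =1 h -> to_form g = to_form h.
Proof. by move=> gh; congr to_form; apply: functional_extensionality_dep. Qed.

(** As for the part valued in A, with the extra input [b] between the first and the
    last blocks, and no output left after the contraction. *)
Lemma jD_assemble e phi y x i (s1 sn : seq (arrow Q)) M :
  SS = s1 :: rcons M sn ->
  jD xx (assemble SS TT) e phi y x i =
  if block_word xx (assemble SS TT) then
    to_form (fun b => (-1) ^ jD_sign M sn e (d - 1 + i) *:
      tlift (read TT read_nil)
        (phi (map (@toA k O A d) s1 ++ Arrow b :: map (@toA k O A d) sn
              ++ flatten (map (map (@toA k O A d)) M))))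
  else 0.
Proof.
move=> eS; have n2 : size xx = (size M).+2 by rewrite -fits_size eS /= size_rcons.
have sT : size TT = (size M).+1 by have := size_fits; rewrite n2 => -[].
rewrite /jD; case: ifP => [|/norP[/negbNE -> _] /=].
  by rewrite n2 /= orbF => /negPf ->.
apply: eq_to_form => b; rewrite n2 subn2.
have -> : saA xx (assemble SS TT) 1 = map (@toA k O A d) s1.
  by rewrite /saA sa_assemble ?n2 // eS.
have -> : saA xx (assemble SS TT) (size M).+2 = map (@toA k O A d) sn.
  by rewrite /saA sa_assemble ?n2 ?leqnn // eS /= nth_rcons ltnn eqxx.
rewrite map_saA_assemble ?n2 //.
have -> : take (size M) (drop 1 SS) = M by rewrite eS /= drop0 -cats1 take_size_cat.
rewrite mulrA.
match goal with |- @eq _ (?c * ?t) ?r => change (@eq k^o (c *: (t : k^o)) r) end.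
rewrite -[RHS]tlift_scaler; etransitivity; [exact/esym/tlift_scaler | apply: eq_tlift => us].
rewrite /contract tfs_assemble /read -/(pairings TT us) sT -sT.
have [su|nsu] := eqVneq (size us) (size TT); last first.
  rewrite scaler0; case: ltnP => [|le]; rewrite ?scaler0 // /read_nil /nilp size_drop.
  by rewrite subn_eq0 leqNgt ltn_neqAle eq_sym nsu le !scaler0.
rewrite su ltnn /read_nil /nilp size_drop su subnn eqxx.
rewrite /GRing.scale /= mulr1 !mulrA.
have [->|nz] := eqVneq (pairings TT us) 0; first by rewrite !mulr0.
congr (_ * _); rewrite apply_signN; last by apply: pairings_degs; rewrite ?su.
rewrite /delta n2 epsilon_assemble !nth_sdeg_sa ?n2 ?leqnn // sumz_sdeg_sa ?n2 //.
rewrite (_ : \sum_(0 <= i0 < (size M).+2) S`_i0 = sumz S); last first.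
  by rewrite -big_nat_sumz /S eS /= size_map size_rcons.
rewrite sumz_sdeg_sa ?n2 //.
have -> : \sum_(1 <= i0 < (size M).+1) S`_i0 = sumz (map (@sdeg _ _ Q) M).
  rewrite -big_nat_sumz size_map big_add1; apply: eq_big_nat => l /andP[_ lt].
  by rewrite /S eS /= map_rcons nth_rcons size_map lt.
have -> : S`_(size M).+1 = sdeg sn.
  by rewrite /S eS /= map_rcons nth_rcons size_map ltnn eqxx.
by rewrite /jD_sign !sign_mul -/(shifted_degrees TT) -/T; sign_congruence.
Qed.

End Fitting.
End Interpretation.

(** * Evaluation of a two-disc diagram by groups of arms *)
Section Arms.
Variables (n m c v p q r : nat).

(** The input arms are cut into eight groups: the inputs of F before the block
    [v], the two parts of that block, the inputs of F after it, and four
    consecutive parts of the inputs of G, ending at [p], [q], [r] and [m].  In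
    every composition the inputs are moved by whole groups. *)
Definition in_group (x : nat) : seq arm :=
  match x with
  | 0 => map InF (iota 1 v.-1)
  | 1 => [:: InL]
  | 2 => [:: InR]
  | 3 => map InF (iota v.+1 (n - v))
  | 4 => map InG (iota 1 p)
  | 5 => map InG (iota p.+1 (q - p))
  | 6 => map InG (iota q.+1 (r - q))
  | _ => map InG (iota r.+1 (m - r))
  end%N.

(** The group of an arm, as [koszul_flatten] asks for. *)
Definition in_color (a : arm) : nat :=
  match a with
  | InF i => if (i < v)%N then 0 else 3
  | InL => 1
  | InR => 2
  | InG i => if (i <= p)%N then 4 else if (i <= q)%N then 5 else if (i <= r)%N then 6 else 7
  | _ => 8
  end.

(** The groups of outputs of F and G, followed by the two groups of inputs of F
    on either side of the connected one, which G passes through unchanged. *)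
Definition out_group (x : nat) : seq arm :=
  match x with
  | 0 => map OutF (iota 1 v.-1)
  | 1 => map OutF (iota v (n - v).+1)
  | 2 => map OutG (iota 1 c.-1)
  | 3 => [:: OutG c]
  | 4 => map OutG (iota c.+1 (m - c))
  | 5 => rcons (map InF (iota 1 v.-1)) InL
  | _ => InR :: map InF (iota v.+1 (n - v))
  end%N.

Definition out_color (a : arm) : nat :=
  match a with
  | OutF i => if (i < v)%N then 0 else 1
  | OutG i => if (i < c)%N then 2 else if i == c then 3 else 4
  | InF i => if (i < v)%N then 5 else 6
  | InL => 5
  | _ => 6
  end.

Hypothesis v0 : (0 < v)%N.

Lemma all_iota (P : pred nat) a b :
  (forall i, (a <= i < a + b)%N -> P i) -> all P (iota a b).
Proof. by move=> h; apply/allP => i; rewrite mem_iota => /h. Qed.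

Lemma in_groupP x : (p <= q <= r)%N -> (x < 8)%N -> all (fun a => in_color a == x) (in_group x).
Proof.
move=> pqr lt; do 8?[case: x lt => [|x] lt //=]; rewrite ?all_map; apply: all_iota => i /=;
  repeat (case: ifP => //=); lia.
Qed.

Lemma out_groupP x : (x < 7)%N -> all (fun a => out_color a == x) (out_group x).
Proof.
move=> lt; do 7?[case: x lt => [|x] lt //=]; rewrite ?ltnn ?eqxx //= ?all_rcons ?all_map /=; apply: all_iota => i /=;
  repeat (case: ifP => //=); lia.
Qed.

End Arms.

Lemma iota_split a b e : (a <= b <= e)%N -> iota a.+1 (e - a) = iota a.+1 (b - a) ++ iota b.+1 (e - b).
Proof.
move=> /andP[ab be]; have -> : (e - a = (b - a) + (e - b))%N by lia.
by rewrite iotaD addSn subnKC.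
Qed.

Lemma flatten_map_flatten (S T : Type) (f : S -> seq T) ss :
  flatten (map f (flatten ss)) = flatten (map (fun s => flatten (map f s)) ss).
Proof. by elim: ss => //= s ss IH; rewrite map_cat flatten_cat IH. Qed.

Lemma eq_koszul (I : eqType) (g h : I -> int) s t :
  {in s, g =1 h} -> koszul g s t = koszul h s t.
Proof.
move=> gh; apply: eq_big_seq => i si; rewrite big_seq_cond [RHS]big_seq_cond.
by apply: eq_bigr => l /andP[sl _]; rewrite !gh.
Qed.

Section Diagram.
Variables (k : fieldType) (O : choiceType) (A : quiver k O) (d : int).
Variables (X1 X2 : seq (seq O)) (xv : seq O) (yy : seq (seq O)) (c j : nat).
Variables (FF1 FF2 G4 G5 G6 G7 : seq (seq (arrow A))) (L R : seq (arrow A)).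

Local Notation xx := (X1 ++ xv :: X2).
Local Notation v := (size X1).+1.
Local Notation GG := (G4 ++ G5 ++ G6 ++ G7).

Hypothesis sF1 : shape FF1 = map predn (map size X1).
Hypothesis sF2 : shape FF2 = map predn (map size X2).
Hypothesis sG : shape GG = map predn (map size yy).
Hypothesis j_le : (j <= size xv)%N.
Hypothesis sL : size L = (j - 2)%N.
Hypothesis sR : size R = (size xv - j)%N.
Hypothesis c_bounds : (0 < c <= size yy)%N.

Let n := size xx.
Let m := size yy.
Let p := size G4.
Let q := (p + size G5)%N.
Let r := (q + size G6)%N.

Let n_def : n = (size FF1 + (size FF2).+1)%N.
Proof.
rewrite /n size_cat /= -[in LHS](size_map size) -[in LHS](size_map predn) -sF1 size_map.
by rewrite -[in LHS](size_map size X2) -[in LHS](size_map predn) -sF2 size_map.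
Qed.
Let v_def : size X1 = size FF1.
Proof. by rewrite -(size_map size) -(size_map predn) -sF1 size_map. Qed.
Let GG_size : size GG = m.
Proof. by rewrite /m -(size_map size yy) -(size_map predn) -sG size_map. Qed.
Let m_def : m = (r + size G7)%N.
Proof. by rewrite -GG_size !size_cat /r /q /p; lia. Qed.

Definition arm_piece (a : arm) : seq (arrow A) :=
  match a with
  | InF i => blk (FF1 ++ [::] :: FF2) i
  | InL => L
  | InR => R
  | InG i => blk GG i
  | _ => [::]
  end.

Definition group_piece (x : nat) : seq (arrow A) :=
  match x with
  | 0 => flatten FF1 | 1 => L | 2 => R | 3 => flatten FF2
  | 4 => flatten G4 | 5 => flatten G5 | 6 => flatten G6 | _ => flatten G7
  end.

Local Notation in_group' := (in_group n m v p q r).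

Lemma flatten_map_piece (f : nat -> arm) (B : seq (seq (arrow A))) a b :
  (forall i, arm_piece (f i) = blk B i) -> (a + b <= size B)%N ->
  flatten (map arm_piece (map f (iota a.+1 b))) = flatten (take b (drop a B)).
Proof.
by move=> fB le; rewrite -map_blk_iota // -map_comp; congr flatten; apply: eq_map.
Qed.

Lemma in_group_piece x : (x < 8)%N -> flatten (map arm_piece (in_group' x)) = group_piece x.
Proof.
have F i : arm_piece (InF i) = blk (FF1 ++ [::] :: FF2) i by [].
have G i : arm_piece (InG i) = blk GG i by [].
case: x => [|[|[|[|[|[|[|[|x]]]]]]]] //= _; rewrite ?cats0 //.
- by rewrite (flatten_map_piece F) ?size_cat ?v_def ?drop0 ?take_size_cat //=; lia.
- rewrite (flatten_map_piece F) n_def /= v_def ?size_cat /=; last by lia.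
  rewrite -cat_rcons drop_size_cat ?size_rcons // take_oversize //; lia.
- by rewrite (flatten_map_piece G) ?GG_size ?m_def /r /q ?drop0 ?take_size_cat //=; lia.
- rewrite (flatten_map_piece G) ?GG_size ?m_def /r /q ?drop_size_cat //=; last by lia.
  by rewrite addKn take_size_cat.
- rewrite (flatten_map_piece G) ?GG_size ?m_def /r /q ?catA; last by lia.
  by rewrite -catA drop_size_cat ?size_cat // addKn take_size_cat.
rewrite (flatten_map_piece G) ?GG_size; last by rewrite m_def; lia.
by rewrite m_def addKn !catA drop_size_cat ?size_cat // take_size.
Qed.

Lemma blk_size (B : seq (seq (arrow A))) (Y : seq (seq O)) i :
  shape B = map predn (map size Y) -> size (blk B i) = (size (blk Y i)).-1.
Proof.
move=> e; have sz : size B = size Y by rewrite -(size_map size) -/(shape B) e !size_map.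
case: (ltnP i.-1 (size B)) => h; last by rewrite /blk !nth_default // -sz.
rewrite /blk -(nth_map _ 0%N size) // -/(shape B) e (nth_map 0%N) ?size_map -?sz //.
by rewrite (nth_map [::]) -?sz.
Qed.

Lemma arm_piece_size a x : (x < 8)%N -> a \in in_group' x ->
  size (arm_piece a) = arity xx yy v j a.
Proof.
have F i : (0 < i)%N -> i != v -> size (blk (FF1 ++ [::] :: FF2) i) = (size (blk xx i)).-1.
  move=> i0 iv; rewrite /blk !nth_cat v_def.
  case: ltnP => h; first by rewrite -(@blk_size FF1 X1 i) // sF1.
  move: iv; rewrite v_def; case e : (i.-1 - size FF1)%N => [|t]; first by lia.
  by move=> _ /=; rewrite -(@blk_size FF2 X2 t.+1).
have G i : size (blk GG i) = (size (blk yy i)).-1 by apply: blk_size.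
have xvE : blk xx v = xv by rewrite /blk nth_cat ltnn subnn.
case: x => [|[|[|[|[|[|[|[|x]]]]]]]] //= _; rewrite ?inE.
- by case/mapP => i; rewrite mem_iota => h -> /=; apply: F; lia.
- by move=> /eqP -> /=; rewrite xvE sL size_takel //; lia.
- by move=> /eqP -> /=; rewrite xvE sR size_drop.
- by case/mapP => i; rewrite mem_iota => h -> /=; apply: F; lia.
- by case/mapP => i _ -> /=; apply: G.
- by case/mapP => i _ -> /=; apply: G.
- by case/mapP => i _ -> /=; apply: G.
- by case/mapP => i _ -> /=; apply: G.
Qed.

Lemma flatten_letters (us : seq (arrow A)) a b : (a + b <= size us)%N ->
  flatten [seq letter i us | i <- iota a.+1 b] = take b (drop a us).
Proof.
elim: b a => [|b IH] a le /=; first by rewrite take0.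
rewrite IH; last by rewrite addSn -addnS.
case e : (drop a us) (size_drop a us) => [|u l] /= sd; first by lia.
by rewrite /letter /= e /= take0 -add1n -drop_drop e /= drop0.
Qed.

Lemma sum_letters (us : seq (arrow A)) a b : (a + b <= size us)%N ->
  \sum_(i <- iota a.+1 b) odeg d (letter i us) = odeg d (take b (drop a us)).
Proof.
by move=> le; rewrite -flatten_letters // /odeg big_flatten /= big_map.
Qed.

Definition out_words (us ws : seq (arrow A)) (x : nat) : seq (arrow A) :=
  match x with
  | 0 => take v.-1 ws | 1 => drop v.-1 ws
  | 2 => take c.-1 us | _ => drop c us
  end%N.

Definition mid_degree (inner : bool) (us : seq (arrow A)) (x : nat) : int :=
  match x with
  | 2%N => odeg d (take c.-1 us)
  | 3%N => odeg d (letter c us) - (if inner then d + 1 else 0)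
  | 4%N => odeg d (drop c us)
  | 5%N => sdeg (flatten FF1) + sdeg L
  | _ => sdeg R + sdeg (flatten FF2)
  end.

Section Arrangement.
Variables (t : nat) (Sl Tl : seq nat).
Hypothesis in_arr : flatten (rot t (sectors xx yy c v)) = flatten (map in_group' Sl).
Hypothesis out_arr : rot t (frees xx yy c v) = flatten (map (out_group n m c v) Tl).
Hypothesis Sl_perm : Sl =i iota 0 8.
Hypothesis Tl_perm : Tl =i [:: 0; 1; 2; 4]%N.

Let inputs := flatten (rot t (sectors xx yy c v)).
Let word := flatten (map group_piece Sl).

Lemma mem_inputs x a : (x < 8)%N -> a \in in_group' x -> a \in inputs.
Proof.
move=> lt ax; rewrite /inputs in_arr; apply/flattenP; exists (in_group' x) => //.
by apply: map_f; rewrite Sl_perm mem_iota.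
Qed.

Lemma map_piece_groups Ul : {subset Ul <= iota 0 8} ->
  flatten (map arm_piece (flatten (map in_group' Ul))) = flatten (map group_piece Ul).
Proof.
move=> sU; rewrite flatten_map_flatten -map_comp; congr flatten.
apply/eq_in_map => x /sU; rewrite mem_iota => /andP[_ lt].
exact: in_group_piece.
Qed.

Lemma piece_word a : a \in inputs ->
  nth [::] (reshape (map (arity xx yy v j) inputs) word) (index a inputs) = arm_piece a.
Proof.
have sS : {subset Sl <= iota 0 8} by move=> x; rewrite Sl_perm.
have wE : word = flatten (map arm_piece inputs).
  by rewrite /inputs in_arr map_piece_groups.
have -> : map (arity xx yy v j) inputs = shape (map arm_piece inputs).
  rewrite /shape -map_comp; apply/eq_in_map => b; rewrite /inputs in_arr => /flattenP[l /mapP[x xS ->] bx] /=.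
  by rewrite (arm_piece_size _ bx) //; have := sS x xS; rewrite mem_iota.
by rewrite wE flattenK => ai; rewrite (nth_map a) ?index_mem // nth_index.
Qed.

Lemma piece_words Ul : {subset Ul <= iota 0 8} ->
  flatten (map (fun a => nth [::] (reshape (map (arity xx yy v j) inputs) word) (index a inputs))
    (flatten (map in_group' Ul))) = flatten (map group_piece Ul).
Proof.
move=> sU; rewrite -map_piece_groups //; congr flatten; apply/eq_in_map => a.
case/flattenP => l /mapP[x xU ->] ax; apply: piece_word; apply: mem_inputs ax.
by have := sU x xU; rewrite mem_iota.
Qed.

(** Applying a multilinear map to the evaluation of a diagram: the inputs come as
    words of the eight groups, [Sl] and [Tl] being the orders in which the
    composed type lists the groups of inputs and of free outputs.  The three
    permutations of the evaluation move whole groups, so their exponents are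
    quadratic functions of finitely many degrees. *)
Lemma tlift_diagram (inner : bool) (eF : int) (F G : seq (arrow A) -> tensors A)
    (W : lmodType k) (H : seq (arrow A) -> W) : multilinear H ->
  tlift H (diagram d xx yy c v j inner eF F G t word) =
  (-1) ^ koszul (fun x => sdeg (group_piece x)) Sl [:: 4; 5; 6; 7; 0; 1; 2; 3]%N *:
  tlift (fun us =>
    if size us != m then 0 else
    (-1) ^ ((if inner then (d + 1) * odeg d (take c.-1 us)
             else (d + 1) * eF + (eF + d + 1) * (d + 1)
                  + (d + 1) * (sdeg (flatten FF1) + sdeg L))
            + koszul (mid_degree inner us) [:: 2; 3; 4; 5; 6]%N [:: 5; 3; 6; 2; 4]%N) *:
    tlift (fun ws =>
      if size ws != n then 0 else
      (-1) ^ koszul (fun x => odeg d (out_words us ws x)) [:: 0; 1; 2; 4]%N Tl *: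
      H (flatten (map (out_words us ws) Tl)))
      (F ((flatten FF1 ++ L) ++ letter c us ++ R ++ flatten FF2)))
  (G (flatten GG)).
Proof.
move=> mH; rewrite /diagram -/n -/m -/inputs tliftZ // tlift_tlift //.
have ginE : map InG (iota 1 m) = flatten (map in_group' [:: 4; 5; 6; 7]%N).
  rewrite /= cats0 -!map_cat -iota_split -?iota_split; [ |rewrite m_def /r; lia ..].
  rewrite -[in LHS](subn0 m) (@iota_split 0 p) ?subn0 //; rewrite m_def /r /q; lia.
have fin1E : rcons (map InF (iota 1 v.-1)) InL = flatten (map in_group' [:: 0; 1]%N).
  by rewrite /= cats1.
have fin2E : InR :: map InF (iota v.+1 (n - v)) = flatten (map in_group' [:: 2; 3]%N).
  by rewrite /= cats0.
set piece := fun a => nth _ _ _.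
set gin := map InG (iota 1 m) in ginE *.
set fin1 := rcons _ InL in fin1E *.
set fin2 := InR :: _ in fin2E *.
set gout := map OutG (iota 1 m).
set fout := map OutF (iota 1 n).
set gfree := [seq a <- gout | _].
have pieceE x : (x < 8)%N -> \sum_(a <- in_group' x) sdeg (piece a) = sdeg (group_piece x).
  move=> lt; rewrite -in_group_piece // /sdeg big_flatten /= big_map.
  by apply: eq_big_seq => a ax; rewrite -/(sdeg _) /piece piece_word // (mem_inputs lt ax).
have w1E : flatten (map piece fin1) = flatten FF1 ++ L.
  by rewrite fin1E piece_words /= ?cats0 // => x; rewrite !inE => /orP[] /eqP->.
have w2E : flatten (map piece fin2) = R ++ flatten FF2.
  by rewrite fin2E piece_words /= ?cats0 // => x; rewrite !inE => /orP[] /eqP->.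
have wGE : flatten (map piece gin) = flatten GG.
  by rewrite ginE piece_words /= ?cats0 ?flatten_cat // => x; rewrite !inE => /or4P[] /eqP->.
congr (_ *: _).
  congr (_ ^ _); rewrite ginE fin1E fin2E -!flatten_cat -!map_cat.
  rewrite [X in koszul _ X _]in_arr (@koszul_flatten _ _ _ _ (in_color v p q r)).
  - by apply: eq_koszul => x; rewrite Sl_perm mem_iota => /andP[_ lt]; exact: pieceE.
  - move=> x; rewrite Sl_perm mem_iota => /andP[_ lt]; apply: in_groupP => //.
    by rewrite /q /r !leq_addr.
  - move=> x; rewrite Sl_perm !inE.
    by case: x => [|[|[|[|[|[|[|[|x]]]]]]]].
rewrite wGE; apply: eq_tlift => us; have [su|nsu] := eqVneq (size us) m; last first.
  by apply: tlift_zero.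
have w2E' : piece InR ++ flatten (map piece (map InF (iota v.+1 (n - v)))) = R ++ flatten FF2.
  exact: w2E.
have /andP[c0 cm] := c_bounds; have v_le : (v <= n)%N by rewrite /n size_cat /=; lia.
have goutE : gout = flatten (map (out_group n m c v) [:: 2; 3; 4]%N).
  rewrite /gout -[in LHS](subn0 m) (@iota_split 0 c.-1) ?subn0 ?map_cat; last by lia.
  rewrite (@iota_split c.-1 c) ?map_cat; last by lia.
  by rewrite (_ : c - c.-1 = 1)%N ?prednK //= ?cats0 //; lia.
have gfreeE : gfree = flatten (map (out_group n m c v) [:: 2; 4]%N).
  rewrite /gfree goutE /= !cats0 filter_cat /= eqxx /=; congr (_ ++ _);
    by apply/all_filterP; rewrite all_map; apply: all_iota => i h /=; apply/eqP => -[]; lia.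
have foutE : fout = flatten (map (out_group n m c v) [:: 0; 1]%N).
  transitivity (map OutF (iota 1 v.-1 ++ iota v (n - v).+1)).
    rewrite /fout -[in LHS](subn0 n) (@iota_split 0 v.-1) ?subn0; last by lia.
    by congr (map _ (_ ++ iota _ _)); lia.
  by rewrite map_cat /= cats0.
have fin1O : fin1 = flatten (map (out_group n m c v) [:: 5]%N) by rewrite /= cats0.
have fin2O : fin2 = flatten (map (out_group n m c v) [:: 6]%N) by rewrite /= cats0.
have disjoint U : {subset U <= iota 0 7} ->
    {in U, forall x, all (fun a => out_color c v a == x) (out_group n m c v x)}.
  by move=> sU x /sU; rewrite mem_iota => /andP[_ lt]; apply: out_groupP.
rewrite /= tliftZ // w1E w2E' sdeg_cat.
congr (_ ^ (_ + _) *: _).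
  rewrite (_ : [:: OutG c, InR & _] = flatten (map (out_group n m c v) [:: 3; 6; 2; 4]%N)); last first.
    by rewrite /= gfreeE /= !cats0.
  rewrite goutE fin1O fin2O -!flatten_cat -!map_cat.
  rewrite (@koszul_flatten _ _ _ _ (out_color c v)); first last.
  - by move=> x; rewrite !inE; case: x => [|[|[|[|[|[|[|x]]]]]]].
  - by apply: disjoint => x; rewrite !inE; case: x => [|[|[|[|[|[|[|x]]]]]]].
  apply: eq_koszul => x; rewrite !inE; case/or4P => [| | |/orP[]] /eqP->; rewrite ?big_map ?big_seq1.
  - rewrite (eq_big_seq (fun i => odeg d (letter i us))) ?sum_letters ?drop0 ?su /=; [by []|lia|].
    move=> i; rewrite mem_iota => h; rewrite (_ : i == c = false) ?andbF ?subr0 //; lia.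
  - by rewrite /= eqxx andbT.
  - rewrite (eq_big_seq (fun i => odeg d (letter i us))) ?sum_letters ?su /=; [|lia|].
      by rewrite take_oversize // size_drop su.
    move=> i; rewrite mem_iota => h; rewrite (_ : i == c = false) ?andbF ?subr0 //; lia.
  - rewrite /= -sdeg_cat -w1E /sdeg big_flatten /= big_map; apply: eq_big_seq => a.
    by rewrite mem_rcons inE => /orP[/eqP->|/mapP[i _ ->]].
  rewrite /= -sdeg_cat -w2E' sdeg_cat big_cons; congr (_ + _).
  rewrite [RHS]/sdeg big_flatten /= [RHS]big_map; apply: eq_big_seq => a.
  by move=> /mapP[i _ ->].
rewrite tlift_tlift //; apply: eq_tlift => ws.
have [sw|nsw] := eqVneq (size ws) n; last by apply: tlift_zero.
have outE x : x \in [:: 0; 1; 2; 4]%N -> flatten [seq match a with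
                   | OutF i => letter i ws
                   | OutG i => letter i us
                   | _ => [::]
                   end
                 | a <- out_group n m c v x] = out_words us ws x.
  rewrite !inE; case/or4P => /eqP -> /=; rewrite -map_comp.
  - by rewrite (@flatten_letters ws 0 v.-1) ?drop0 ?sw //; lia.
  - rewrite [LHS](_ : _ = take (n - v).+1 (drop v.-1 ws)); last first.
      by apply: (@flatten_letters ws v.-1 (n - v).+1); rewrite sw /=; lia.
    by rewrite take_oversize // size_drop sw; lia.
  - by rewrite (@flatten_letters us 0 c.-1) ?drop0 ?su //; lia.
  rewrite (@flatten_letters us c (m - c)) ?su //; last by lia.
  by rewrite take_oversize // size_drop su.
rewrite /= tliftZ // tlift_pure // out_arr; congr (_ ^ _ *: H _).
  rewrite foutE gfreeE -!flatten_cat -!map_cat.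
  rewrite (@koszul_flatten _ _ _ _ (out_color c v)); first last.
  - by move=> x; rewrite Tl_perm.
  - by apply: disjoint => x; rewrite !inE; case: x => [|[|[|[|[|[|[|x]]]]]]].
  apply: eq_koszul => x xT; rewrite -outE // /odeg big_flatten /= big_map.
  by apply: eq_bigr.
rewrite flatten_map_flatten -map_comp; congr flatten; apply/eq_in_map => x.
by rewrite Tl_perm => /outE.
Qed.

End Arrangement.
End Diagram.

(** * The orders of the arms in the two compositions *)
Section Arrangements.
Variables (O : choiceType) (xx yy : seq (seq O)).
Local Notation n := (size xx).
Local Notation m := (size yy).

(** If G has a single output, all its inputs lie between the two parts of the
    block of F that receives it. *)
Lemma sectors_one v : m = 1%N ->
  flatten (sectors xx yy 1 v) =
  flatten (map (in_group n m v 1 1 1) [:: 0; 1; 4; 5; 6; 7; 2; 3]%N).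
Proof.
by move=> m1; rewrite /sectors /after m1 subnn /= !flatten_cat /= !flatten_map1 /= !cats0.
Qed.

(** The last output of G being connected, its first block is continued by the
    right part of the block of F, and its last block is preceded by the left
    part. *)
Lemma sectors_inner v : (1 < m)%N ->
  flatten (sectors xx yy m v) =
  flatten (map (in_group n m v 1 m.-1 m) [:: 0; 4; 2; 5; 1; 6; 7; 3]%N).
Proof.
move=> m1; rewrite /sectors /after subnn /=.
case: m m1 => [|[|M]] //= _.
rewrite !(flatten_cat, flatten_map1) /= !subnn ?subSS ?subn0 /=.
rewrite !(flatten_cat, flatten_map1) /= -!catA /= subSnn /= ?cats0 //.
Qed.

(** If the extra input [b] lies in the last block of F, which is the connected
    one, its sector comes first: the labelling is rotated until the left part
    of that block is leading. *)
Lemma sectors_rotated : (1 < m)%N ->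
  flatten (rot m.-1 (sectors xx yy m 1)) =
  flatten (map (in_group n m 1 1 m.-1 m) [:: 0; 1; 6; 7; 3; 4; 2; 5]%N).
Proof.
move=> m1; rewrite /sectors /after subnn /=.
case: m m1 => [|[|M]] //= _.
rewrite -catA -cat_cons.
rewrite [M.+1](_ : _ = size ([:: InG 1; InR] :: [seq [:: InG i] | i <- iota 2 M])); last first.
  by rewrite /= size_map size_iota.
rewrite rot_size_cat !(flatten_cat, flatten_map1) /= !(flatten_cat, flatten_map1) /=.
by rewrite size_map size_iota subSnn subnn /= !cats0 [(M.+1 - 1)%N]subn1.
Qed.

(** The root being an output of G, the blocks of G before the output [c] come
    first, then F, then the other blocks of G. *)
Lemma sectors_outer c : (0 < c < m)%N ->
  flatten (rot (m - c) (sectors xx yy c 1)) =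
  flatten (map (in_group n m 1 c.-1 c c.+1) [:: 0; 4; 1; 5; 3; 6; 2; 7]%N).
Proof.
move=> /andP[c0 cm]; rewrite /sectors /after /=.
have -> : (m - c = (m - c.+1).+1)%N by lia.
set M := (m - c.+1)%N; rewrite /= map_cat -!catA -cat_cons.
rewrite {1}[M.+1](_ : _ = size ([:: InG c.+1; InR] :: [seq [:: InG i] | i <- iota c.+2 M])); last first.
  by rewrite /= size_map size_iota.
rewrite rot_size_cat !(flatten_cat, flatten_map1) /= !(flatten_cat, flatten_map1) /=.
have -> : (c - c.-1 = 1)%N by lia.
by rewrite subSnn /= prednK // -!catA /= ?cats0.
Qed.

Lemma frees_inner v : 
  frees xx yy m v = flatten (map (out_group n m m v) [:: 0; 4; 2; 1]%N).
Proof. by rewrite /frees /after /= subnn /= ?cats0. Qed.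

Lemma frees_rotated : 
  rot m.-1 (frees xx yy m 1) = flatten (map (out_group n m m 1) [:: 0; 4; 1; 2]%N).
Proof.
rewrite /frees /after subnn cat0s.
have {1}-> : m.-1 = size (map OutG (iota 1 m.-1)) by rewrite size_map size_iota.
by rewrite rot_size_cat /= subnn ?cats0.
Qed.

Lemma frees_outer c : (0 < c <= m)%N ->
  rot (m - c) (frees xx yy c 1) = flatten (map (out_group n m c 1) [:: 0; 2; 1; 4]%N).
Proof.
move=> _; rewrite /frees /after cat0s map_cat -catA.
have {1}-> : (m - c)%N = size (map OutG (iota c.+1 (m - c))) by rewrite size_map size_iota.
by rewrite rot_size_cat /= cats0 -catA.
Qed.

Lemma size_sectors v : (0 < m)%N -> (0 < v <= n)%N ->
  size (sectors xx yy m v) = size (frees xx yy m v).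
Proof.
move=> m0 /andP[v0 vn]; rewrite /sectors /frees /after subnn /= !size_cat !size_map !size_iota.
by case: m m0 => [|[|M]] //= _; rewrite ?size_cat ?size_map ?size_iota /=; lia.
Qed.

Lemma inn_rot_size v : (0 < v <= n)%N -> inn_rot xx yy v = size (frees xx yy m v).
Proof.
move=> /andP[v0 vn]; rewrite /inn_rot /rooted_at.
have -> : frees xx yy m v = rcons (map OutF (iota 1 v.-1) ++ map OutG (after yy m) ++ map OutF (iota v (n - v))) (OutF n).
  by rewrite /frees -[(n - v).+1]addn1 iotaD subnKC // map_cat /= -cats1 -!catA.
rewrite size_rcons -cats1 index_cat /= eqxx addn0 ifN // !mem_cat.
by apply/negP => /or3P[] /mapP[i] //; rewrite mem_iota => + [ni]; lia.
Qed.

Lemma out_rot_outer v : (0 < v < m)%N -> out_rot xx yy v = (m - v)%N.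
Proof.
move=> /andP[v0 vm]; rewrite /out_rot /rooted_at /frees /after map_cat cat0s -catA.
have -> : (m - v = (m - v).-1 + 1)%N by lia.
rewrite iotaD map_cat -catA index_cat ifN; last first.
  by apply/negP => /mapP[i]; rewrite mem_iota => + [ni]; lia.
rewrite /= (_ : v.+1 + (m - v).-1 = m)%N ?eqxx ?size_map ?size_iota; lia.
Qed.

Lemma starting_InF1 v : (1 < v)%N -> starting_at xx yy m v (InF 1) = 0%N.
Proof. by case: v => [|[|v]]. Qed.

Lemma starting_InR : (0 < m)%N -> starting_at xx yy m 1 InR = 0%N.
Proof.
by rewrite /starting_at /sectors /after subnn; case: m => [|[|M]].
Qed.

Lemma starting_InL : (0 < m)%N -> starting_at xx yy m 1 InL = m.-1.
Proof.
rewrite /starting_at /sectors /after subnn; case: m => [|[|M]] //= _.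
rewrite -catA find_cat ifN /=; first by rewrite size_map size_iota addn0.
by apply/hasPn => s /mapP[i _ ->].
Qed.

Lemma starting_InG1 c : (0 < c <= m)%N -> starting_at xx yy c 1 (InG 1) = (m - c)%N.
Proof.
move=> /andP[c0 cm]; rewrite /starting_at /sectors /after /=.
have [e|lt] : c = m \/ (c < m)%N by lia.
  by rewrite e subnn /=; case: m e => [|[|M]] //=; lia.
have -> : (m - c = (m - c.+1).+1)%N by lia.
rewrite /= inE /= (_ : InG 1 == InG c.+1 = false); last by apply/eqP => -[]; lia.
rewrite map_cat -!catA find_cat ifN; last first.
  apply/hasPn => s /mapP[i]; rewrite mem_iota => h -> /=; rewrite inE.
  by apply/eqP => -[]; lia.
rewrite size_map size_iota; congr _.+1.
case: c c0 cm lt => [|[|c]] //= _ _ _; rewrite ?inE ?eqxx /= ?addn0 //.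
Qed.

End Arrangements.

(** * Multilinearity of the nested integrands *)
(** If only the word of index [x] contains the letter [a], the concatenation
    contains it at a place independent of [a]. *)
Lemma flatten_map_slot (I : eqType) (T : Type) (s : seq I) x (g0 : I -> seq T) l' r' :
  uniq s -> x \in s ->
  exists l r, forall g a, {in s, forall y, y != x -> g y = g0 y} -> g x = l' ++ a :: r' ->
    flatten (map g s) = l ++ a :: r.
Proof.
move=> + xs; case/splitPr: xs => s1 s2; rewrite cat_uniq /= => /and3P[_ ns /andP[nx _]].
move: ns; rewrite negb_or => /andP[nx1 _].
exists (flatten (map g0 s1) ++ l'), (r' ++ flatten (map g0 s2)) => g a gE gx.
rewrite map_cat flatten_cat /= gx -!catA /=; congr (flatten _ ++ (_ ++ _ :: _ ++ flatten _)).
  by apply/eq_in_map => y ys; rewrite gE ?mem_cat ?ys //; apply: contraNneq nx1 => <-.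
by apply/eq_in_map => y ys; rewrite gE ?mem_cat ?inE ?ys ?orbT //; apply: contraNneq nx => <-.
Qed.

Section DoubleSum.
Variables (k : fieldType) (O : choiceType) (A : quiver k O) (d : int).
Variables (X1 : seq (seq O)) (c : nat).
Variables (m n : nat) (Tl : seq nat) (W : lmodType k).
Implicit Types (us ws : seq (arrow A)).

Definition tag_invariant (R : Type) (s : seq (arrow A) -> R) :=
  forall u v, map tag u = map tag v -> s u = s v.

Lemma tag_invariant_odeg : tag_invariant (odeg d).
Proof.
move=> u v e.
have oE w : odeg d w = \sum_(a <- map tag w) (a.2 + d :> int) by rewrite big_map.
by rewrite !oE e.
Qed.

Lemma odeg_tags (u v : seq (arrow A)) : map tag u = map tag v -> odeg d u = odeg d v.
Proof. exact: tag_invariant_odeg. Qed.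

Lemma mid_degree_tags (e : nat) (FF1 FF2 : seq (seq (arrow A))) (L R u v : seq (arrow A)) b :
  map tag u = map tag v ->
  mid_degree d e FF1 FF2 L R b u =1 mid_degree d e FF1 FF2 L R b v.
Proof.
move=> E; case=> [|[|[|[|[|x]]]]] //=; rewrite /letter.
- by rewrite (@odeg_tags (take _ u) (take e.-1 v)) // !map_take E.
- by rewrite (@odeg_tags (take 1 (drop e.-1 u)) (take 1 (drop e.-1 v))) // !map_take !map_drop E.
- by rewrite (@odeg_tags (drop e u) (drop e v)) // !map_drop E.
Qed.

Lemma out_words_tags (u u' w w' : seq (arrow A)) x :
  map tag u = map tag u' -> map tag w = map tag w' ->
  odeg d (out_words X1 c u w x) = odeg d (out_words X1 c u' w' x).
Proof.
move=> E E'; apply: odeg_tags; case: x => [|[|[|x]]] /=; by rewrite ?map_take ?map_drop ?E ?E'.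
Qed.

Lemma multilinear_tag_scale (s : seq (arrow A) -> k) (h : seq (arrow A) -> W) :
  tag_invariant s -> multilinear h -> multilinear (fun us => s us *: h us).
Proof.
move=> ti mh l r y x i a b e; rewrite mh scalerDr !scalerA [_ * a]mulrC.
by congr (_ * _ *: _ + _ *: _); apply: ti; rewrite !map_cat.
Qed.

Lemma multilinear_linear (V U : lmodType k) (f : V -> U) (h : seq (arrow A) -> V) :
  linear f -> multilinear h -> multilinear (fun us => f (h us)).
Proof. by move=> lf mh l r y x i a b e; rewrite mh lf. Qed.

Hypothesis Tl_uniq : uniq Tl.
Hypothesis Tl_mem : Tl =i [:: 0; 1; 2; 4]%N.
Variables (s : seq (arrow A) -> k) (t : seq (arrow A) -> seq (arrow A) -> k).
Hypothesis s_inv : tag_invariant s.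
Hypothesis t_inv : forall u u' w w',
  map tag u = map tag u' -> map tag w = map tag w' -> t u w = t u' w'.
Variables (H : seq (arrow A) -> W) (F : seq (arrow A) -> tensors A) (w1 w2 : seq (arrow A)).
Hypotheses (mH : multilinear H) (mF : multilinear F).
Hypothesis c0 : (0 < c <= m)%N.

(** The integrand over the outputs of F, those of G being given. *)
Definition inner_summand us ws : W :=
  if size ws != n then 0 else t us ws *: H (flatten (map (out_words X1 c us ws) Tl)).

Lemma inner_summand_multilinear us : multilinear (inner_summand us).
Proof.
apply: multilinear_guard; apply: multilinear_tag_scale.
  by move=> u v e; apply: t_inv.
apply: multilinear_rearrange => // l r; set q := size X1.
case: (ltnP (size l) q) => lq.
  have [||l1 [r1 E]] := @flatten_map_slot _ _ Tl 0%N
    (fun y => if y == 1%N then drop (q - size l).-1 r else out_words X1 c us [::] y)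
    l (take (q - size l).-1 r); rewrite ?Tl_mem //.
  exists l1, r1 => a; apply: E => [[|[|[|y]]] _ //|] /=;
    rewrite /= -/q -(subnKC (ltnW lq)) ?take_cat ?drop_cat ltnNge leq_addr /= addKn;
    by rewrite -[(q - size l)%N]prednK ?subn_gt0.
have [||l1 [r1 E]] := @flatten_map_slot _ _ Tl 1%N
  (fun y => if y == 0%N then take q l else out_words X1 c us [::] y)
  (drop q l) r; rewrite ?Tl_mem //.
exists l1, r1 => a; apply: E => [[|[|[|y]]] _ //|] /=; rewrite -/q.
  by rewrite takel_cat.
by rewrite dropl_cat.
Qed.

(** The integrand over the outputs of G, in which F has already been applied. *)
Definition outer_summand us : W :=
  if size us != m then 0 else
  s us *: tlift (inner_summand us) (F (w1 ++ letter c us ++ w2)).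

(** An output of G other than the connected one is not an input of F; it survives
    as a letter of the final word. *)
Lemma inner_summand_outer l r ws y x i (e : k) (a b : A y x i) :
  size l != c.-1 -> size (l ++ Arrow a :: r) = m ->
  inner_summand (l ++ Arrow (e *: a + b) :: r) ws =
  e *: inner_summand (l ++ Arrow a :: r) ws + inner_summand (l ++ Arrow b :: r) ws.
Proof.
move=> nl sm; rewrite /inner_summand; case: ifP => _; first by rewrite scaler0 addr0.
have tE a' b' : t (l ++ Arrow (a' : A y x i) :: r) ws = t (l ++ Arrow (b' : A y x i) :: r) ws.
  by apply: t_inv => //; rewrite !map_cat.
rewrite (tE _ a) (tE b a).
suff [l1 [r1 E]] : exists l1 r1, forall a' : A y x i,
    flatten (map (out_words X1 c (l ++ Arrow a' :: r) ws) Tl) = l1 ++ Arrow a' :: r1.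
  by rewrite !E mH scalerDr !scalerA mulrC.
case: (ltnP (size l) c.-1) => lc.
  have [||l1 [r1 E]] := @flatten_map_slot _ _ Tl 2%N
    (fun y => if y == 0%N then take (size X1) ws else if y == 1%N then drop (size X1) ws
      else drop (c - size l).-1 r)
    l (take (c.-1 - size l).-1 r); rewrite ?Tl_mem //.
  exists l1, r1 => a'; apply: E => [[|[|[|y']]] _ //|] /=.
    by rewrite drop_cat ltnNge (ltnW (leq_trans lc (leq_pred _))) /= -[(c - size l)%N]prednK ?subn_gt0 ?(leq_trans lc) ?leq_pred.
  by rewrite take_cat ltnNge (ltnW lc) /= -[(c.-1 - size l)%N]prednK ?subn_gt0.
have lc' : (c <= size l)%N by move: nl; rewrite neq_ltn ltnNge lc /=; case: (c) c0.
have [||l1 [r1 E]] := @flatten_map_slot _ _ Tl 4%N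
    (fun y => if y == 0%N then take (size X1) ws else if y == 1%N then drop (size X1) ws
      else take c.-1 l)
    (drop c l) r; rewrite ?Tl_mem //.
exists l1, r1 => a'; apply: E => [y'|] /=; last by rewrite dropl_cat.
rewrite Tl_mem !inE => /or4P[] /eqP -> //= _.
by rewrite takel_cat // (leq_trans (leq_pred _) lc').
Qed.

(** Each output of G is used exactly once: the connected one as a letter of the
    input of F, any other one as a letter of the final word.  The signs depend
    on the degrees of the letters only. *)
Lemma outer_summand_multilinear : multilinear outer_summand.
Proof.
move=> l r y x i e a b; rewrite /outer_summand.
have sE (a' b' : A y x i) : s (l ++ Arrow a' :: r) = s (l ++ Arrow b' :: r).
  by apply: s_inv; rewrite !map_cat.
rewrite (sE _ a) (sE b a) !size_cat /=.
case: ifP => [|/negbFE/eqP sm]; first by rewrite scaler0 addr0.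
have [sl|nl] := eqVneq (size l) c.-1.
  have letE a' : letter c (l ++ Arrow (a' : A y x i) :: r) = [:: Arrow a'].
    by rewrite /letter -sl drop_size_cat //= take0.
  have inE (a' b' : A y x i) : inner_summand (l ++ Arrow a' :: r) =1 inner_summand (l ++ Arrow b' :: r).
    move=> ws; rewrite /inner_summand; case: ifP => // _.
    rewrite (t_inv (u' := l ++ Arrow b' :: r) (w' := ws)) ?map_cat //.
    congr (_ *: H (flatten _)); apply/eq_in_map => z _; rewrite /out_words -sl.
    case: z => [|[|[|z]]] //; first by rewrite !take_size_cat.
    have -> : c = (size l).+1 by move: c0 sl; case: (c) => //= ? _ ->.
    by rewrite !drop_cat ltnNge leqnSn /= subSnn /= !drop0.
  rewrite !letE (eq_tlift _ (inE _ a)) (eq_tlift _ (inE b a)) mF.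
  by rewrite (tlift_linear (inner_summand_multilinear _)) scalerDr !scalerA mulrC.
have letE (a' b' : A y x i) : letter c (l ++ Arrow a' :: r) = letter c (l ++ Arrow b' :: r).
  rewrite /letter !drop_cat; case: ltngtP nl => // [lt _|lt _].
    case ed : (drop c.-1 l) (size_drop c.-1 l) => [|z l'] /= sd; first by lia.
    by rewrite !take0.
  by rewrite -[(c.-1 - size l)%N]prednK ?subn_gt0.
rewrite (letE _ a) (letE b a) [e *: (_ *: _)]scalerA [e * _]mulrC -scalerA -scalerDr; congr (_ *: _).
rewrite -tlift_scaler !tlift_sum -big_split /=; apply: eq_bigr => z _.
by rewrite inner_summand_outer // ?size_cat // scalerDr.
Qed.

End DoubleSum.

(** * Contraction of the outputs of an inner diagram *)
Section Outputs.
Variables (k : fieldType) (O : choiceType) (A : quiver k O).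

Lemma size_out_of_type yy (us : seq (arrow A)) : out_of_type yy us -> size us = size yy.
Proof.
move=> /eqP /(congr1 size); rewrite size_map size_zip !size_map size_rot minnn.
by [].
Qed.

Lemma last_out_of_type yy us (u : arrow A) y0 x0 : out_of_type yy (rcons us u) ->
  lt_obj (last [::] yy) = Some y0 -> rt_obj (head [::] yy) = Some x0 ->
  tgt u = y0 /\ src u = x0.
Proof.
case: yy => [|y1 yy]; first by case: us.
rewrite /out_of_type rot1_cons map_rcons map_rcons => /eqP + /= hl hr.
rewrite [in map _ (y1 :: yy)]lastI map_rcons zip_rcons; last first.
  by rewrite !size_map size_belast.
by move=> /rcons_inj [_]; rewrite hl hr => -[->] [->].
Qed.

End Outputs.

Lemma mid_koszul (g : nat -> int) :
  koszul g [:: 2; 3; 4; 5; 6]%N [:: 5; 3; 6; 2; 4]%N =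
  g 2%N * g 3%N + g 2%N * g 5%N + g 2%N * g 6%N + g 3%N * g 5%N + g 4%N * g 5%N + g 4%N * g 6%N.
Proof. by rewrite /koszul !big_cons !big_nil /= ?addr0 ?add0r !addrA. Qed.

Section InnerCore.
Variables (k : fieldType) (O : choiceType) (A : quiver k O) (d eF eG : int).
Local Notation Q := (ext A d).
Variables (F G : multi_family A).
Hypotheses (F_multi : multi d eF F) (G_multi : multi d eG G).
Variables (X1 X2 : seq (seq O)) (xv : seq O) (yy : seq (seq O)) (j : nat).
Variables (FF1 FF2 G4 G5 G6 G7 : seq (seq (arrow A))) (L R : seq (arrow A)).
Variables (TF1 TF2 TG : seq (arrow Q)).

Local Notation xx := (X1 ++ xv :: X2).
Local Notation v := (size X1).+1.
Local Notation GG := (G4 ++ G5 ++ G6 ++ G7).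

Hypothesis sF1 : shape FF1 = map predn (map size X1).
Hypothesis sF2 : shape FF2 = map predn (map size X2).
Hypothesis sG : shape GG = map predn (map size yy).
Hypothesis j_le : (j <= size xv)%N.
Hypothesis sL : size L = (j - 2)%N.
Hypothesis sR : size R = (size xv - j)%N.
Hypothesis sTF1 : size TF1 = size X1.
Hypothesis sTG : (size TG).+1 = size yy.

Variables (W : lmodType k) (h : seq (arrow A) -> W).
Hypothesis mh : multilinear h.
Variables (y0 x0 : O) (rotated : bool).
Hypothesis y0E : lt_obj (last [::] yy) = Some y0.
Hypothesis x0E : rt_obj (head [::] yy) = Some x0.
Hypothesis sTF2 : rotated -> size TF2 = (size X2).+1.

Let n := size xx.
Let m := size yy.
Let Tl := if rotated then [:: 0; 4; 1; 2]%N else [:: 0; 4; 2; 1]%N.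
Let TZ := if rotated then TF1 ++ TF2 ++ TG else TF1 ++ TG ++ TF2.
Variables (t : nat) (Sl : seq nat).
Hypothesis in_arr : flatten (rot t (sectors xx yy m v)) =
  flatten (map (in_group n m v (size G4) (size G4 + size G5) (size G4 + size G5 + size G6)) Sl).
Hypothesis out_arr : rot t (frees xx yy m v) = flatten (map (out_group n m m v) Tl).
Hypothesis Sl_perm : Sl =i iota 0 8.

(** The degree in A[-d] of the only output of G that is not contracted. *)
Definition inner_degree := eG + sdeg (flatten GG) + sdeg TG.

(** [B] is the degree of the forms applied to G, [C] the degree of the connected
    output in A[1], [f1] and [f2] the degrees of the inputs of F on either side
    of it.  The last summand exchanges the contracted outputs of G with the outputs of
    F of index at least [v]; if [rotated], no exchange takes place, and the second
    factor vanishes because all these outputs are contracted. *)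
Definition inner_sign :=
  let B := sdeg TG in
  let C := inner_degree - (d + 1) in
  let f1 := sdeg (flatten FF1) + sdeg L in
  let f2 := sdeg R + sdeg (flatten FF2) in
  koszul (fun x => sdeg (group_piece FF1 FF2 G4 G5 G6 G7 L R x)) Sl [:: 4; 5; 6; 7; 0; 1; 2; 3]%N
  + (d + 1) * B + (B * C + B * f1 + B * f2 + C * f1)
  + B * (eF + f1 + C + f2 + sdeg TF1 + (if rotated then sdeg TF2 else 0)).

Lemma multi_spanned (e : int) (K : multi_family A) zz w : multi d e K ->
  spanned (fun us => out_of_type zz us && (odeg d us == e + sdeg w)) (K zz w).
Proof. by case. Qed.

(** All outputs of G but the connected one are contracted with the forms [TG].
    What remains of G is a vector of A, which F, being linear in the connected
    input, receives as a letter: this vector is the part valued in A of j(G), up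
    to sign.  If [rotated], the composed type reads the remaining outputs of F
    before those of G; these are then all contracted, which determines their
    degree. *)
Lemma inner_diagram :
  tlift (read TZ h)
    (diagram d xx yy m v j true eF (F xx) (G yy) t
       (flatten (map (group_piece FF1 FF2 G4 G5 G6 G7 L R) Sl))) =
  (-1) ^ inner_sign *:
  tlift (read (TF1 ++ TF2) h)
    (F xx ((flatten FF1 ++ L) ++
       Arrow (tlift (read TG (read_component y0 x0 (inner_degree - d))) (G yy (flatten GG)))
       :: R ++ flatten FF2)).
Proof.
have mF := multi_linear F_multi xx; have mG := multi_linear G_multi yy.
have m_gt0 : (0 < m <= m)%N by rewrite /m -sTG leqnn.
have Tl_mem : Tl =i [:: 0; 1; 2; 4]%N.
  by move=> x; rewrite /Tl; case: rotated; rewrite !inE; case: x => [|[|[|[|[|x]]]]].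
have Tl_uniq : uniq Tl by rewrite /Tl; case: rotated.
have mread := read_multilinear TZ mh.
rewrite (tlift_diagram d sF1 sF2 sG j_le sL sR m_gt0 in_arr out_arr) //.
set k1 := koszul _ _ _.
set U := G yy _; set ρ := read TG _.
have mρ : multilinear ρ by apply/read_multilinear/read_component_multilinear.
pose K := read (TF1 ++ TF2) h; have mK : multilinear K by apply: read_multilinear.
have linK y x i : linear (fun a : A y x i => tlift K (F xx ((flatten FF1 ++ L) ++ Arrow a :: R ++ flatten FF2))).
  by move=> e a b; rewrite mF (tlift_linear mK).
rewrite (linear_tlift _ _ (linK _ _ _)) -/K.
rewrite -!tlift_scaler.
pose s (us : seq (arrow A)) := (-1 : k) ^ ((d + 1) * odeg d (take m.-1 us) +
  koszul (mid_degree d m FF1 FF2 L R true us) [:: 2; 3; 4; 5; 6]%N [:: 5; 3; 6; 2; 4]%N).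
pose tt (us ws : seq (arrow A)) := (-1 : k) ^ koszul (fun x => odeg d (out_words X1 m us ws x)) [:: 0; 1; 2; 4]%N Tl.
apply: (eq_tlift_spanned (P := fun us => out_of_type yy us && (odeg d us == eG + sdeg (flatten GG)))).
- pose OS := outer_summand X1 m m n Tl s tt (read TZ h) (F xx) (flatten FF1 ++ L) (R ++ flatten FF2).
  apply: (@multilinear_linear _ _ _ W W (fun x => (-1) ^ k1 *: x) OS).
    exact: scale_linear.
  apply: outer_summand_multilinear => //.
  + move=> u w e; rewrite /s (odeg_tags d (u := take m.-1 u) (v := take m.-1 w)) ?map_take ?e //.
    congr (_ ^ (_ + _)); apply: eq_koszul => x _; exact: mid_degree_tags.
  + by move=> u u' w w' e e'; congr (_ ^ _); apply: eq_koszul => x _; apply: out_words_tags.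
- apply: (@multilinear_linear _ _ _ _ W (fun x => (-1) ^ inner_sign *: tlift K (F xx ((flatten FF1 ++ L) ++ Arrow x :: R ++ flatten FF2))) ρ) => //.
  by move=> e a b; rewrite linK scalerDr !scalerA mulrC.
- exact: multi_spanned.
move=> us /andP[uT /eqP uD].
have su : size us = m := size_out_of_type uT.
rewrite su eqxx [~~ true]/= -/(s us).
have eu : us = rcons (take m.-1 us) (last (Arrow (0 : A x0 x0 0)) us).
  case/lastP: (us) su => [|l u]; first by rewrite /m -sTG.
  rewrite size_rcons last_rcons => <-.
  by have -> : take (size l).+1.-1 (rcons l u) = l by rewrite -cats1 take_size_cat.
set us' := take m.-1 us in eu *; set u := last _ us in eu.
have su' : size us' = size TG by move: su; rewrite eu size_rcons /m -sTG => -[].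
have ρE : ρ us = pairings TG us' *: component y0 x0 (inner_degree - d) u.
  by rewrite /ρ eu -cats1 -[TG in LHS]cats0 read_cat // /read ltn0 /pairings big_nil scale1r.
have letE : letter m us = [:: u].
  by rewrite /letter eu -cats1 /m -sTG /= drop_size_cat.
have dropE : drop m us = [::] by rewrite drop_oversize // su.
rewrite ρE letE.
have HE ws : size ws = n -> read TZ h (flatten [seq out_words X1 m us ws i | i <- Tl]) =
    pairings TG us' *: K ws.
  move=> sw; have s1 : size (take (size X1) ws) = size TF1.
    by rewrite sTF1 size_takel // sw /n size_cat leq_addr.
  have -> : K ws = read (TF1 ++ TF2) h (take (size X1) ws ++ drop (size X1) ws).
    by rewrite cat_take_drop.
  rewrite read_cat // /Tl /TZ; case: rotated sTF2 => [/(_ isT) s2|_] /=.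
    have s2' : size (drop (size X1) ws) = size TF2.
      by rewrite s2 size_drop sw /n size_cat /=; lia.
    rewrite dropE cats0 cat0s -/us' !read_cat // !read_full // !scalerA.
    by congr (_ *: _); ring.
  by rewrite dropE cats0 cat0s -/us' !read_cat // !scalerA mulrC.
rewrite (multilinear_at _ _ _ _ mF) tliftZ //.
have [p0|nz] := eqVneq (pairings TG us') 0.
  rewrite p0 scale0r scaler0 (@eq_tlift _ _ _ _ _ (fun=> 0)) ?tlift0 ?scaler0 // => ws.
  by case: eqP => //= sw; rewrite HE // p0 scale0r scaler0.
have dus' := pairings_deg su' nz.
have du : odeg d [:: u] = inner_degree.
  by have := uD; rewrite eu -cats1 odeg_cat dus' /inner_degree => <-; ring.
have du' : deg u = inner_degree - d by rewrite -du odeg_cons /odeg big_nil; ring.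
have tu : tag u = (y0, x0, inner_degree - d).
  have [e1 e2] : tgt u = y0 /\ src u = x0 by apply: (@last_out_of_type _ _ _ yy us') => //; rewrite -eu.
  by rewrite -e1 -e2 -du' /tgt /src /deg; case: (tag u) => [[]].
rewrite (Arrow_component tu) /=.
set w := (flatten FF1 ++ L) ++ _.
rewrite -!tlift_scaler.
apply: (eq_tlift_spanned (P := fun ws => out_of_type xx ws && (odeg d ws == eF + sdeg w))).
- apply: multilinear_linear; first exact: scale_linear.
  apply: multilinear_linear; first exact: scale_linear.
  apply: (@inner_summand_multilinear k O A X1 m n Tl W Tl_uniq Tl_mem tt) => //.
  by move=> a a' b b' e e'; congr (_ ^ _); apply: eq_koszul => x _; apply: out_words_tags.
- apply: multilinear_linear; first exact: scale_linear.
  by apply: multilinear_linear; first exact: scale_linear.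
- exact: multi_spanned.
move=> ws /andP[/size_out_of_type sw /eqP wD].
rewrite sw eqxx [~~ true]/= HE // -/(tt us ws) !scalerA.
have sw1 : size (take (size X1) ws) = size TF1.
  by rewrite sTF1 size_takel // sw /n size_cat leq_addr.
have KE : K ws = pairings TF1 (take (size X1) ws) *: read TF2 h (drop (size X1) ws).
  by rewrite -read_cat // cat_take_drop.
have [p0|nz1] := eqVneq (pairings TF1 (take (size X1) ws)) 0.
  by rewrite KE p0 scale0r !scaler0.
have dw1 := pairings_deg sw1 nz1.
have dw2 : odeg d (drop (size X1) ws) = eF + sdeg w + sdeg TF1.
  by rewrite -wD -{2}(cat_take_drop (size X1) ws) odeg_cat dw1; ring.
have wE : sdeg w = sdeg (flatten FF1) + sdeg L + (inner_degree - (d + 1)) + (sdeg R + sdeg (flatten FF2)).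
  by rewrite /w !sdeg_cat sdeg_cons du' sdeg_cat; ring.
(* In the rotated order the sign involves the outputs of F read before those of
   G; their degree is known because all of them are contracted. *)
have [K0|rel] : K ws = 0 \/ (rotated -> eF + sdeg w + sdeg TF1 = - sdeg TF2).
  case: (rotated) sTF2 => [/(_ isT) s2|_]; last by right.
  have s2' : size (drop (size X1) ws) = size TF2.
    by rewrite s2 size_drop sw /n size_cat /=; lia.
  have [p0|nz2] := eqVneq (pairings TF2 (drop (size X1) ws)) 0.
    by left; rewrite KE read_full // p0 scale0r scaler0.
  by right; rewrite -(pairings_deg s2' nz2) dw2.
  by rewrite K0 !scaler0.
congr (_ *: _); congr (_ * _).
rewrite /s /tt !sign_mul mid_koszul /mid_degree -/us' letE dus' du dropE /inner_sign -/k1.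
have -> : koszul (fun x : nat => odeg d (out_words X1 m us ws x)) [:: 0; 1; 2; 4]%N Tl =
    if rotated then 0 else odeg d us' * odeg d (drop (size X1) ws).
  rewrite /koszul /Tl; case: rotated; rewrite !big_cons !big_nil /= -/us' dropE /odeg !big_nil;
  rewrite ?mulr0 ?mul0r ?addr0 ?add0r ?mul0r ?mulr0 ?addr0 ?add0r //; ring.
move: rel; rewrite dus' dw2 wE [odeg d [::]]big_nil; case: rotated => [/(_ isT) rel|_]; last first.
  by sign_congruence.
set X := eF + _ + _ + _ + sdeg TF1 + _.
have -> : X = 0 by rewrite /X -[sdeg TF2]opprK -rel; ring.
by sign_congruence.
Qed.

End InnerCore.

(** * Contraction of the outputs of an outer diagram *)
Section Support.
Variables (k : fieldType) (O : choiceType) (A : quiver k O) (d e : int).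
Variables (F : multi_family A).
Hypothesis F_multi : multi d e F.

Lemma size_pairs (x : seq O) : size (pairs x) = (size x).-1.
Proof. by rewrite /pairs size_zip size_behead; case: x => //= a l; apply/minn_idPr. Qed.

Lemma pairs_cat (s t : seq O) (a : O) :
  pairs (s ++ a :: t) = pairs (rcons s a) ++ pairs (a :: t).
Proof.
by elim: s => [|b [|c s] IH] //=; move: IH; rewrite /pairs /= => ->.
Qed.

Lemma pairs_mid (a b : seq O) o1 o2 :
  pairs (a ++ o1 :: o2 :: b) = pairs (rcons a o1) ++ (o1, o2) :: pairs (o2 :: b).
Proof. by rewrite pairs_cat. Qed.

(** F vanishes on words off its type, so a letter at the connected place has the
    endpoints of that place. *)
Lemma multi_support_at (X1 X2 : seq (seq O)) a b o1 o2 (l r : seq (arrow A)) (u : arrow A) :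
  size l = (sumn [seq (size x).-1 | x <- X1] + size a)%N ->
  F (X1 ++ (a ++ o1 :: o2 :: b) :: X2) (l ++ u :: r) != 0 -> tgt u = o1 /\ src u = o2.
Proof.
move=> sl /eqP nz.
have : is_type (X1 ++ (a ++ o1 :: o2 :: b) :: X2) && of_type (X1 ++ (a ++ o1 :: o2 :: b) :: X2) (l ++ u :: r).
  by apply/negPn/negP => /(multi_support F_multi).
move=> /andP[_ /eqP]; rewrite map_cat /= map_cat flatten_cat /= pairs_mid -!catA catA /=.
move=> /eqP; rewrite eqseq_cat.
  by move=> /andP[_ /eqP[-> -> _]].
rewrite size_map size_cat size_flatten /shape -map_comp sl size_pairs size_rcons.
by congr (sumn _ + _)%N; apply: eq_map => x; rewrite /= size_pairs.
Qed.

End Support.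

Section OuterCore.
Variables (k : fieldType) (O : choiceType) (A : quiver k O) (d eF eG : int).
Local Notation Q := (ext A d).
Variables (F G : multi_family A).
Hypotheses (F_multi : multi d eF F) (G_multi : multi d eG G).
Variables (X2 : seq (seq O)) (a b : seq O) (o1 o2 : O) (yy : seq (seq O)) (c : nat).
Variables (FF2 G4 G5 G6 G7 : seq (seq (arrow A))) (L R : seq (arrow A)).
Variables (TF TG1 TG2 : seq (arrow Q)).

Local Notation xv := (a ++ o1 :: o2 :: b).
Local Notation xx := (xv :: X2).
Local Notation j := (size a).+2.
Local Notation GG := (G4 ++ G5 ++ G6 ++ G7).

Hypothesis sF2 : shape FF2 = map predn (map size X2).
Hypothesis sG : shape GG = map predn (map size yy).
Hypothesis sL : size L = size a.
Hypothesis sR : size R = size b.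
Hypothesis sTF : size TF = size xx.
Hypothesis sTG1 : size TG1 = c.-1.
Hypothesis c_bounds : (0 < c <= size yy)%N.

Variables (W : lmodType k) (h : seq (arrow A) -> W).
Hypothesis mh : multilinear h.

Let n := size xx.
Let m := size yy.
Let Tl := [:: 0; 2; 1; 4]%N.
Variables (t : nat) (Sl : seq nat).
Hypothesis in_arr : flatten (rot t (sectors xx yy c 1)) =
  flatten (map (in_group n m 1 (size G4) (size G4 + size G5) (size G4 + size G5 + size G6)) Sl).
Hypothesis out_arr : rot t (frees xx yy c 1) = flatten (map (out_group n m c 1) Tl).
Hypothesis Sl_perm : Sl =i iota 0 8.

(** The degree of the form left after contracting all the outputs of F. *)
Definition outer_degree := eF + sdeg L + sdeg R + sdeg (flatten FF2) + sdeg TF - d.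

Variable (g : Defs.form (A o1 o2 (- (d - 1 + outer_degree)))).
Hypothesis gE : forall u, g u = tlift (read TF read_nil) (F xx (L ++ Arrow u :: R ++ flatten FF2)).

Definition outer_input : arrow Q :=
  @Arrow _ _ Q o2 o1 outer_degree (0, g).

Definition outer_sign :=
  let B := sdeg TG1 in
  let C := 1 - outer_degree in
  let f1 := sdeg L in
  let f2 := sdeg R + sdeg (flatten FF2) in
  let D := eG + sdeg (flatten GG) + sdeg TG1 - C in
  koszul (fun x => sdeg (group_piece [::] FF2 G4 G5 G6 G7 L R x)) Sl [:: 4; 5; 6; 7; 0; 1; 2; 3]%N
  + ((d + 1) * eF + (eF + d + 1) * (d + 1) + (d + 1) * f1)
  + (B * C + B * f1 + B * f2 + C * f1 + D * f1 + D * f2)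
  + B * sdeg TF.

Lemma pairing_outer_input (u : arrow A) :
  pairing outer_input u = g (component o1 o2 (- (d - 1 + outer_degree)) u).
Proof. by []. Qed.

(** All outputs of F are contracted, so what remains of F is a form [g] in the
    connected input.  The connected output of G is then read by [g], exactly as
    its other outputs are read by the forms of the word. *)
Lemma outer_diagram :
  tlift (read (TG1 ++ TF ++ TG2) h)
    (diagram d xx yy c 1 j false eF (F xx) (G yy) t
       (flatten (map (group_piece [::] FF2 G4 G5 G6 G7 L R) Sl))) =
  (-1) ^ outer_sign *: tlift (read (TG1 ++ outer_input :: TG2) h) (G yy (flatten GG)).
Proof.
have mF := multi_linear F_multi xx; have mG := multi_linear G_multi yy.
have Tl_mem : Tl =i [:: 0; 1; 2; 4]%N.
  by move=> x; rewrite !inE; case: x => [|[|[|[|[|x]]]]].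
have Tl_uniq : uniq Tl by [].
set TZ := TG1 ++ TF ++ TG2.
have mread := read_multilinear TZ mh.
have j_le : (j <= size xv)%N by rewrite size_cat /=; lia.
have sL' : size L = (j - 2)%N by rewrite sL subSS subn1.
have sR' : size R = (size xv - j)%N by rewrite sR size_cat /=; lia.
rewrite (@tlift_diagram _ _ _ d [::] X2 xv yy c j [::] FF2 G4 G5 G6 G7 L R
  erefl sF2 sG j_le sL' sR' c_bounds t Sl Tl in_arr out_arr) //.
set k1 := koszul _ _ _; set U := G yy _.
have mρ : multilinear (read (TG1 ++ outer_input :: TG2) h) by apply: read_multilinear.
rewrite -!tlift_scaler.
pose s (us : seq (arrow A)) := (-1 : k) ^ ((d + 1) * eF + (eF + d + 1) * (d + 1) +
  (d + 1) * (sdeg (flatten ([::] : seq (seq (arrow A)))) + sdeg L) +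
  koszul (mid_degree d c [::] FF2 L R false us) [:: 2; 3; 4; 5; 6]%N [:: 5; 3; 6; 2; 4]%N).
pose tt (us ws : seq (arrow A)) := (-1 : k) ^ koszul (fun x => odeg d (out_words [::] c us ws x)) [:: 0; 1; 2; 4]%N Tl.
have tt_inv (u u' w w' : seq (arrow A)) : map tag u = map tag u' -> map tag w = map tag w' -> tt u w = tt u' w'.
  by move=> e e'; congr (_ ^ _); apply: eq_koszul => x _; apply: out_words_tags.
apply: (eq_tlift_spanned (P := fun us => out_of_type yy us && (odeg d us == eG + sdeg (flatten GG)))).
- pose OS := outer_summand [::] c m n Tl s tt (read TZ h) (F xx) (flatten [::] ++ L) (R ++ flatten FF2).
  apply: (@multilinear_linear _ _ _ W W (fun x => (-1) ^ k1 *: x) OS).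
    exact: scale_linear.
  apply: outer_summand_multilinear => //.
  by move=> u w e; congr (_ ^ (_ + _)); apply: eq_koszul => x _; exact: mid_degree_tags.
- apply: multilinear_linear => //.
  exact: scale_linear.
- exact: multi_spanned.
move=> us /andP[uT /eqP uD].
have su : size us = m := size_out_of_type uT.
rewrite su eqxx [~~ true]/= -/(s us).
have /andP[c0 cm] := c_bounds.
have [u eu] : exists u, us = take c.-1 us ++ u :: drop c us.
  have := cat_take_drop c.-1 us; case ed : (drop c.-1 us) (size_drop c.-1 us) => [|u l] /= sd e; first by lia.
  by exists u; rewrite -(prednK c0) -add1n -drop_drop ed /= drop0.
set us1 := take c.-1 us in eu *; set us2 := drop c us in eu *.
have su1 : size us1 = size TG1 by rewrite size_takel ?sTG1 // su; lia.
have letE : letter c us = [:: u].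
  by rewrite /letter eu drop_size_cat ?su1 ?sTG1 //= take0.
rewrite letE.
have RE : read (TG1 ++ outer_input :: TG2) h us =
    (pairings TG1 us1 * pairing outer_input u) *: read TG2 h us2.
  rewrite eu read_cat // -cat1s -[u :: us2]cat1s read_cat // scalerA.
  by rewrite /pairings big_cons big_nil mulr1.
have HE ws : size ws = n -> read TZ h (flatten [seq out_words [::] c us ws i | i <- Tl]) =
    (pairings TG1 us1 * pairings TF ws) *: read TG2 h us2.
  move=> sw; rewrite /= take0 drop0 cats0 ?cat0s -/us1 -/us2 /TZ read_cat // read_cat ?scalerA //.
  by rewrite sw sTF.
rewrite RE; have [p0|nz] := eqVneq (pairings TG1 us1) 0.
  rewrite p0 mul0r scale0r scaler0 (@eq_tlift _ _ _ _ _ (fun=> 0)) ?tlift0 ?scaler0 // => ws.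
  by case: eqP => //= sw; rewrite HE // p0 mul0r scale0r scaler0.
have dus1 := pairings_deg su1 nz.
set w := (flatten [::] ++ L) ++ _.
have mI : multilinear (inner_summand [::] c n Tl tt (read TZ h) us).
  apply: inner_summand_multilinear => //.
set V := read TG2 h us2 in HE *; rewrite pairing_outer_input.
(* A letter that the form cannot read also contributes nothing to the diagram:
   wrong endpoints annihilate F, a wrong degree one of the other forms. *)
have [tu|ntu] := eqVneq (tag u) (o1, o2, - (d - 1 + outer_degree)); last first.
  rewrite component_neq //; have -> : g 0 = 0 :> k.
    have /asboolP l := form_linear g; have := l (-1) 0 0.
    by rewrite scaler0 addr0 scaleN1r addNr.
  rewrite mulr0 scale0r scaler0.
  have [F0|F1] := eqVneq (F xx w) 0.
    by rewrite F0 (tlift_zero mI) !scaler0.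
  have [e1 e2] : tgt u = o1 /\ src u = o2.
    by apply: (multi_support_at F_multi (X1 := [::])) F1; rewrite /= sL.
  rewrite (eq_tlift_spanned (h := fun=> 0) mI _ (multi_spanned _ _ F_multi)); first by rewrite tlift0 !scaler0.
    by move=> l r y x i e p q; rewrite scaler0 addr0.
  move=> ws /andP[/size_out_of_type sw /eqP wD]; rewrite /inner_summand sw eqxx /= -/us1 HE //.
  have [->|nzF] := eqVneq (pairings TF ws) 0; first by rewrite mulr0 scale0r scaler0.
  case/eqP: ntu; have := pairings_deg _ nzF; rewrite wD sw sTF => /(_ erefl) dw.
  rewrite -e1 -e2 (_ : - (d - 1 + outer_degree) = deg u); first by rewrite /tgt /src /deg; case: (tag u) => [[]].
  rewrite /outer_degree; move: dw; rewrite /w !sdeg_cat sdeg_cons !sdeg_nil.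
  by move: (sdeg L) (sdeg R) (sdeg (flatten FF2)) (sdeg TF) (deg u) => *; lia.
have wE : w = L ++ Arrow (component o1 o2 (- (d - 1 + outer_degree)) u) :: R ++ flatten FF2.
  by rewrite (Arrow_component tu).
rewrite gE -wE.
have linV : linear (fun x : k^o => (pairings TG1 us1 * x) *: V).
  by move=> e x y; rewrite mulrDr scalerDl scalerA /GRing.scale /= mulrCA.
rewrite (linear_tlift _ _ linV) -!tlift_scaler; apply: eq_tlift => ws.
rewrite read_nilE sTF -/n; have [sw|nsw] := eqVneq (size ws) n; last first.
  by rewrite !(scaler0, mulr0, scale0r).
rewrite [~~ true]/= HE // -/(tt us ws).
have [->|nzF] := eqVneq (pairings TF ws) 0; first by rewrite mulr0 scale0r !scaler0.
have dws : odeg d ws = - sdeg TF by apply: pairings_deg; rewrite // sw sTF.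
rewrite !scalerA; congr (_ *: _); rewrite !mulrA; congr (_ * _ * _).
have du : odeg d [:: u] = 1 - outer_degree.
  by rewrite odeg_cons /odeg big_nil /deg tu /=; ring.
have dus2 : odeg d us2 = eG + sdeg (flatten GG) + sdeg TG1 - (1 - outer_degree).
  by rewrite -uD eu -cat1s !odeg_cat du dus1; ring.
rewrite /s /tt !sign_mul mid_koszul /mid_degree -/us1 -/us2 letE du dus1 dus2 sdeg_nil /outer_sign -/k1.
have -> : koszul (fun x : nat => odeg d (out_words [::] c us ws x)) [:: 0; 1; 2; 4]%N Tl =
    odeg d ws * odeg d us1.
  by rewrite /koszul /Tl !big_cons !big_nil /= -/us1 -/us2 drop0 ?mulr0 ?mul0r ?addr0 ?add0r.
rewrite dus1 dws.
move: outer_degree => D; sign_congruence.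
Qed.

End OuterCore.

(** * Objects of words, forms and sizes *)
Section Objects.
Variables (k : fieldType) (O : choiceType) (B : quiver k O).
Implicit Types (w wl mid wr : seq (arrow B)) (P Y R : seq O).

Lemma pairs_insert P y Y R :
  pairs (P ++ (y :: Y) ++ R) = pairs (rcons P y) ++ pairs (y :: Y) ++ pairs (last y Y :: R).
Proof.
rewrite /= pairs_cat; congr (_ ++ _).
elim: Y y => [|z Y IH] y //=.
by have := IH z; rewrite /pairs /= => ->.
Qed.

Lemma endpoints_ends a w y Y : map (@endpoints _ _ B) (a :: w) = pairs (y :: Y) ->
  tgt a = y /\ src (last a w) = last y Y.
Proof.
case: Y => [|z Y] //= [-> sz]; rewrite -/(pairs (z :: Y)) => e; split => //.
elim: w a z Y sz e => [|b w IH] a z [|z' Y] //= sz [e1 e2 e3].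
by apply: IH e3.
Qed.

Lemma block_word_size xx w : (map (@endpoints _ _ B) w == pairs (flatten (rev xx))) ->
  size w = (size (flatten xx)).-1.
Proof.
move=> /eqP /(congr1 size); rewrite size_map size_pairs => ->.
by rewrite !size_flatten /shape map_rev sumn_rev.
Qed.

(** The rest of a word only sees the end objects [y] and [last y Y] of a subword. *)
Lemma objects_insert P y Y R wl mid wr : size wl = size P -> size wr = size R ->
  size mid = size Y ->
  (map (@endpoints _ _ B) (wl ++ mid ++ wr) == pairs (P ++ (y :: Y) ++ R)) =
  [&& map (@endpoints _ _ B) wl == pairs (rcons P y),
      map (@endpoints _ _ B) mid == pairs (y :: Y) &
      map (@endpoints _ _ B) wr == pairs (last y Y :: R)].
Proof.
move=> sl sr sm; rewrite pairs_insert !map_cat eqseq_cat ?eqseq_cat //.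
  by rewrite size_map size_pairs.
by rewrite size_map size_pairs size_rcons.
Qed.

End Objects.

Section Forms.
Variables (k : fieldType) (U : lmodType k).

Lemma to_formE (f : U -> k^o) : linear f -> to_form f =1 f.
Proof.
move=> lf u; rewrite /to_form /insubd; case: insubP => [g _ <- //|].
by move=> /negP[]; apply/asboolP.
Qed.

Lemma form_ext (f g : Defs.form U) : f =1 g -> f = g.
Proof. by move=> e; apply: val_inj; apply: functional_extensionality_dep. Qed.

Lemma to_form_scale (c : k) (f : U -> k^o) : linear f ->
  c *: to_form f = to_form (fun u => c *: f u).
Proof.
move=> lf; apply: form_ext => u.
have lcf : linear (fun u => c *: f u).
  by move=> e x y; rewrite lf scalerDr !scalerA mulrC.
by rewrite (to_formE lcf) -(to_formE lf).
Qed.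

Lemma to_form_if (b : bool) (f : U -> k^o) :
  (if b then to_form f else 0) = to_form (fun u => if b then f u else 0).
Proof.
case: b; first by apply: eq_to_form.
apply: form_ext => u; rewrite to_formE // => e x y.
by rewrite scaler0 addr0.
Qed.

End Forms.

Lemma sdeg_toA (k : fieldType) (O : choiceType) (A : quiver k O) d (w : seq (arrow (ext A d))) :
  sdeg (map (@toA _ _ A d) w) = sdeg w.
Proof. by rewrite /sdeg big_map. Qed.

Lemma shape_toA (k : fieldType) (O : choiceType) (A : quiver k O) d (ss : seq (seq (arrow (ext A d)))) :
  shape (map (map (@toA _ _ A d)) ss) = shape ss.
Proof. by rewrite /shape -map_comp; apply: eq_map => s; rewrite /= size_map. Qed.

Lemma sumz_sdeg_toA (k : fieldType) (O : choiceType) (A : quiver k O) d (ss : seq (seq (arrow (ext A d)))) :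
  sdeg (flatten (map (map (@toA _ _ A d)) ss)) = sumz (map (@sdeg _ _ _) ss).
Proof.
rewrite sdeg_flatten -map_comp; congr sumz; apply: eq_map => s; exact: sdeg_toA.
Qed.

Lemma sdeg_assemble (k : fieldType) (O : choiceType) (B : quiver k O) (SS : seq (seq (arrow B))) TT :
  size SS = (size TT).+1 -> sdeg (assemble SS TT) = sumz (map (@sdeg _ _ _) SS) + sdeg TT.
Proof.
elim: SS TT => [|s SS IH] [|t TT] //=.
  by case: SS {IH} => //= _; rewrite sumz_cons sumz_nil sdeg_nil !addr0.
move=> [e]; rewrite sdeg_cat IH // !sdeg_cons sumz_cons; ring.
Qed.

Lemma size_flatten_rev (T : Type) (X : seq (seq T)) : size (flatten (rev X)) = size (flatten X).
Proof. by rewrite !size_flatten /shape map_rev sumn_rev. Qed.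

Lemma sumn_succ (T : Type) (SS : seq (seq T)) :
  sumn [seq (size s).+1 | s <- SS] = (sumn (shape SS) + size SS)%N.
Proof. by elim: SS => //= s SS ->; lia. Qed.

Section WordSizes.
Variables (S T : Type).
Implicit Types (X : seq (seq S)) (a b : seq S) (FF : seq (seq T)) (L R TT : seq T).

Lemma size_left X a L FF TT : map size X = [seq (size s).+1 | s <- FF] ->
  size FF = size TT -> size L = size a ->
  size (assemble (L :: FF) TT) = size (flatten (rev X) ++ a).
Proof.
move=> sX sT sL; rewrite size_assemble /= ?sT // size_cat size_flatten_rev size_flatten /shape sX.
by rewrite sumn_succ -sT sL /shape; lia.
Qed.

Lemma size_right X b R FF TT : map size X = [seq (size s).+1 | s <- FF] ->
  size FF = size TT -> size R = size b ->
  size (assemble (rcons FF R) TT) = size (b ++ flatten (rev X)).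
Proof.
move=> sX sT sR; rewrite size_assemble ?size_rcons ?sT // size_cat size_flatten_rev size_flatten /shape sX.
by rewrite sumn_succ map_rcons -cats1 sumn_cat /= addn0 sR -sT /shape; lia.
Qed.

End WordSizes.

Lemma size_fits_word (k : fieldType) (O : choiceType) (A : quiver k O) d xx (SS : seq (seq (arrow (ext A d)))) TT :
  fits xx SS TT -> size (assemble SS TT) = (size (flatten (rev xx))).-1.
Proof.
move=> f; rewrite size_assemble ?f.2 // size_flatten_rev size_flatten /shape f.1 sumn_succ f.2.
by rewrite addnS.
Qed.

Lemma fits_shape (k : fieldType) (O : choiceType) (A : quiver k O) d xx (SS : seq (seq (arrow (ext A d)))) TT :
  fits xx SS TT -> shape SS = map predn (map size xx).
Proof. by case=> -> _; rewrite -map_comp; apply: eq_map. Qed.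

(** * Inner diagrams and the inserted letter *)
Section Ends.
Variable (O : choiceType).

(** The objects of a word of block type run from the target to the source of the
    last output. *)
Lemma flatten_rev_ends (yy : seq (seq O)) : yy != [::] -> all (fun x => x != [::]) yy ->
  exists y Y, [/\ flatten (rev yy) = y :: Y, lt_obj (last [::] yy) = Some y
                & rt_obj (head [::] yy) = Some (last y Y)].
Proof.
case: yy => // y1 yy _; rewrite [all _ _]/(_ && all _ yy) => /andP[n1 nyy].
have [z [Z e]] : exists z Z, y1 = rcons Z z by case/lastP: y1 n1 => // Z z _; exists z, Z.
have [y [Y [e1 e2]]] : exists y Y, flatten (rev (y1 :: yy)) = y :: Y /\ lt_obj (last [::] (y1 :: yy)) = Some y.
  case/lastP: yy nyy => [_|yy l].
    by rewrite /= cats0; case: (y1) n1 => // y Y _; exists y, Y.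
  rewrite all_rcons => /andP[nl _]; rewrite [last _ _]/= last_rcons.
  rewrite rev_cons rev_rcons; case: l nl => // y Y _ /=.
  by exists y, (Y ++ flatten (rcons (rev yy) y1)).
exists y, Y; split => //; rewrite e /= /rt_obj rev_rcons /=; congr Some.
have <- : last y (y :: Y) = last y Y by [].
by rewrite -e1 e rev_cons flatten_rcons last_cat last_rcons.
Qed.

End Ends.

Section InnerTransfer.
Variables (k : fieldType) (O : choiceType) (A : quiver k O) (d eF eG : int).
Local Notation Q := (ext A d).
Local Notation toA := (@toA k O A d).
Variables (F G : multi_family A).
Hypotheses (F_multi : multi d eF F) (G_multi : multi d eG G).
Variables (X1 X2 : seq (seq O)) (a b : seq O) (o1 o2 : O) (yy : seq (seq O)).
Variables (FF1 FF2 G4 G5 G6 G7 : seq (seq (arrow A))) (L R : seq (arrow A)).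
Variables (GQ : seq (seq (arrow Q))) (TF1 TF2 TG : seq (arrow Q)).
Hypothesis yy_type : is_type yy.

Local Notation xv := (a ++ o1 :: o2 :: b).
Local Notation xx := (X1 ++ xv :: X2).
Local Notation v := (size X1).+1.
Local Notation j := (size a).+2.

Hypothesis sF1 : shape FF1 = map predn (map size X1).
Hypothesis sF2 : shape FF2 = map predn (map size X2).
Hypothesis GQ_fits : fits yy GQ TG.
Hypothesis GQ_cut : map (map toA) GQ = G4 ++ G5 ++ G6 ++ G7.
Hypothesis sL : size L = size a.
Hypothesis sR : size R = size b.
Hypothesis sTF1 : size TF1 = size X1.
Variables (W : lmodType k) (h : seq (arrow A) -> W).
Hypothesis mh : multilinear h.
Variable (rotated : bool).
Hypothesis sTF2 : rotated -> size TF2 = (size X2).+1.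

Let n := size xx.
Let m := size yy.
Let Tl := if rotated then [:: 0; 4; 1; 2]%N else [:: 0; 4; 2; 1]%N.
Let TZ := if rotated then TF1 ++ TF2 ++ TG else TF1 ++ TG ++ TF2.
Variables (t : nat) (Sl : seq nat).
Hypothesis in_arr : flatten (rot t (sectors xx yy m v)) =
  flatten (map (in_group n m v (size G4) (size G4 + size G5) (size G4 + size G5 + size G6)) Sl).
Hypothesis out_arr : rot t (frees xx yy m v) = flatten (map (out_group n m m v) Tl).
Hypothesis Sl_perm : Sl =i iota 0 8.

Variables (am : arrow Q) (mid' : seq (arrow Q)).
Local Notation mid := (am :: mid').
Hypothesis midE : mid = assemble GQ TG.
Variables (bz bx : bool).
Hypothesis bz_mid : bz -> block_word yy mid.
Hypothesis bx_mid : block_word yy mid ->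
  bx = bz && ((o1, o2) == (tgt am, src (last am mid'))).

(** The letter fed to F by the insertion of the part valued in A of j(G). *)
Definition inserted : arrow A :=
  Arrow (jA yy mid eG (G yy) (tgt am) (src (last am mid')) (eG - (d + 1) + sdeg mid + 1)).

Variables (sZ sF E : int).
Hypothesis signs : parity (sZ + inner_sign eF eG FF1 FF2 G4 G5 G6 G7 L R TF1 TF2 TG rotated Sl) =
  parity (E + sF + jA_sign GQ TG eG).

(** Compares the composed map with the map in which j(G) has been inserted, each
    restricted to its own words: [bz] and [bx] say that the objects match.  If
    they match in the composed word but not at the inserted letter, F vanishes
    by its type.  Only the congruence [signs] is left to the cases. *)
Lemma inner_transfer :
  (if bz then (-1) ^ sZ *: tlift (read TZ h)
     (diagram d xx yy m v j true eF (F xx) (G yy) t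
       (flatten (map (group_piece FF1 FF2 G4 G5 G6 G7 L R) Sl))) else 0) =
  (-1) ^ E *: (if bx then (-1) ^ sF *: tlift (read (TF1 ++ TF2) h)
    (F xx ((flatten FF1 ++ L) ++ inserted :: R ++ flatten FF2)) else 0).
Proof.
have mF := multi_linear F_multi xx.
have mread : multilinear (read (TF1 ++ TF2) h) by apply: read_multilinear.
have Fzero y x i : F xx ((flatten FF1 ++ L) ++ Arrow (0 : A y x i) :: R ++ flatten FF2) = 0.
  exact: multilinear_at0.
have [byy|nby] := boolP (block_word yy mid); last first.
  have -> : bz = false by apply/negP => /bz_mid; apply/negP.
  case: bx; rewrite ?scaler0 // /inserted /jA nby Fzero.
  by rewrite (tlift_zero mread) !scaler0.
rewrite bx_mid //; case: bz => /=; last by rewrite scaler0.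
have [y [Y [eY hl hr]]] : exists y Y, [/\ flatten (rev yy) = y :: Y, lt_obj (last [::] yy) = Some y
                & rt_obj (head [::] yy) = Some (last y Y)].
  by case/and3P: yy_type => yy0 ally _; apply: flatten_rev_ends.
have [ey ex] : tgt am = y /\ src (last am mid') = last y Y.
  by apply: endpoints_ends; rewrite -eY; apply/eqP.
have sdm : sdeg mid = sdeg (flatten (G4 ++ G5 ++ G6 ++ G7)) + sdeg TG.
  by rewrite midE (sdeg_assemble GQ_fits.2) -GQ_cut sumz_sdeg_toA.
have degE : inner_degree eG G4 G5 G6 G7 TG - d = eG - (d + 1) + sdeg mid + 1.
  by rewrite sdm /inner_degree; ring.
have core := @inner_diagram k O A d eF eG F G F_multi G_multi X1 X2 xv yy j FF1 FF2 G4 G5 G6 G7 L R TF1 TF2 TG sF1 sF2.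
have insE : F xx ((flatten FF1 ++ L) ++ inserted :: R ++ flatten FF2) =
  (-1) ^ jA_sign GQ TG eG *: F xx ((flatten FF1 ++ L) ++
     Arrow (tlift (read TG (read_component y (last y Y) (inner_degree eG G4 G5 G6 G7 TG - d)))
       (G yy (flatten (G4 ++ G5 ++ G6 ++ G7)))) :: R ++ flatten FF2).
  rewrite degE /inserted midE (jA_assemble GQ_fits) -midE byy.
  by rewrite (multilinear_at _ _ _ _ mF) ey ex GQ_cut.
have sG : shape (G4 ++ G5 ++ G6 ++ G7) = map predn (map size yy).
  by rewrite -GQ_cut shape_toA (fits_shape GQ_fits).
have j_le : (j <= size xv)%N by rewrite size_cat /=; lia.
have sL' : size L = (j - 2)%N by rewrite sL subSS subn1.
have sR' : size R = (size xv - j)%N by rewrite sR size_cat /=; lia.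
have sTG : (size TG).+1 = size yy by rewrite -(fits_size GQ_fits) GQ_fits.2.
rewrite /TZ (core sG j_le sL' sR' sTF1 sTG W h mh y (last y Y) rotated hl hr sTF2 t Sl in_arr out_arr Sl_perm).
rewrite scalerA sign_mul; case: eqP => [_|nm].
  rewrite insE tliftZ // !scalerA !sign_mul; congr (_ *: _); apply: eq_sign.
  by rewrite signs.
rewrite scaler0; set Fw := F xx _.
have [->|nz] := eqVneq Fw 0; first by rewrite (tlift_zero mread) scaler0.
case: nm; rewrite ey ex.
have sl : size (flatten FF1 ++ L) = (sumn [seq (size x).-1 | x <- X1] + size a)%N.
  rewrite size_cat size_flatten sL; congr (sumn _ + _)%N.
  by rewrite sF1 -map_comp; apply: eq_map.
by have [<- <-] := multi_support_at F_multi sl nz.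
Qed.

End InnerTransfer.

(** * Inner compositions: the part valued in A *)
(** Each of the following four permutations is the one sorting the groups of
    inputs, in the order of the composed type, into the inputs of G followed by
    those of F. *)
Lemma koszul_single (g : nat -> int) :
  koszul g [:: 0; 1; 4; 5; 6; 7; 2; 3]%N [:: 4; 5; 6; 7; 0; 1; 2; 3]%N =
  (g 0%N + g 1%N) * (g 4%N + g 5%N + g 6%N + g 7%N).
Proof. by rewrite /koszul unlock /=; ring. Qed.
Lemma koszul_inner (g : nat -> int) :
  koszul g [:: 0; 4; 2; 5; 1; 6; 7; 3]%N [:: 4; 5; 6; 7; 0; 1; 2; 3]%N =
  g 0%N * (g 4%N + g 5%N + g 6%N + g 7%N) + g 2%N * (g 5%N + g 6%N + g 7%N) + g 1%N * (g 6%N + g 7%N) + g 2%N * g 1%N.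
Proof. by rewrite /koszul unlock /=; ring. Qed.
Lemma koszul_rotated (g : nat -> int) :
  koszul g [:: 0; 1; 6; 7; 3; 4; 2; 5]%N [:: 4; 5; 6; 7; 0; 1; 2; 3]%N =
  (g 0%N + g 1%N) * (g 4%N + g 5%N + g 6%N + g 7%N) + (g 6%N + g 7%N + g 3%N) * (g 4%N + g 5%N) + g 3%N * g 2%N + g 2%N * g 5%N.
Proof. by rewrite /koszul unlock /=; ring. Qed.
Lemma koszul_outer (g : nat -> int) :
  koszul g [:: 0; 4; 1; 5; 3; 6; 2; 7]%N [:: 4; 5; 6; 7; 0; 1; 2; 3]%N =
  g 0%N * (g 4%N + g 5%N + g 6%N + g 7%N) + g 1%N * (g 5%N + g 6%N + g 7%N)
  + g 3%N * (g 6%N + g 7%N + g 2%N) + g 2%N * g 7%N.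
Proof. by rewrite /koszul unlock /=; ring. Qed.

Section Graft.
Variable T : Type.
Implicit Types (l r : seq T) (gg FF : seq (seq T)).

(** The blocks obtained by inserting the blocks [gg] between [l] and [r]; in words
    they are read from right to left, so [r] continues the first block. *)
Definition graft l r gg : seq (seq T) :=
  if gg is g1 :: gg' then
    if gg' is g2 :: gg'' then (g1 ++ r) :: rcons (belast g2 gg'') (l ++ last g2 gg'')
    else [:: l ++ g1 ++ r]
  else [:: l ++ r].

Lemma graft2 l r g1 gm gl :
  graft l r (g1 :: rcons gm gl) = (g1 ++ r) :: rcons gm (l ++ gl).
Proof. by case: gm => [|g2 gm] //=; rewrite last_rcons belast_rcons. Qed.

Lemma one_or_more gg : gg <> [::] ->
  (exists g, gg = [:: g]) \/ (exists g1 gm gl, gg = g1 :: rcons gm gl).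
Proof.
case: gg => [//|g1 gg _]; case/lastP: gg => [|gm gl]; first by left; exists g1.
by right; exists g1, gm, gl.
Qed.

Lemma flatten_rev_graft l r gg : gg <> [::] ->
  flatten (rev (graft l r gg)) = l ++ flatten (rev gg) ++ r.
Proof.
case/one_or_more => [[g ->]|[g1 [gm [gl ->]]]]; first by rewrite /= !cats0.
by rewrite graft2 !rev_cons !rev_rcons !flatten_rcons /= -!catA.
Qed.

Lemma size_graft l r gg : gg <> [::] -> size (graft l r gg) = size gg.
Proof.
case/one_or_more => [[g ->]|[g1 [gm [gl ->]]]]; first by [].
by rewrite graft2 /= !size_rcons.
Qed.

Lemma assemble_block FF1 l s r FF2 TT1 TT2 : size FF1 = size TT1 ->
  assemble (FF1 ++ (l ++ s ++ r) :: FF2) (TT1 ++ TT2) =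
  assemble (l :: FF2) TT2 ++ s ++ assemble (rcons FF1 r) TT1.
Proof.
move=> sz; rewrite assemble_cat // !assemble_head -!catA; congr (_ ++ (_ ++ _)).
by rewrite -[in RHS]cats1 -[TT1 in RHS]cats0 assemble_cat //.
Qed.

(** Inserting a word at a letter of a block is grafting its blocks. *)
Lemma assemble_graft FF1 l r FF2 gg TT1 TT2 TG :
  size FF1 = size TT1 -> size gg = (size TG).+1 ->
  assemble (FF1 ++ graft l r gg ++ FF2) (TT1 ++ TG ++ TT2) =
  assemble (l :: FF2) TT2 ++ assemble gg TG ++ assemble (rcons FF1 r) TT1.
Proof.
move=> s1 sg; have gg0 : gg <> [::] by case: gg sg.
case/one_or_more: gg0 sg => [[g ->]|[g1 [gm [gl ->]]]].
  by case: TG => // _; rewrite /graft assemble_block.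
rewrite [size _]/= size_rcons => -[sm]; rewrite graft2 cat_cons cat_rcons.
have sg : size (g1 :: gm) = size TG by rewrite /= sm.
rewrite (assemble_cat _ _ _ s1) assemble_head.
rewrite (@assemble_cat _ (g1 :: gm) (l ++ gl) FF2 TG TT2 sg) assemble_head.
have -> : assemble (g1 :: rcons gm gl) TG = gl ++ assemble (rcons (g1 :: gm) [::]) TG.
  by rewrite -{1}[TG]cats0 -cats1 (@assemble_cat _ (g1 :: gm) gl [::] TG [::] sg).
have -> : assemble (rcons FF1 r) TT1 = r ++ assemble (rcons FF1 [::]) TT1.
  by rewrite -{1}[TT1]cats0 -cats1 (@assemble_cat _ FF1 r [::] TT1 [::] s1).
by rewrite -!catA.
Qed.

End Graft.

Section Cross.
Variables (k : fieldType) (O : choiceType) (A : quiver k O) (d : int).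
Local Notation Q := (ext A d).
Implicit Types (SS FF : seq (seq (arrow Q))) (TT s l r g : seq (arrow Q)).

Definition sdegs SS : int := sumz (map (@sdeg _ _ Q) SS).
Definition cross TT SS : int := crosssum (shifted_degrees TT) (map (@sdeg _ _ Q) SS).
Definition pairs_sdeg SS : int := pairsum (map (@sdeg _ _ Q) SS).

Lemma sdegs_cat SS FF : sdegs (SS ++ FF) = sdegs SS + sdegs FF.
Proof. by rewrite /sdegs map_cat sumz_cat. Qed.
Lemma sdegs_cons s FF : sdegs (s :: FF) = sdeg s + sdegs FF.
Proof. exact: sumz_cons. Qed.
Lemma sdegs_rcons FF s : sdegs (rcons FF s) = sdegs FF + sdeg s.
Proof. by rewrite /sdegs map_rcons sumz_rcons. Qed.
Lemma sdegs_nil : sdegs [::] = 0. Proof. exact: sumz_nil. Qed.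

Lemma pairs_sdeg_cat SS FF : pairs_sdeg (SS ++ FF) = pairs_sdeg SS + pairs_sdeg FF + sdegs SS * sdegs FF.
Proof. by rewrite /pairs_sdeg map_cat pairsum_cat. Qed.
Lemma pairs_sdeg_cons s FF : pairs_sdeg (s :: FF) = sdeg s * sdegs FF + pairs_sdeg FF.
Proof. by []. Qed.
Lemma pairs_sdeg_rcons FF s : pairs_sdeg (rcons FF s) = pairs_sdeg FF + sdegs FF * sdeg s.
Proof. by rewrite -cats1 pairs_sdeg_cat pairs_sdeg_cons sdegs_cons /pairs_sdeg /= sdegs_nil; ring. Qed.
Lemma pairs_sdeg_nil : pairs_sdeg [::] = 0. Proof. by []. Qed.

Lemma cross_cat TT1 TT2 SS FF : size TT1 = size SS ->
  cross (TT1 ++ TT2) (SS ++ FF) = cross TT1 SS + cross TT2 FF + sdeg TT1 * sdegs FF.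
Proof.
move=> e; rewrite /cross /shifted_degrees !map_cat crosssum_cat ?size_map //.
by rewrite -sumz_shifted_degrees.
Qed.

Lemma cross_head TT s FF : cross TT (s :: FF) = cross TT ([::] :: FF).
Proof. by case: TT. Qed.

Lemma cross_block TT1 TT2 FF1 s FF2 : size FF1 = size TT1 ->
  cross (TT1 ++ TT2) (FF1 ++ s :: FF2) =
  cross TT1 FF1 + cross TT2 ([::] :: FF2) + sdeg TT1 * (sdeg s + sdegs FF2).
Proof. by move=> e; rewrite cross_cat // cross_head sdegs_cons. Qed.

Lemma cross_rcons TT s FF s' : size FF = size TT -> 
  cross TT (rcons FF s') = cross TT FF + sdeg TT * sdeg s'.
Proof.
move=> e; rewrite -[TT in LHS]cats0 -cats1 cross_cat //.
by rewrite sdegs_cons sdegs_nil /cross /= ; ring.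
Qed.

Lemma cross_graft TT1 TT2 TG FF1 l r g1 gm gl FF2 :
  size FF1 = size TT1 -> size TG = (size gm).+1 ->
  cross (TT1 ++ TG ++ TT2) (FF1 ++ graft l r (g1 :: rcons gm gl) ++ FF2) =
  cross TT1 FF1 + cross TG ([::] :: gm) + cross TT2 ([::] :: FF2)
  + sdeg TT1 * (sdeg g1 + sdeg r + sdegs gm + sdeg l + sdeg gl + sdegs FF2)
  + sdeg TG * (sdeg l + sdeg gl + sdegs FF2).
Proof.
move=> e1 e2; rewrite graft2 cross_cat // cat_cons cat_rcons.
rewrite -[_ :: gm ++ _]/(((g1 ++ r) :: gm) ++ (l ++ gl) :: FF2) cross_block ?e2 //.
rewrite cross_head !(sdegs_cat, sdegs_cons, sdeg_cat); ring.
Qed.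

Lemma cross_inner TG g1 gm gl : size TG = (size gm).+1 ->
  cross TG (g1 :: rcons gm gl) = cross TG ([::] :: gm) + sdeg TG * sdeg gl.
Proof.
move=> e; rewrite -rcons_cons cross_rcons ?e // cross_head; ring.
Qed.

Lemma jA_signE SS TT e : jA_sign SS TT e =
  cross TT SS + e * sdeg TT + d * (size TT)%:Z + pairs_sdeg SS + d * sdeg TT.
Proof. by rewrite /jA_sign sumz_shifted_degrees. Qed.

Lemma jD_signE SS TT M sn e c : jD_sign SS TT M sn e c =
  (d - 1) * c + cross TT SS + e * sdeg TT + d * (size TT)%:Z + pairs_sdeg SS
  + d * (e + sdegs SS) + (sdeg sn + c + 1) * sdegs M + sdeg sn * (c + 1).
Proof. by rewrite /jD_sign sumz_shifted_degrees. Qed.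

Lemma flatten_toA SS : sdeg (flatten (map (map (@toA k O A d)) SS)) = sdegs SS.
Proof. exact: sumz_sdeg_toA. Qed.

End Cross.

Ltac expand_degrees_with eqs :=
  rewrite ?(sdegs_cat, sdegs_cons, sdegs_rcons, sdegs_nil, pairs_sdeg_cat, pairs_sdeg_cons,
    pairs_sdeg_rcons, pairs_sdeg_nil, sdeg_cat, size_cat, PoszD,
    sdeg_nil, flatten_toA, sdeg_toA, flatten_cat, cats0, eqs).

Ltac reassociate := rewrite -?catA ?cat_cons -?catA ?cat_cons -?catA.

Section InnerInsertion.
Variables (k : fieldType) (O : choiceType) (A : quiver k O) (d eF eG : int).
Local Notation Q := (ext A d).
Local Notation toA := (@toA k O A d).
Local Notation toAs := (map (map toA)).
Variables (F G : multi_family A).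
Hypotheses (F_multi : multi d eF F) (G_multi : multi d eG G).
Variables (X1 X2 : seq (seq O)) (a b : seq O) (o1 o2 : O) (yy : seq (seq O)).
Hypothesis yy_type : is_type yy.
Local Notation xv := (a ++ o1 :: o2 :: b).
Local Notation xx := (X1 ++ xv :: X2).
Local Notation v := (size X1).+1.
Local Notation j := (size a).+2.
Local Notation n := (size xx).
Local Notation m := (size yy).
Variables (FF1 FF2 GQ : seq (seq (arrow Q))) (L R TF1 TF2 TG : seq (arrow Q)).
Hypothesis GQ_fits : fits yy GQ TG.
Hypothesis sF1 : map size X1 = [seq (size s).+1 | s <- FF1].
Hypothesis sF2 : map size X2 = [seq (size s).+1 | s <- FF2].
Hypothesis sTF1 : size FF1 = size TF1.
Hypothesis sTF2 : size FF2 = size TF2.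
Hypothesis sL : size L = size a.
Hypothesis sR : size R = size b.

Local Notation wl := (assemble (L :: FF2) TF2).
Local Notation wr := (assemble (rcons FF1 R) TF1).
Variables (am : arrow Q) (mid' : seq (arrow Q)).
Local Notation mid := (am :: mid').
Hypothesis midE : mid = assemble GQ TG.

(** The letter that Gerstenhaber insertion puts in place of [mid]. *)
Definition inserted_letter : arrow Q :=
  @Arrow _ _ Q (tgt am) (src (last am mid')) (eG - (d + 1) + sdeg mid + 1)
    (jA yy mid eG (G yy) (tgt am) (src (last am mid')) (eG - (d + 1) + sdeg mid + 1), 0).

Local Notation zz := (inn_type xx yy v j).
Local Notation SF := (FF1 ++ (L ++ inserted_letter :: R) :: FF2).
Local Notation SZ := (FF1 ++ graft L R GQ ++ FF2).
Local Notation TZ := (TF1 ++ TG ++ TF2).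
Local Notation w := (wl ++ mid ++ wr).
Local Notation wF := (wl ++ inserted_letter :: wr).
Local Notation bz := (block_word zz w).
Local Notation bx := (block_word xx wF).

Lemma size_left_blocks : size X1 = size FF1.
Proof. by rewrite -(size_map size) sF1 size_map. Qed.
Lemma yy_neq0 : yy <> [::].
Proof. by case/and3P: yy_type => /eqP. Qed.
Lemma size_GQ : size GQ = m.
Proof. exact: fits_size GQ_fits. Qed.
Lemma GQ_neq0 : GQ <> [::].
Proof. by move=> e; have := GQ_fits.2; rewrite e. Qed.
Lemma size_TG : (size TG).+1 = m.
Proof. by rewrite -size_GQ GQ_fits.2. Qed.

Lemma inn_type_graft : zz = X1 ++ graft a b yy ++ X2.
Proof.
rewrite /inn_type; have -> : blk xx v = xv by rewrite /blk nth_cat ltnn subnn.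
have -> : take v.-1 xx = X1 by rewrite take_size_cat.
have -> : drop v xx = X2 by rewrite -cat_rcons drop_size_cat ?size_rcons.
have -> : take (j - 2) xv = a by rewrite !subSS subn0 take_size_cat.
have -> : drop j xv = b.
  by rewrite -[j]addn2 addnC -drop_drop drop_size_cat //= drop0.
case: (one_or_more yy_neq0) => [[y ->]|[y1 [ym [yl ->]]]]; first by [].
rewrite graft2 /= size_rcons !subSS subn0 -[ym in size ym]/ym -cats1 take_size_cat //.
by rewrite /blk /= nth_cat ltnn subnn cats1 -cats1.
Qed.

Lemma inn_type_fits : fits zz SZ TZ.
Proof.
rewrite inn_type_graft; split; last first.
  rewrite !size_cat size_graft ?GQ_fits.2; last exact: GQ_neq0.
  by rewrite sTF1 sTF2; lia.
rewrite !map_cat sF1 sF2; congr (_ ++ (_ ++ _)).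
have eG' := GQ_fits.1; case: (one_or_more GQ_neq0) eG' => [[g ->]|[g1 [gm [gl ->]]]].
  by case: (yy) => [|y [|]] //= [e]; rewrite !size_cat e sL sR; congr [:: _]; lia.
case: (one_or_more yy_neq0) => [[y ->]|[y1 [ym [yl ->]]]].
  by case: (gm).
rewrite !graft2 /= !map_rcons => -[e1 /rcons_inj [e2 e3]].
by rewrite !size_cat e1 e2 e3 sL sR addnS.
Qed.

Lemma inserted_fits : fits xx SF (TF1 ++ TF2).
Proof.
split; last by rewrite !size_cat /= sTF1 sTF2 addnS.
by rewrite !map_cat /= sF1 sF2 !size_cat /= sL sR !addnS.
Qed.

Lemma inn_word_assemble : w = assemble SZ TZ.
Proof. by rewrite assemble_graft // ?midE // GQ_fits.2. Qed.

Lemma inserted_word_assemble : wF = assemble SF (TF1 ++ TF2).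
Proof. by rewrite (assemble_block L [:: inserted_letter] R FF2 TF2 sTF1). Qed.

Lemma flatten_rev_xx : flatten (rev xx) = (flatten (rev X2) ++ a) ++ (o1 :: [:: o2]) ++ (b ++ flatten (rev X1)).
Proof. by rewrite rev_cat rev_cons flatten_cat flatten_rcons -!catA. Qed.

Lemma flatten_rev_zz : flatten (rev zz) = (flatten (rev X2) ++ a) ++ flatten (rev yy) ++ (b ++ flatten (rev X1)).
Proof.
rewrite inn_type_graft !rev_cat !flatten_cat flatten_rev_graft; last exact: yy_neq0.
by rewrite -!catA.
Qed.

Lemma size_wl : size wl = size (flatten (rev X2) ++ a).
Proof. exact: size_left. Qed.

Lemma size_wr : size wr = size (b ++ flatten (rev X1)).
Proof. exact: size_right. Qed.

Lemma size_mid : size mid = (size (flatten (rev yy))).-1.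
Proof. rewrite midE; exact: size_fits_word. Qed.

Lemma ends : exists y Y, flatten (rev yy) = y :: Y.
Proof.
case/and3P: yy_type => yy0 ally _.
by have [y [Y [e _ _]]] := flatten_rev_ends yy0 ally; exists y, Y.
Qed.

Lemma inn_word_mid : bz -> block_word yy mid.
Proof.
have [y [Y e]] := ends; have sm := size_mid; rewrite e /= in sm.
rewrite /block_word flatten_rev_zz e (objects_insert _ size_wl size_wr) //.
by case/and3P.
Qed.

Lemma inserted_word_match : block_word yy mid -> bx = bz && ((o1, o2) == (tgt am, src (last am mid'))).
Proof.
have [y [Y e]] := ends; have sm := size_mid; rewrite e /= in sm.
move=> byy; have [e1 e2] : tgt am = y /\ src (last am mid') = last y Y.
  by apply: endpoints_ends; rewrite -e; apply/eqP.
rewrite /block_word flatten_rev_zz flatten_rev_xx e (objects_insert _ size_wl size_wr) //.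
rewrite (@objects_insert _ _ _ _ o1 [:: o2] _ wl [:: inserted_letter] wr size_wl size_wr) //.
have em : (map (@endpoints _ _ Q) mid == pairs (y :: Y)) = true by rewrite -e; exact: byy.
have ei : (map (@endpoints _ _ Q) [:: inserted_letter] == pairs [:: o1; o2]) = ((o1, o2) == (y, last y Y)).
  have [t1 t2] : tgt inserted_letter = y /\ src inserted_letter = last y Y by [].
  by rewrite /pairs /= eqseq_cons andbT /endpoints t1 t2 eq_sym.
rewrite em ei e1 e2 [last o1 _]/=.
have [[-> ->]|_] := eqVneq (o1, o2) (y, last y Y); first by rewrite andbT.
by rewrite !andbF.
Qed.

Lemma sdeg_wl : sdeg wl = sdeg L + sdegs FF2 + sdeg TF2.
Proof. by rewrite sdeg_assemble /= ?sTF2 // -/(sdegs (L :: FF2)) sdegs_cons. Qed.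

Lemma sdeg_mid : sdeg mid = sdegs GQ + sdeg TG.
Proof. by rewrite midE sdeg_assemble // GQ_fits.2. Qed.

Lemma sdeg_inserted_letter (r : seq (arrow Q)) :
  sdeg (inserted_letter :: r) = eG - (d + 1) + (sdegs GQ + sdeg TG) + sdeg r.
Proof. by rewrite sdeg_cons -sdeg_mid /deg /=; ring. Qed.

Ltac expand_degrees := expand_degrees_with sdeg_inserted_letter.

(** The vector fed to F is the same on both sides, so only signs are compared.  The
    single block and the several blocks of G lead to different orders of the
    input groups. *)
Lemma inner_comp_A y x i :
  jA zz w (eF + eG - (d + 1)) (inn_comp d eF F G xx yy v j) y x i =
  (-1) ^ ((eG - (d + 1)) * sdeg wl) *: jA xx wF eF (F xx) y x i.
Proof.
rewrite {1}inn_word_assemble (jA_assemble inn_type_fits) -inn_word_assemble {1}inserted_word_assemble (jA_assemble inserted_fits) -inserted_word_assemble.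
have -> : flatten (toAs SF) = (flatten (toAs FF1) ++ map toA L) ++
    inserted eG G yy am mid' :: map toA R ++ flatten (toAs FF2).
  by rewrite map_cat flatten_cat /= map_cat /= -!catA.
have xx0 : (0 < v <= n)%N by rewrite size_cat /=; lia.
have m0 : (0 < m)%N by rewrite -size_TG.
have rotE : rot (inn_rot xx yy v) (sectors xx yy m v) = sectors xx yy m v.
  by rewrite rot_oversize // inn_rot_size // size_sectors.
have out_arr : rot (inn_rot xx yy v) (frees xx yy m v) =
    flatten (map (out_group n m m v) [:: 0; 4; 2; 1]%N).
  by rewrite rot_oversize ?inn_rot_size // frees_inner.
have sA1 : shape (toAs FF1) = map predn (map size X1).
  by rewrite shape_toA sF1 -map_comp; apply: eq_map.
have sA2 : shape (toAs FF2) = map predn (map size X2).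
  by rewrite shape_toA sF2 -map_comp; apply: eq_map.
have sLA : size (map toA L) = size a by rewrite size_map.
have sRA : size (map toA R) = size b by rewrite size_map.
have sT1 : size TF1 = size X1 by rewrite size_left_blocks.
rewrite /inn_comp.
case: (one_or_more GQ_neq0) => [[g eG1]|[g1 [gm [gl eG2]]]].
- have TG0 : TG = [::] by have := GQ_fits.2; rewrite eG1 => -[/esym/size0nil].
  have m1 : m = 1%N by rewrite -size_TG TG0.
  have -> : flatten (toAs SZ) = flatten (map (group_piece (toAs FF1) (toAs FF2)
      [:: map toA g] [::] [::] [::] (map toA L) (map toA R)) [:: 0; 1; 4; 5; 6; 7; 2; 3]%N).
    by rewrite eG1 /= !map_cat !flatten_cat /= !map_cat /= !cats0 -!catA.
  apply: (@inner_transfer _ _ _ d eF eG F G F_multi G_multi X1 X2 a b o1 o2 yy _ _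
    [:: map toA g] [::] [::] [::] _ _ GQ TF1 TF2 TG yy_type sA1 sA2 GQ_fits _ sLA sRA sT1
    _ _ (read_component_multilinear y x i) false _ _ _ _ out_arr _ _ _ midE _ _ inn_word_mid inserted_word_match) => //.
  + by rewrite eG1.
  + by rewrite rotE {1}m1 sectors_one // m1.
  + by move=> z; rewrite !inE; case: z => [|[|[|[|[|[|[|[|z]]]]]]]].
  + rewrite !jA_signE /inner_sign /inner_degree eG1 TG0 [graft _ _ _]/= [[::] ++ TF2]/=.
    rewrite (cross_block TF2 (L ++ g ++ R) FF2 sTF1) (cross_block TF2 (L ++ inserted_letter :: R) FF2 sTF1).
    rewrite koszul_single /group_piece sdeg_wl /= !cats0.
    rewrite (_ : cross [::] [:: g] = 0) //.
    by expand_degrees; rewrite eG1 TG0; expand_degrees; parity_ring.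
have sTGm : size TG = (size gm).+1 by have := GQ_fits.2; rewrite eG2 /= size_rcons => -[].
have m2 : m = (size gm).+2 by rewrite -size_TG sTGm.
have -> : flatten (toAs SZ) = flatten (map (group_piece (toAs FF1) (toAs FF2)
    [:: map toA g1] (toAs gm) [:: map toA gl] [::] (map toA L) (map toA R)) [:: 0; 4; 2; 5; 1; 6; 7; 3]%N).
  rewrite eG2 graft2 !map_cat !flatten_cat /= map_cat map_rcons flatten_rcons /= !map_cat /= !cats0.
  by rewrite -!catA.
apply: (@inner_transfer _ _ _ d eF eG F G F_multi G_multi X1 X2 a b o1 o2 yy _ _
  [:: map toA g1] (toAs gm) [:: map toA gl] [::] _ _ GQ TF1 TF2 TG yy_type sA1 sA2 GQ_fits _ sLA sRA sT1
  _ _ (read_component_multilinear y x i) false _ _ _ _ out_arr _ _ _ midE _ _ inn_word_mid inserted_word_match) => //.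
+ by rewrite eG2 /= map_rcons cats1.
+ rewrite rotE sectors_inner ?m2 // -m2; congr (flatten (map (in_group _ _ _ _ _ _) _)); rewrite /= ?size_map m2 /=; lia.
+ by move=> z; rewrite !inE; case: z => [|[|[|[|[|[|[|[|z]]]]]]]].
+ rewrite !jA_signE /inner_sign /inner_degree eG2 (cross_graft _ _ _ _ _ _ sTF1 sTGm) (cross_inner _ _ sTGm).
  rewrite (cross_block TF2 (L ++ inserted_letter :: R) FF2 sTF1) graft2 koszul_inner /group_piece sdeg_wl /= ?cats0.
  by expand_degrees; rewrite eG2; expand_degrees; parity_ring.
Qed.

End InnerInsertion.

(** * Inner compositions: the part valued in forms, pointwise *)
Section InnerDual.
Variables (k : fieldType) (O : choiceType) (A : quiver k O) (d eF eG : int).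
Local Notation Q := (ext A d).
Local Notation toA := (@toA k O A d).
Local Notation toAs := (map (map toA)).
Variables (F G : multi_family A).
Hypotheses (F_multi : multi d eF F) (G_multi : multi d eG G).
Variables (a b : seq O) (o1 o2 : O) (yy : seq (seq O)).
Hypothesis yy_type : is_type yy.
Local Notation xv := (a ++ o1 :: o2 :: b).
Local Notation j := (size a).+2.
Local Notation m := (size yy).
Variables (GQ : seq (seq (arrow Q))) (L R TG : seq (arrow Q)).
Hypothesis GQ_fits : fits yy GQ TG.
Hypothesis sL : size L = size a.
Hypothesis sR : size R = size b.
Variables (am : arrow Q) (mid' : seq (arrow Q)).
Local Notation mid := (am :: mid').
Hypothesis midE : mid = assemble GQ TG.
Variables (Bz Bx : bool).
Hypothesis Bz_mid : Bz -> block_word yy mid.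
Hypothesis Bx_mid : block_word yy mid ->
  Bx = Bz && ((o1, o2) == (tgt am, src (last am mid'))).
Variables (c : int) (x y : O) (bb : A x y (- c)).
Local Notation ins := (inserted_letter eG G yy am mid').
Local Notation e := (eF + eG - (d + 1)).

Let sTG : (size TG).+1 = m.
Proof. by rewrite -(fits_size GQ_fits) GQ_fits.2. Qed.
Let GQ0 : GQ <> [::].
Proof. by move=> E; have := GQ_fits.2; rewrite E. Qed.

Lemma shape_preds (X : seq (seq O)) (FF : seq (seq (arrow Q))) :
  map size X = [seq (size s).+1 | s <- FF] -> shape (toAs FF) = map predn (map size X).
Proof. by move=> E; rewrite shape_toA E -map_comp; apply: eq_map. Qed.

Lemma size_blocks (X : seq (seq O)) (FF : seq (seq (arrow Q))) :
  map size X = [seq (size s).+1 | s <- FF] -> size X = size FF.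
Proof. by move=> E; rewrite -(size_map size) E size_map. Qed.

Lemma sdeg_form_arrow r : sdeg (Arrow bb :: r) = - c - 1 + sdeg r.
Proof. exact: sdeg_cons. Qed.

Lemma sdeg_ins r : sdeg (ins :: r) = eG - (d + 1) + (sdegs GQ + sdeg TG) + sdeg r.
Proof. by rewrite (sdeg_inserted_letter eG G GQ_fits midE). Qed.

Ltac expand_degrees := expand_degrees_with (sdeg_ins, sdeg_form_arrow).

Section First.
Variables (X2 : seq (seq O)) (xn : seq O) (FF2 : seq (seq (arrow Q))) (sn TF2 : seq (arrow Q)).
Hypothesis sF2 : map size X2 = [seq (size s).+1 | s <- FF2].
Hypothesis sxn : size xn = (size sn).+1.
Hypothesis sTF2 : (size FF2).+1 = size TF2.
Local Notation pxx := (([::] : seq (seq O)) ++ (a ++ o1 :: o2 :: (b ++ xn)) :: X2).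
Local Notation SF := ((L ++ ins :: R) :: rcons FF2 sn).
Local Notation SZ := (graft L R GQ ++ rcons FF2 sn).

(** The connected block is the first one, so that [b] and the last block lie to
    its right. *)
Lemma inner_dual_first z1 MZ zn : SZ = z1 :: rcons MZ zn ->
  (if Bz then (-1) ^ jD_sign SZ (TG ++ TF2) MZ zn e c *:
     tlift (read (TG ++ TF2) read_nil)
       (diagram d pxx yy m 1 j true eF (F pxx) (G yy) 0
         (map toA z1 ++ Arrow bb :: map toA zn ++ flatten (toAs MZ))) else 0) =
  (-1) ^ ((eG - (d + 1)) * (sdeg L + sdegs FF2 + sdeg sn + sdeg TF2)) *:
  (if Bx then (-1) ^ jD_sign SF TF2 FF2 sn eF c *:
     tlift (read TF2 read_nil)
       (F pxx (map toA (L ++ ins :: R) ++ Arrow bb :: map toA sn ++ flatten (toAs FF2))) else 0).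
Proof.
move=> eZ.
have -> : map toA (L ++ ins :: R) ++ Arrow bb :: map toA sn ++ flatten (toAs FF2) =
    (flatten [::] ++ map toA L) ++ inserted eG G yy am mid' ::
      (map toA R ++ Arrow bb :: map toA sn) ++ flatten (toAs FF2).
  by rewrite map_cat /= -!catA.
have sA2 := shape_preds sF2.
have sLA : size (map toA L) = size a by rewrite size_map.
have sRA : size (map toA R ++ Arrow bb :: map toA sn) = size (b ++ xn).
  by rewrite !size_cat /= !size_map sxn sR.
have out_arr : rot 0 (frees pxx yy m 1) =
    flatten (map (out_group (size pxx) m m 1) [:: 0; 4; 2; 1]%N) by rewrite rot0 frees_inner.
case: (one_or_more GQ0) => [[g eG1]|[g1 [gm [gl eG2]]]].
- have TG0 : TG = [::] by have := GQ_fits.2; rewrite eG1 => -[/esym/size0nil].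
  have m1 : m = 1%N by rewrite -sTG TG0.
  move: (eZ); rewrite eG1 /= => -[<- /rcons_inj [<- <-]].
  have -> : map toA (L ++ g ++ R) ++ Arrow bb :: map toA sn ++ flatten (toAs FF2) =
      flatten (map (group_piece [::] (toAs FF2) [:: map toA g] [::] [::] [::] (map toA L)
        (map toA R ++ Arrow bb :: map toA sn)) [:: 0; 1; 4; 5; 6; 7; 2; 3]%N).
    by rewrite /= !map_cat !cats0 -!catA.
  apply: (@inner_transfer _ _ _ d eF eG F G F_multi G_multi [::] X2 a (b ++ xn) o1 o2 yy [::] _
    [:: map toA g] [::] [::] [::] _ _ GQ [::] TF2 TG yy_type erefl sA2 GQ_fits _ sLA sRA erefl
    _ _ (@read_nil_multilinear _ _ _) false _ _ _ _ out_arr _ _ _ midE _ _ Bz_mid Bx_mid) => //.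
  + by rewrite eG1.
  + by rewrite rot0 {1}m1 sectors_one // m1.
  + exact/perm_mem.
  + rewrite !jD_signE jA_signE /inner_sign /inner_degree koszul_single /group_piece /= ?cats0.
    rewrite TG0 eG1 /= !(cross_head _ (_ ++ _)) (_ : cross [::] [:: g] = 0) //.
    by expand_degrees; rewrite eG1 TG0; expand_degrees; parity_ring.
have sTGm : size TG = (size gm).+1 by have := GQ_fits.2; rewrite eG2 /= size_rcons => -[].
have m2 : m = (size gm).+2 by rewrite -sTG sTGm.
have [-> [-> ->]] : z1 = g1 ++ R /\ MZ = gm ++ (L ++ gl) :: FF2 /\ zn = sn.
  by move: (eZ); rewrite eG2 graft2 cat_cons cat_rcons -rcons_cons -rcons_cat => -[-> /rcons_inj [-> ->]].
have -> : map toA (g1 ++ R) ++ Arrow bb :: map toA sn ++ flatten (toAs (gm ++ (L ++ gl) :: FF2)) =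
    flatten (map (group_piece [::] (toAs FF2) [:: map toA g1] (toAs gm) [:: map toA gl] [::] (map toA L)
      (map toA R ++ Arrow bb :: map toA sn)) [:: 0; 4; 2; 5; 1; 6; 7; 3]%N).
  rewrite /= !map_cat !flatten_cat /= !map_cat !cats0. by rewrite -!catA !cat_cons.
apply: (@inner_transfer _ _ _ d eF eG F G F_multi G_multi [::] X2 a (b ++ xn) o1 o2 yy [::] _
  [:: map toA g1] (toAs gm) [:: map toA gl] [::] _ _ GQ [::] TF2 TG yy_type erefl sA2 GQ_fits _ sLA sRA erefl
  _ _ (@read_nil_multilinear _ _ _) false _ _ _ _ out_arr _ _ _ midE _ _ Bz_mid Bx_mid) => //.
+ by rewrite eG2 /= map_rcons cats1.
+ rewrite rot0 sectors_inner ?m2 // -m2; congr (flatten (map (in_group _ _ _ _ _ _) _)); rewrite /= ?size_map m2 /=; lia.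
+ exact/perm_mem.
+ rewrite !jD_signE jA_signE /inner_sign /inner_degree koszul_inner /group_piece.
  rewrite eG2 (@cross_graft _ _ _ d [::] TF2 TG [::] L R g1 gm gl (rcons FF2 sn) erefl sTGm).
  rewrite (cross_inner _ _ sTGm) (cross_head _ (L ++ _)) graft2 /= ?cats0.
  by expand_degrees; rewrite eG2; expand_degrees; parity_ring.
Qed.

End First.

Section Middle.
Variables (X1 X2 : seq (seq O)) (x1 xn : seq O).
Variables (FF1 FF2 : seq (seq (arrow Q))) (f1 sn TF1 TF2 : seq (arrow Q)).
Hypothesis sF1 : map size X1 = [seq (size s).+1 | s <- FF1].
Hypothesis sF2 : map size X2 = [seq (size s).+1 | s <- FF2].
Hypothesis sx1 : size x1 = (size f1).+1.
Hypothesis sxn : size xn = (size sn).+1.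
Hypothesis sTF1 : (size FF1).+1 = size TF1.
Hypothesis sTF2 : (size FF2).+1 = size TF2.
Local Notation pxx := (((x1 ++ xn) :: X1) ++ xv :: X2).
Local Notation SF := ((f1 :: FF1) ++ (L ++ ins :: R) :: rcons FF2 sn).
Local Notation SZ := ((f1 :: FF1) ++ graft L R GQ ++ rcons FF2 sn).
Local Notation MZ := (FF1 ++ graft L R GQ ++ FF2).
Local Notation MF := (FF1 ++ (L ++ ins :: R) :: FF2).
Local Notation f1b := (map toA f1 ++ Arrow bb :: map toA sn).

(** The connected block is neither the first nor the last one: [b] lies in the
    first block and is moved along with it. *)
Lemma inner_dual_middle :
  (if Bz then (-1) ^ jD_sign SZ (TF1 ++ TG ++ TF2) MZ sn e c *:
     tlift (read (TF1 ++ TG ++ TF2) read_nil)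
       (diagram d pxx yy m (size X1).+2 j true eF (F pxx) (G yy) 0
         (map toA f1 ++ Arrow bb :: map toA sn ++ flatten (toAs MZ))) else 0) =
  (-1) ^ ((eG - (d + 1)) * (sdeg L + sdegs FF2 + sdeg sn + sdeg TF2)) *:
  (if Bx then (-1) ^ jD_sign SF (TF1 ++ TF2) MF sn eF c *:
     tlift (read (TF1 ++ TF2) read_nil)
       (F pxx (map toA f1 ++ Arrow bb :: map toA sn ++ flatten (toAs MF))) else 0).
Proof.
have -> : map toA f1 ++ Arrow bb :: map toA sn ++ flatten (toAs MF) =
    (flatten (f1b :: toAs FF1) ++ map toA L) ++ inserted eG G yy am mid' ::
      map toA R ++ flatten (toAs FF2).
  by rewrite map_cat flatten_cat /= map_cat; reassociate.
have sA1 : shape (f1b :: toAs FF1) = map predn (map size ((x1 ++ xn) :: X1)).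
  by rewrite /= -(shape_preds sF1) !size_cat /= !size_map sx1 sxn addSn.
have sA2 := shape_preds sF2.
have sLA : size (map toA L) = size a by rewrite size_map.
have sRA : size (map toA R) = size b by rewrite size_map.
have sT1 : size TF1 = size ((x1 ++ xn) :: X1) by rewrite -sTF1 /= (size_blocks sF1).
have sT1' : size (f1 :: FF1) = size TF1 by rewrite -sTF1.
have out_arr : rot 0 (frees pxx yy m (size ((x1 ++ xn) :: X1)).+1) =
    flatten (map (out_group (size pxx) m m (size ((x1 ++ xn) :: X1)).+1) [:: 0; 4; 2; 1]%N).
  by rewrite rot0 frees_inner.
case: (one_or_more GQ0) => [[g eG1]|[g1 [gm [gl eG2]]]].
- have TG0 : TG = [::] by have := GQ_fits.2; rewrite eG1 => -[/esym/size0nil].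
  have m1 : m = 1%N by rewrite -sTG TG0.
  have -> : map toA f1 ++ Arrow bb :: map toA sn ++ flatten (toAs MZ) =
      flatten (map (group_piece (f1b :: toAs FF1) (toAs FF2) [:: map toA g] [::] [::] [::] (map toA L)
        (map toA R)) [:: 0; 1; 4; 5; 6; 7; 2; 3]%N).
    by rewrite eG1 /= !map_cat !flatten_cat /= !map_cat !cats0; reassociate.
  apply: (@inner_transfer _ _ _ d eF eG F G F_multi G_multi ((x1 ++ xn) :: X1) X2 a b o1 o2 yy _ _
    [:: map toA g] [::] [::] [::] _ _ GQ TF1 TF2 TG yy_type sA1 sA2 GQ_fits _ sLA sRA sT1
    _ _ (@read_nil_multilinear _ _ _) false _ _ _ _ out_arr _ _ _ midE _ _ Bz_mid Bx_mid) => //.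
  + by rewrite eG1.
  + by rewrite rot0 {1}m1 sectors_one // m1.
  + exact/perm_mem.
  + rewrite !jD_signE jA_signE /inner_sign /inner_degree koszul_single /group_piece.
    rewrite TG0 eG1 [graft _ _ _]/= [[::] ++ TF2]/= cat1s !(cross_block TF2 _ (rcons FF2 sn) sT1') (_ : cross [::] [:: g] = 0) //.
    by expand_degrees; rewrite /= eG1 TG0; expand_degrees; parity_ring.
have sTGm : size TG = (size gm).+1 by have := GQ_fits.2; rewrite eG2 /= size_rcons => -[].
have m2 : m = (size gm).+2 by rewrite -sTG sTGm.
have -> : map toA f1 ++ Arrow bb :: map toA sn ++ flatten (toAs MZ) =
    flatten (map (group_piece (f1b :: toAs FF1) (toAs FF2) [:: map toA g1] (toAs gm) [:: map toA gl] [::] (map toA L)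
      (map toA R)) [:: 0; 4; 2; 5; 1; 6; 7; 3]%N).
  rewrite eG2 graft2 cat_cons cat_rcons /= !map_cat !flatten_cat /= !map_cat !flatten_cat /= !map_cat !cats0.
  by reassociate.
apply: (@inner_transfer _ _ _ d eF eG F G F_multi G_multi ((x1 ++ xn) :: X1) X2 a b o1 o2 yy _ _
  [:: map toA g1] (toAs gm) [:: map toA gl] [::] _ _ GQ TF1 TF2 TG yy_type sA1 sA2 GQ_fits _ sLA sRA sT1
  _ _ (@read_nil_multilinear _ _ _) false _ _ _ _ out_arr _ _ _ midE _ _ Bz_mid Bx_mid) => //.
+ by rewrite eG2 /= map_rcons cats1.
+ rewrite rot0 sectors_inner ?m2 // -m2; congr (flatten (map (in_group _ _ _ _ _ _) _)); rewrite /= ?size_map m2 /=; lia.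
+ exact/perm_mem.
+ rewrite !jD_signE jA_signE /inner_sign /inner_degree koszul_inner /group_piece.
  rewrite eG2 (cross_graft _ _ _ _ _ _ sT1' sTGm) (cross_inner _ _ sTGm) (cross_block TF2 _ (rcons FF2 sn) sT1') graft2.
  by expand_degrees; rewrite /= eG2; expand_degrees; parity_ring.
Qed.

End Middle.

Section Last.
Variables (X1 : seq (seq O)) (x1 : seq O).
Variables (FF1 : seq (seq (arrow Q))) (f1 TF1 : seq (arrow Q)).
Hypothesis sF1 : map size X1 = [seq (size s).+1 | s <- FF1].
Hypothesis sx1 : size x1 = (size f1).+1.
Hypothesis sTF1 : (size FF1).+1 = size TF1.
Local Notation pxx := (([::] : seq (seq O)) ++ ((x1 ++ a) ++ o1 :: o2 :: b) :: X1).
Local Notation SF := ((f1 :: FF1) ++ [:: L ++ ins :: R]).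
Local Notation SZ := ((f1 :: FF1) ++ graft L R GQ).

(** The connected block is the last one.  In the type with [b] it belongs to the
    first block, whence the rotated labelling. *)
Lemma inner_dual_last MZ zn : SZ = f1 :: rcons MZ zn ->
  (if Bz then (-1) ^ jD_sign SZ (TF1 ++ TG) MZ zn e c *:
     tlift (read (TF1 ++ TG) read_nil)
       (diagram d pxx yy m 1 (size (x1 ++ a)).+2 true eF (F pxx) (G yy) m.-1
         (map toA f1 ++ Arrow bb :: map toA zn ++ flatten (toAs MZ))) else 0) =
  (-1) ^ ((eG - (d + 1)) * sdeg L) *:
  (if Bx then (-1) ^ jD_sign SF TF1 FF1 (L ++ ins :: R) eF c *:
     tlift (read TF1 read_nil)
       (F pxx (map toA f1 ++ Arrow bb :: map toA (L ++ ins :: R) ++ flatten (toAs FF1))) else 0).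
Proof.
move=> eZ; set Lb := map toA f1 ++ Arrow bb :: map toA L.
have -> : map toA f1 ++ Arrow bb :: map toA (L ++ ins :: R) ++ flatten (toAs FF1) =
    (flatten [::] ++ Lb) ++ inserted eG G yy am mid' :: map toA R ++ flatten (toAs FF1).
  by rewrite map_cat /=; reassociate.
have sA1 := shape_preds sF1.
have sLA : size Lb = size (x1 ++ a) by rewrite !size_cat /= !size_map sx1 sL addSnnS.
have sRA : size (map toA R) = size b by rewrite size_map.
have sT1 : true -> size TF1 = (size X1).+1 by rewrite -sTF1 (size_blocks sF1).
have sT1' : size TF1 = size (f1 :: FF1) by rewrite -sTF1.
have out_arr : rot m.-1 (frees pxx yy m 1) =
    flatten (map (out_group (size pxx) m m 1) [:: 0; 4; 1; 2]%N) by exact: frees_rotated.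
case: (one_or_more GQ0) => [[g eG1]|[g1 [gm [gl eG2]]]].
- have TG0 : TG = [::] by have := GQ_fits.2; rewrite eG1 => -[/esym/size0nil].
  have m1 : m = 1%N by rewrite -sTG TG0.
  have [-> ->] : MZ = FF1 /\ zn = L ++ g ++ R.
    by move: (eZ); rewrite eG1 /= cats1 => -[/rcons_inj [-> ->]].
  have -> : map toA f1 ++ Arrow bb :: map toA (L ++ g ++ R) ++ flatten (toAs FF1) =
      flatten (map (group_piece [::] (toAs FF1) [:: map toA g] [::] [::] [::] Lb
        (map toA R)) [:: 0; 1; 4; 5; 6; 7; 2; 3]%N).
    by rewrite /= /Lb !map_cat !cats0; reassociate.
  apply: (@inner_transfer _ _ _ d eF eG F G F_multi G_multi [::] X1 (x1 ++ a) b o1 o2 yy [::] _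
    [:: map toA g] [::] [::] [::] _ _ GQ [::] TF1 TG yy_type erefl sA1 GQ_fits _ sLA sRA erefl
    _ _ (@read_nil_multilinear _ _ _) true sT1 _ _ _ out_arr _ _ _ midE _ _ Bz_mid Bx_mid) => //.
  + by rewrite eG1.
  + have -> : m.-1 = 0%N by rewrite m1.
    by rewrite rot0 {1}m1 sectors_one // m1.
  + exact/perm_mem.
  + rewrite !jD_signE jA_signE /inner_sign /inner_degree koszul_single /group_piece /Lb.
    rewrite TG0 eG1 cats0 [graft _ _ _]/= !cats1 !cross_rcons // (_ : cross [::] [:: g] = 0) //.
    by expand_degrees; rewrite /= eG1 TG0; expand_degrees; parity_ring.
have sTGm : size TG = (size gm).+1 by have := GQ_fits.2; rewrite eG2 /= size_rcons => -[].
have m2 : m = (size gm).+2 by rewrite -sTG sTGm.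
have [-> ->] : MZ = FF1 ++ (g1 ++ R) :: gm /\ zn = L ++ gl.
  by move: (eZ); rewrite eG2 graft2 -rcons_cons -rcons_cat /= => -[/rcons_inj [-> ->]].
have -> : map toA f1 ++ Arrow bb :: map toA (L ++ gl) ++ flatten (toAs (FF1 ++ (g1 ++ R) :: gm)) =
    flatten (map (group_piece [::] (toAs FF1) [:: map toA g1] (toAs gm) [:: map toA gl] [::] Lb
      (map toA R)) [:: 0; 1; 6; 7; 3; 4; 2; 5]%N).
  by rewrite /= /Lb !map_cat !flatten_cat /= !map_cat !cats0; reassociate.
apply: (@inner_transfer _ _ _ d eF eG F G F_multi G_multi [::] X1 (x1 ++ a) b o1 o2 yy [::] _
  [:: map toA g1] (toAs gm) [:: map toA gl] [::] _ _ GQ [::] TF1 TG yy_type erefl sA1 GQ_fits _ sLA sRA erefl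
  _ _ (@read_nil_multilinear _ _ _) true sT1 _ _ _ out_arr _ _ _ midE _ _ Bz_mid Bx_mid) => //.
+ by rewrite eG2 /= map_rcons cats1.
+ rewrite sectors_rotated ?m2 // -m2; congr (flatten (map (in_group _ _ _ _ _ _) _)); rewrite /= ?size_map m2 /=; lia.
+ exact/perm_mem.
+ rewrite !jD_signE jA_signE /inner_sign /inner_degree koszul_rotated /group_piece /Lb.
  rewrite eG2 graft2 (cats1 _ (L ++ ins :: R)) cross_rcons // (cross_cat _ _ sT1') !(cross_inner _ _ sTGm).
  by expand_degrees; rewrite /= eG2; expand_degrees; parity_ring.
Qed.

End Last.

End InnerDual.

(** * Inner compositions: both parts on all words *)
Section Splitting.
Variables (T O : Type).
Implicit Types (X : seq (seq O)) (w : seq T).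

Lemma map_size_succ X : all (fun x => 0 < size x)%N X ->
  map size X = [seq p.+1 | p <- map predn (map size X)].
Proof. by elim: X => //= x l IH /andP[x0 /IH <-]; rewrite prednK. Qed.

(** The part of a word to the left of an inserted subword ends inside a block. *)
Lemma split_left X nl w : all (fun x => 0 < size x)%N X -> size w = (nl + size (flatten X))%N ->
  exists L FF TT, [/\ w = assemble (L :: FF) TT, map size X = [seq (size s).+1 | s <- FF],
    size FF = size TT & size L = nl].
Proof.
move=> X0; rewrite size_flatten => sw.
have XE := map_size_succ X0.
have [|//|SS [TT [e1 e2 e3]]] := @assemble_surj T (nl :: map predn (map size X)) w.
  by rewrite /= -XE sw.
case: SS e1 e2 e3 => [|L FF] //= e1 [e2 e2'] [e3].
exists L, FF, TT; split => //.
by rewrite XE -e2' -map_comp.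
Qed.

Lemma split_right X nr w : all (fun x => 0 < size x)%N X -> size w = (nr + size (flatten X))%N ->
  exists R FF TT, [/\ w = assemble (rcons FF R) TT, map size X = [seq (size s).+1 | s <- FF],
    size FF = size TT & size R = nr].
Proof.
move=> X0; rewrite size_flatten => sw.
have XE := map_size_succ X0.
have [||SS [TT [e1 e2 e3]]] := @assemble_surj T (rcons (map predn (map size X)) nr) w.
- by rewrite map_rcons -XE -cats1 sumn_cat sw /shape /= addn0 addnS addnC.
- by case: (map _ _).
case/lastP: SS e1 e2 e3 => [|FF R] e1 e2 e3; first by [].
move: e2 e3; rewrite /shape map_rcons => /rcons_inj [e2 e2']; rewrite size_rcons => -[e3].
exists R, FF, TT; split => //.
by rewrite XE -e2 -map_comp.
Qed.

End Splitting.

Section Assembly.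
Variables (k : fieldType) (O : choiceType) (A : quiver k O) (d : int).
Local Notation Q := (ext A d).
Local Notation toA := (@toA k O A d).
Local Notation toAs := (map (map toA)).

Lemma split_fits (yy : seq (seq O)) (w : seq (arrow Q)) : yy != [::] ->
  all (fun x => 0 < size x)%N yy -> size w = (size (flatten yy)).-1 ->
  exists GG TG, w = assemble GG TG /\ fits yy GG TG.
Proof.
move=> yy0 ally; rewrite size_flatten => sw.
have XE := map_size_succ ally.
have [||SS [TT [e1 e2 e3]]] := @assemble_surj _ (map predn (map size yy)) w.
- by rewrite -XE sw.
- by case: (yy) yy0.
by exists SS, TT; split => //; split => //; rewrite XE -e2 -map_comp.
Qed.

(** Forms are compared by their values; the case where the objects do not match is
    part of the compared values. *)
Lemma jD_pointwise xx zz SF TF SZ TZ (eF eZ E : int) (phiF phiZ : seq (arrow A) -> tensors A) y x i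
    z1 MZ zn s1 MF sn :
  fits zz SZ TZ -> SZ = z1 :: rcons MZ zn -> fits xx SF TF -> SF = s1 :: rcons MF sn ->
  multilinear phiF ->
  (forall bb : A x y (- (d - 1 + i)),
    (if block_word zz (assemble SZ TZ) then (-1) ^ jD_sign SZ TZ MZ zn eZ (d - 1 + i) *:
       tlift (read TZ read_nil)
         (phiZ (map toA z1 ++ Arrow bb :: map toA zn ++ flatten (toAs MZ))) else 0) =
    (-1) ^ E *:
    (if block_word xx (assemble SF TF) then (-1) ^ jD_sign SF TF MF sn eF (d - 1 + i) *:
       tlift (read TF read_nil)
         (phiF (map toA s1 ++ Arrow bb :: map toA sn ++ flatten (toAs MF))) else 0) :> k^o) ->
  jD zz (assemble SZ TZ) eZ phiZ y x i = (-1) ^ E *: jD xx (assemble SF TF) eF phiF y x i.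
Proof.
move=> fz ez ff ef mF H; rewrite (jD_assemble fz _ _ _ _ _ ez) (jD_assemble ff _ _ _ _ _ ef).
rewrite !to_form_if to_form_scale; first exact: eq_to_form.
move=> c u v; case: ifP => _; last by rewrite scaler0 addr0.
rewrite mF tlift_linear; last by apply/read_multilinear/read_nil_multilinear.
by rewrite scalerDr !scalerA mulrC.
Qed.

Lemma j_parts_block e xx phi phi' (w : seq (arrow Q)) y x i :
  ~~ block_word xx w -> j_parts d e xx phi phi' w y x i = 0.
Proof. by move=> nb; rewrite /j_parts /jA /jD nb. Qed.

Lemma insertion_split eg q r (f g : cochain Q) wl am mid' wr y x i :
  size (am :: mid') = q -> size wr = r ->
  insertion eg q r f g (wl ++ (am :: mid') ++ wr) y x i =
  (-1) ^ (eg * sdeg wl) *: f (wl ++ Arrow (g (am :: mid') (tgt am) (src (last am mid'))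
     (eg + sdeg (am :: mid') + 1)) :: wr) y x i.
Proof.
move=> sq sr; rewrite /insertion.
have -> : (size (wl ++ (am :: mid') ++ wr) - (q + r) = size wl)%N.
  by rewrite !size_cat sq sr; lia.
rewrite drop_size_cat // take_size_cat // -sq take_size_cat //.
by rewrite catA drop_size_cat ?size_cat.
Qed.

(** Insertions vanish on words of the wrong length.  On words shorter than the arity
    the truncated subtractions in the insertion still apply the outer map, to a
    single letter made from a word of the wrong length. *)
Lemma insertion_size eg q r (f g : cochain Q) w y x i s :
  (r < s)%N -> (forall w', size w' != s -> f w' y x i = 0) ->
  (forall am mid', size (am :: mid') != q ->
     f [:: Arrow (g (am :: mid') (tgt am) (src (last am mid')) (eg + sdeg (am :: mid') + 1))] y x i = 0) ->
  (size w).+1 != (s + q)%N -> insertion eg q r f g w y x i = 0.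
Proof.
move=> rs f0 f1 sw; rewrite /insertion; set p := (size w - (q + r))%N.
case E : (take q (drop p w)) => [|am mid'] //.
have sm : size (am :: mid') = size (take q (drop p w)) by rewrite E.
have [lt|le] := ltnP (size w) q.
  have p0 : p = 0%N by rewrite /p; lia.
  rewrite p0 take0 add0n drop_oversize ?(ltnW lt) // f1 ?scaler0 // sm p0 drop0 take_oversize ?(ltnW lt) //.
  by rewrite neq_ltn lt.
rewrite f0 ?scaler0 // size_cat /= size_take size_drop.
move: sw; rewrite /p => sw; apply/eqP => h; move/eqP: sw; apply; move: h.
by case: ifP => /=; lia.
Qed.

End Assembly.

Section Primes.
Variables (k : fieldType) (O : choiceType) (A : quiver k O) (d eF : int).
Variables (F G : multi_family A).
Variables (a b : seq O) (o1 o2 : O) (yy : seq (seq O)).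
Local Notation xv := (a ++ o1 :: o2 :: b).
Local Notation j := (size a).+2.
Local Notation m := (size yy).
Hypothesis m0 : (0 < m)%N.

Lemma prime_ends (x1 xn : seq O) X : prime (x1 :: rcons X xn) = (x1 ++ xn) :: X.
Proof.
rewrite /prime /= size_rcons subSS subn1 /= -cats1 take_size_cat // /blk /= cats1.
by rewrite nth_rcons ltnn eqxx.
Qed.

Lemma inn_comp'_first X2 xn :
  inn_comp' d eF F G (([::] : seq (seq O)) ++ xv :: rcons X2 xn) yy 1 j =
  diagram d (([::] : seq (seq O)) ++ (a ++ o1 :: o2 :: (b ++ xn)) :: X2) yy m 1 j true eF
    (F (([::] : seq (seq O)) ++ (a ++ o1 :: o2 :: (b ++ xn)) :: X2)) (G yy) 0.
Proof.
rewrite /inn_comp' /= size_rcons /= prime_ends -catA /=.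
by rewrite starting_InR.
Qed.

Lemma inn_comp'_middle X1 X2 x1 xn :
  inn_comp' d eF F G ((x1 :: X1) ++ xv :: rcons X2 xn) yy (size X1).+2 j =
  diagram d (((x1 ++ xn) :: X1) ++ xv :: X2) yy m (size X1).+2 j true eF
    (F (((x1 ++ xn) :: X1) ++ xv :: X2)) (G yy) 0.
Proof.
rewrite /inn_comp' -[(x1 :: X1) ++ _]/(x1 :: X1 ++ xv :: rcons X2 xn) -cat_rcons -rcons_cat prime_ends cat_rcons.
rewrite /= !size_rcons size_cat /=.
rewrite (_ : _ == _ = false) /=; last by apply/eqP; lia.
by rewrite starting_InF1.
Qed.

Lemma inn_comp'_last X1 x1 :
  inn_comp' d eF F G ((x1 :: X1) ++ [:: xv]) yy (size X1).+2 j =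
  diagram d (([::] : seq (seq O)) ++ ((x1 ++ a) ++ o1 :: o2 :: b) :: X1) yy m 1 (size (x1 ++ a)).+2 true eF
    (F (([::] : seq (seq O)) ++ ((x1 ++ a) ++ o1 :: o2 :: b) :: X1)) (G yy) m.-1.
Proof.
rewrite /inn_comp' cats1 rcons_cons prime_ends /= size_rcons /= eqxx starting_InL //.
by rewrite -catA size_cat /blk /= !addnS.
Qed.

End Primes.

Section InnerDualPart.
Variables (k : fieldType) (O : choiceType) (A : quiver k O) (d eF eG : int).
Local Notation Q := (ext A d).
Local Notation toA := (@toA k O A d).
Local Notation toAs := (map (map toA)).
Variables (F G : multi_family A).
Hypotheses (F_multi : multi d eF F) (G_multi : multi d eG G).
Variables (a b : seq O) (o1 o2 : O) (yy : seq (seq O)).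
Hypothesis yy_type : is_type yy.
Local Notation xv := (a ++ o1 :: o2 :: b).
Local Notation j := (size a).+2.
Local Notation m := (size yy).
Variables (GQ : seq (seq (arrow Q))) (L R TG : seq (arrow Q)).
Hypothesis GQ_fits : fits yy GQ TG.
Hypothesis sL : size L = size a.
Hypothesis sR : size R = size b.
Variables (am : arrow Q) (mid' : seq (arrow Q)).
Local Notation mid := (am :: mid').
Hypothesis midE : mid = assemble GQ TG.
Local Notation ins := (inserted_letter eG G yy am mid').
Local Notation e := (eF + eG - (d + 1)).

Lemma graft_cons (T : Type) (l r : seq T) gg : exists z Z, graft l r gg = z :: Z.
Proof. by case: gg => [|g1 [|g2 gg]]; eexists; eexists. Qed.

Lemma graft_rcons (T : Type) (l r : seq T) gg : exists Z z, graft l r gg = rcons Z z.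
Proof.
by have [z [Z ->]] := graft_cons l r gg; exists (belast z Z), (last z Z); rewrite lastI.
Qed.

Let m0 : (0 < m)%N.
Proof. by rewrite -(fits_size GQ_fits) GQ_fits.2. Qed.

(** The word with [b] has one block less, and the connected block may be the first,
    the last, both, or neither. *)
Lemma inner_comp_D X1 X2 FF1 FF2 TF1 TF2 y x i :
  map size X1 = [seq (size s).+1 | s <- FF1] ->
  map size X2 = [seq (size s).+1 | s <- FF2] ->
  size FF1 = size TF1 -> size FF2 = size TF2 ->
  jD (inn_type (X1 ++ xv :: X2) yy (size X1).+1 j)
    (assemble (L :: FF2) TF2 ++ mid ++ assemble (rcons FF1 R) TF1) e
    (inn_comp' d eF F G (X1 ++ xv :: X2) yy (size X1).+1 j) y x i =
  (-1) ^ ((eG - (d + 1)) * (sdeg L + sdegs FF2 + sdeg TF2)) *: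
  jD (X1 ++ xv :: X2)
    (assemble (L :: FF2) TF2 ++ ins :: assemble (rcons FF1 R) TF1) eF (F (prime (X1 ++ xv :: X2))) y x i.
Proof.
move=> sF1 sF2 sTF1 sTF2.
have bzm := inn_word_mid (o1 := o1) (o2 := o2) yy_type GQ_fits sF1 sF2 sTF1 sTF2 sL sR midE.
have bxm := inserted_word_match eG G o1 o2 yy_type GQ_fits sF1 sF2 sTF1 sTF2 sL sR midE.
have zf := inn_type_fits o1 o2 yy_type GQ_fits sF1 sF2 sTF1 sTF2 sL sR.
have xf := inserted_fits eG G o1 o2 yy sF1 sF2 sTF1 sTF2 sL sR am mid'.
have GQ0 : GQ <> [::] by move=> E; have := GQ_fits.2; rewrite E.
rewrite (inn_word_assemble FF2 L R TF2 GQ_fits sTF1 midE) in bzm bxm *.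
rewrite (inserted_word_assemble eG G yy FF2 L R TF2 sTF1 am mid') in bxm *.
case: X1 sF1 bzm bxm zf xf => [|x1 X1] sF1 bzm bxm zf xf; case/lastP: X2 sF2 bzm bxm zf xf => [|X2 xn] sF2 bzm bxm zf xf.
- case: FF1 sF1 sTF1 bzm bxm zf xf => // _ sTF1; case: FF2 sF2 sTF2 => // _ sTF2.
  case: TF1 sTF1 => // _; case: TF2 sTF2 => // _ bzm bxm zf xf.
  rewrite [in RHS]/jD orbT scaler0 /inn_comp' /=.
  case: (one_or_more GQ0) zf => [[g eG1]|[g1 [gm [gl eG2]]]] zf.
    by rewrite /jD -(fits_size zf) eG1 /= orbT.
  have eZ : [::] ++ graft L R GQ ++ [::] = (g1 ++ R) :: rcons gm (L ++ gl) by rewrite eG2 graft2 cats0.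
  have mr TT := @read_multilinear k O A d _ TT _ (@read_nil_multilinear k O A).
  rewrite (jD_assemble zf _ _ _ _ _ eZ) to_form_if; apply: form_ext => bb.
  have t0 (TT : seq (arrow Q)) : tlift (read TT read_nil) (0 : tensors A) = 0 := tlift_zero (mr TT).
  rewrite to_formE t0 ?scaler0 ?if_same //.
  by move=> c u w; rewrite scaler0 addr0.
- case: FF1 sF1 sTF1 bzm bxm zf xf => // _ sTF1; case: TF1 sTF1 => // _ bzm bxm zf xf.
  case/lastP: FF2 sF2 sTF2 bzm bxm zf xf => [|FF2 sn] sF2; first by case: (X2) sF2.
  move: sF2; rewrite map_rcons map_rcons => /rcons_inj [sF2 sxn].
  rewrite size_rcons => sTF2 bzm bxm zf xf.
  have [z1 [Zr eg]] := graft_cons L R GQ.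
  have eZ : [::] ++ graft L R GQ ++ rcons FF2 sn = z1 :: rcons (Zr ++ FF2) sn.
    by rewrite eg rcons_cat.
  apply: (jD_pointwise zf eZ xf erefl); first exact: multi_linear F_multi _.
  move=> bb; rewrite inn_comp'_first // prime_ends sdegs_rcons addrA -catA.
  exact: (inner_dual_first F_multi G_multi yy_type GQ_fits sL sR midE bzm bxm bb sF2 sxn sTF2 eZ).
- case: FF2 sF2 sTF2 bzm bxm zf xf => // _ sTF2; case: TF2 sTF2 => // _ bzm bxm zf xf.
  case: FF1 sF1 sTF1 bzm bxm zf xf => // f1 FF1 [sx1 sF1] sTF1 bzm bxm zf xf.
  have [Zr [zn eg]] := graft_rcons L R GQ.
  have eZ : (f1 :: FF1) ++ graft L R GQ ++ [::] = f1 :: rcons (FF1 ++ Zr) zn.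
    by rewrite eg cats0 rcons_cat.
  apply: (jD_pointwise (z1 := f1) zf eZ xf (MF := FF1) (sn := L ++ ins :: R)).
  + by rewrite cats1.
  + exact: multi_linear F_multi _.
  have pE : prime ((x1 :: X1) ++ [:: xv]) = (([::] : seq (seq O)) ++ ((x1 ++ a) ++ o1 :: o2 :: b) :: X1).
    by rewrite cats1 rcons_cons prime_ends -catA.
  move=> bb; rewrite pE inn_comp'_last // sdegs_nil sdeg_nil !addr0.
  rewrite !cats0 in bzm bxm eZ *.
  exact: (inner_dual_last F_multi G_multi yy_type GQ_fits sL sR midE bzm bxm bb sF1 sx1 sTF1 eZ).
case: FF1 sF1 sTF1 bzm bxm zf xf => // f1 FF1 [sx1 sF1] sTF1 bzm bxm zf xf.
case/lastP: FF2 sF2 sTF2 bzm bxm zf xf => [|FF2 sn] sF2; first by case: (X2) sF2.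
move: sF2; rewrite map_rcons map_rcons => /rcons_inj [sF2 sxn].
rewrite size_rcons => sTF2 bzm bxm zf xf.
have eZ : (f1 :: FF1) ++ graft L R GQ ++ rcons FF2 sn = f1 :: rcons (FF1 ++ graft L R GQ ++ FF2) sn.
  by rewrite !rcons_cat.
have eF' : (f1 :: FF1) ++ (L ++ ins :: R) :: rcons FF2 sn = f1 :: rcons (FF1 ++ (L ++ ins :: R) :: FF2) sn.
  by rewrite rcons_cat.
apply: (jD_pointwise zf eZ xf eF'); first exact: multi_linear F_multi _.
move=> bb; rewrite inn_comp'_middle // sdegs_rcons addrA.
have -> : prime ((x1 :: X1) ++ xv :: rcons X2 xn) = ((x1 ++ xn) :: X1) ++ xv :: X2.
  by rewrite -[_ ++ _]/(x1 :: X1 ++ xv :: rcons X2 xn) -rcons_cons -rcons_cat prime_ends.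
exact: (inner_dual_middle F_multi G_multi yy_type GQ_fits sL sR midE bzm bxm bb sF1 sF2 sx1 sxn sTF1 sTF2).
Qed.

End InnerDualPart.

Section InnerPart.
Variables (k : fieldType) (O : choiceType) (A : quiver k O) (d eF eG : int).
Local Notation Q := (ext A d).
Local Notation toA := (@toA k O A d).
Local Notation toAs := (map (map toA)).
Variables (F G : multi_family A).
Hypotheses (F_multi : multi d eF F) (G_multi : multi d eG G).
Variables (X1 X2 : seq (seq O)) (a b : seq O) (o1 o2 : O) (yy : seq (seq O)).
Hypothesis yy_type : is_type yy.
Hypothesis X1_ne : all (fun x => 0 < size x)%N X1.
Hypothesis X2_ne : all (fun x => 0 < size x)%N X2.
Local Notation xv := (a ++ o1 :: o2 :: b).
Local Notation xx := (X1 ++ xv :: X2).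
Local Notation v := (size X1).+1.
Local Notation j := (size a).+2.
Local Notation zz := (inn_type xx yy v j).
Local Notation e := (eF + eG - (d + 1)).
Local Notation q := (size (flatten yy)).-1.

Lemma yy_nonempty : yy != [::] /\ all (fun x => 0 < size x)%N yy.
Proof.
case/and3P: yy_type => yy0 ally _; split => //.
by apply: sub_all ally => -[].
Qed.

Lemma yy_size : (1 < size (flatten yy))%N.
Proof.
have [yy0 ally] := yy_nonempty; case/and3P: yy_type => _ _.
case: (yy) yy0 ally => [|y1 [|y2 l]] //= _; first by rewrite cats0.
move=> /and3P[h1 h2 _] _; rewrite !size_cat; lia.
Qed.

Lemma slot_size : (size (flatten (take v xx)) - j = size b + size (flatten X1))%N.
Proof.
have -> : take v xx = rcons X1 xv by rewrite -cat_rcons take_size_cat ?size_rcons.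
by rewrite flatten_rcons !size_cat /=; lia.
Qed.

Lemma size_flatten_xx : size (flatten xx) = (size (flatten X1) + size a + 2 + size b + size (flatten X2))%N.
Proof. by rewrite flatten_cat /= !size_cat /=; lia. Qed.

Lemma size_flatten_zz :
  size (flatten zz) = (size (flatten X1) + size a + size (flatten yy) + size b + size (flatten X2))%N.
Proof.
by rewrite -size_flatten_rev (flatten_rev_zz _ _ _ _ _ _ yy_type) !size_cat !size_flatten_rev; lia.
Qed.

Lemma inner_part_size w y x i : size w != (size (flatten zz)).-1 ->
  j_parts d e zz (inn_comp d eF F G xx yy v j) (inn_comp' d eF F G xx yy v j) w y x i
  = insertion (eG - (d + 1)) q (size (flatten (take v xx)) - j)
      (j_comp d eF xx F) (piA (j_comp d eG yy G)) w y x i.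
Proof.
move=> sw; rewrite j_parts_block; last by apply: contra sw => /block_word_size ->.
have q1 := yy_size; rewrite slot_size (@insertion_size _ _ _ _ _ _ _ _ _ _ _ _ _ (size (flatten xx)).-1) //.
- by rewrite size_flatten_xx; lia.
- by move=> w' sw'; apply: j_parts_block; apply: contra sw' => /block_word_size ->.
- move=> am mid' sm; rewrite /j_comp.
  have nb : ~~ block_word yy (am :: mid') by apply: contra sm => /block_word_size ->.
  have j0 y' x' i' : jA yy (am :: mid') eG (G yy) y' x' i' = 0 by rewrite /jA nb.
  rewrite /piA /j_parts /= j0.
  set u := Arrow _; have [bw|nbw] := boolP (block_word xx [:: u]); last first.
    by rewrite /jA /jD nbw.
  have sF := block_word_size bw; move: sF; rewrite size_flatten_xx /= => sF.
  have nil (S : seq (seq O)) : all (fun x => 0 < size x)%N S -> size (flatten S) = 0%N -> S = [::].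
    by case: S => //= x0 S /andP[x0S _]; rewrite size_cat; lia.
  have E1 := nil _ X1_ne ltac:(lia); have E2 := nil _ X2_ne ltac:(lia).
  have Ea : a = [::] by apply/size0nil; lia.
  have Eb : b = [::] by apply/size0nil; lia.
  have ff : fits [:: [:: o1; o2]] [:: [:: u]] [::] by [].
  rewrite E1 E2 Ea Eb; congr (_, _).
    rewrite [LHS](jA_assemble ff); case: ifP => // _.
    have mF := multi_linear F_multi [:: [:: o1; o2]].
    rewrite (multilinear_at0 [::] [::] _ _ _ mF) (tlift_zero (read_multilinear _ _)) ?scaler0 //.
    exact: read_component_multilinear.
  by rewrite /jD orbT.
- move: sw; rewrite size_flatten_zz size_flatten_xx; lia.
Qed.

(** The word is cut at the inserted subword; its parts are assembled words. *)
Lemma inner_part w y x i :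
  j_parts d e zz (inn_comp d eF F G xx yy v j) (inn_comp' d eF F G xx yy v j) w y x i
  = insertion (eG - (d + 1)) q (size (flatten (take v xx)) - j)
      (j_comp d eF xx F) (piA (j_comp d eG yy G)) w y x i.
Proof.
have [sw|/inner_part_size //] := eqVneq (size w) (size (flatten zz)).-1.
have [yy0 ally] := yy_nonempty; have q1 := yy_size; rewrite size_flatten_zz in sw.
set p := (size a + size (flatten X2))%N.
have wE0 : w = take p w ++ take q (drop p w) ++ drop q (drop p w) by rewrite !cat_take_drop.
have s1 : size (take p w) = p by rewrite size_takel // sw /p; lia.
have s2 : size (take q (drop p w)) = q by rewrite size_takel // size_drop sw /p; lia.
have s3 : size (drop q (drop p w)) = (size b + size (flatten X1))%N.
  by rewrite !size_drop sw /p; lia.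
have [L [FF2 [TF2 [wlE sF2 sTF2 sL]]]] := split_left X2_ne s1.
have [R [FF1 [TF1 [wrE sF1 sTF1 sR]]]] := split_right X1_ne s3.
have [GQ [TG [midE ff]]] := split_fits yy0 ally s2.
move: wE0 s2 s3 midE; rewrite wlE wrE; case: (take q (drop p w)) => [|am mid'] -> s2 s3 midE.
  by move: s2 => /=; lia.
rewrite slot_size insertion_split // sdeg_wl //.
rewrite -[j_comp _ _ _ _ _ _ _ _]/(jA xx _ eF (F xx) y x i, jD xx _ eF (F (prime xx)) y x i).
congr (_, _).
  by rewrite (inner_comp_A F_multi G_multi o1 o2 yy_type ff sF1 sF2 sTF1 sTF2 sL sR midE) sdeg_wl.
exact: (inner_comp_D F_multi G_multi o1 o2 yy_type ff sL sR midE y x i sF1 sF2 sTF1 sTF2).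
Qed.

End InnerPart.

(** * Outer diagrams and the inserted form *)
Section OuterTransfer.
Variables (k : fieldType) (O : choiceType) (A : quiver k O) (d eF eG : int).
Local Notation Q := (ext A d).
Local Notation toA := (@toA k O A d).
Local Notation toAs := (map (map toA)).
Variables (F G : multi_family A).
Hypotheses (F_multi : multi d eF F) (G_multi : multi d eG G).
Variables (X2 : seq (seq O)) (a b : seq O) (o1 o2 : O) (yy : seq (seq O)) (c : nat).
Variables (FF : seq (seq (arrow Q))) (G4 G5 G6 G7 : seq (seq (arrow A))) (L R TF TG1 TG2 : seq (arrow Q)).

Local Notation xv := (a ++ o1 :: o2 :: b).
Local Notation xx := (xv :: X2).
Local Notation j := (size a).+2.
Local Notation m := (size yy).
Local Notation GG := (G4 ++ G5 ++ G6 ++ G7).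
Local Notation split := (rcons a o1 :: rcons X2 (o2 :: b)).

Hypothesis sF : map size X2 = [seq (size s).+1 | s <- FF].
Hypothesis sTF : (size FF).+1 = size TF.
Hypothesis sL : size L = size a.
Hypothesis sR : size R = size b.
Hypothesis sG : shape GG = map predn (map size yy).
Hypothesis c_bounds : (0 < c <= m)%N.
Hypothesis sTG1 : size TG1 = c.-1.
Variables (W : lmodType k) (h : seq (arrow A) -> W).
Hypothesis mh : multilinear h.

Let Tl := [:: 0; 2; 1; 4]%N.
Variables (t : nat) (Sl : seq nat).
Hypothesis in_arr : flatten (rot t (sectors xx yy c 1)) =
  flatten (map (in_group (size xx) m 1 (size G4) (size G4 + size G5) (size G4 + size G5 + size G6)) Sl).
Hypothesis out_arr : rot t (frees xx yy c 1) = flatten (map (out_group (size xx) m c 1) Tl).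
Hypothesis Sl_perm : Sl =i iota 0 8.

Variables (am : arrow Q) (mid' : seq (arrow Q)).
Local Notation mid := (am :: mid').
Hypothesis midE : mid = assemble (L :: rcons FF R) TF.

Variables (p r : O).
Hypothesis rE : lt_obj (nth [::] yy c.-1) = Some r.
Hypothesis pE : rt_obj (nth [::] (rot 1 yy) c.-1) = Some p.
Variables (bz bx : bool).
Hypothesis bx_mid : block_word split mid -> bx = bz && ((p, r) == (o2, o1)).
Hypothesis bz_mid : bz -> (p, r) = (o2, o1) -> block_word split mid.

(** The letter that Gerstenhaber insertion puts in place of [mid]: a form. *)
Definition dual_letter : arrow Q :=
  @Arrow _ _ Q (tgt am) (src (last am mid')) (eF - (d + 1) + sdeg mid + 1)
    (0, jD split mid eF (F xx) (tgt am) (src (last am mid')) (eF - (d + 1) + sdeg mid + 1)).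

Variables (sZ sG' E : int).
Let D := outer_degree eF (toAs FF) (map toA L) (map toA R) TF.
Hypothesis signs : parity (sZ + outer_sign eF eG (toAs FF) G4 G5 G6 G7 (map toA L) (map toA R) TF TG1 Sl) =
  parity (E + sG' + jD_sign (L :: rcons FF R) TF FF R eF (d - 1 + D)).

Lemma split_fits_word : fits split (L :: rcons FF R) TF.
Proof.
split; last by rewrite /= size_rcons -sTF.
by rewrite /= !map_rcons /= sF size_rcons sL sR.
Qed.

Lemma sdeg_split : sdeg mid = sdeg L + sdegs FF + sdeg R + sdeg TF.
Proof.
rewrite midE sdeg_assemble /= ?size_rcons ?sTF // -/(sdegs (L :: rcons FF R)).
by rewrite sdegs_cons sdegs_rcons addrA.
Qed.

Lemma dual_degree : eF - (d + 1) + sdeg mid + 1 = D.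
Proof. by rewrite sdeg_split /D /outer_degree !sdeg_toA flatten_toA; ring. Qed.

(** If objects match, the form read at the connected output of G is, up to sign, the
    part valued in forms of j(F) on the type split at the connected input.
    Otherwise the output of G and the form have different endpoints, and the
    reading vanishes.  The congruence [signs] is left to the cases. *)
Lemma outer_transfer :
  (if bz then (-1) ^ sZ *: tlift (read (TG1 ++ TF ++ TG2) h)
     (diagram d xx yy c 1 j false eF (F xx) (G yy) t
       (flatten (map (group_piece [::] (toAs FF) G4 G5 G6 G7 (map toA L) (map toA R)) Sl))) else 0) =
  (-1) ^ E *: (if bx then (-1) ^ sG' *: tlift (read (TG1 ++ dual_letter :: TG2) h)
    (G yy (flatten GG)) else 0).
Proof.
have mF := multi_linear F_multi xx; have mG := multi_linear G_multi yy.
pose T (u : A o1 o2 (- (d - 1 + D))) : k^o := tlift (read TF read_nil)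
  (F xx (map toA L ++ Arrow u :: map toA R ++ flatten (toAs FF))).
have lT : linear T.
  move=> c' u w; rewrite /T mF tlift_linear //.
  by apply/read_multilinear/read_nil_multilinear.
have gE := to_formE lT.
have sA2 := shape_preds sF.
have sX2 := size_blocks sF.
have sTF' : size TF = size xx by rewrite -sTF /= sX2.
have core := @outer_diagram _ _ _ d eF eG F G F_multi G_multi X2 a b o1 o2 yy c (toAs FF) G4 G5 G6 G7
  (map toA L) (map toA R) TF TG1 TG2 sA2 sG _ _ sTF' sTG1 c_bounds W h mh t Sl in_arr out_arr Sl_perm _ gE.
rewrite {}core ?size_map //.
set oi := outer_input _.
have mr u : multilinear (read (TG1 ++ u :: TG2) h) by apply: read_multilinear.
have read_letter (u : arrow Q) us : size us = m ->
    read (TG1 ++ u :: TG2) h us = (pairings TG1 (take c.-1 us) * pairing u (nth (Arrow (0 : A p r 0)) us c.-1)) *: read TG2 h (drop c us).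
  move=> su; have /andP[c0 cm] := c_bounds.
  rewrite -{1}(cat_take_drop c.-1 us) (drop_nth (Arrow (0 : A p r 0))) ?su ?prednK //.
  have sut : size (take c.-1 us) = size TG1 by rewrite size_takel ?sTG1 // su; lia.
  rewrite read_cat // -cat1s -[_ :: drop c us]cat1s read_cat // scalerA.
  by rewrite /pairings /= big_cons big_nil mulr1.
rewrite scalerA sign_mul.
(* If the endpoints of the connected output of G are not those of the connected
   input of F, no form on that input can read it. *)
have Vmis : (p, r) != (o2, o1) -> tlift (read (TG1 ++ oi :: TG2) h) (G yy (flatten GG)) = 0.
  move=> nm; rewrite (eq_tlift_spanned (h := fun=> 0) (mr _) _ (multi_spanned _ _ G_multi)) ?tlift0 //.
    by move=> l r' y x i e u w; rewrite scaler0 addr0.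
  move=> us /andP[uT _]; have su := size_out_of_type uT.
  rewrite read_letter //; set u := nth _ us _.
  have [->|nz] := eqVneq (pairing oi u) 0; first by rewrite mulr0 scale0r.
  have tu := pairing_neq0 nz; case/eqP: nm.
  have /andP[c0 cm] := c_bounds.
  have := congr1 (fun s => nth (None, None) s c.-1) (eqP uT).
  rewrite (nth_map (Arrow (0 : A p r 0))) ?su ?prednK // nth_zip ?size_map ?size_rot //.
  rewrite !(nth_map [::]) ?size_rot ?prednK // rE pE -/u => -[<- <-].
  by rewrite /tgt /src tu.
have [byy|nby] := boolP (block_word split mid); last first.
  have pz u : pairing dual_letter u = 0.
    have -> : pairing dual_letter u = jD split mid eF (F xx) (tgt am) (src (last am mid')) (eF - (d + 1) + sdeg mid + 1)
       (component (src (last am mid')) (tgt am) (- (d - 1 + (eF - (d + 1) + sdeg mid + 1))) u) by [].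
    by rewrite /jD nby.
  have -> : tlift (read (TG1 ++ dual_letter :: TG2) h) (G yy (flatten GG)) = 0.
    rewrite (eq_tlift_spanned (h := fun=> 0) (mr _) _ (multi_spanned _ _ G_multi)) ?tlift0 //.
      by move=> l r' y x i e u w; rewrite scaler0 addr0.
    move=> us /andP[/size_out_of_type su _].
    by rewrite read_letter // pz mulr0 scale0r.
  rewrite scaler0 if_same scaler0; case: ifP => // zz; rewrite Vmis ?scaler0 //.
  by apply: contra nby => /eqP /(bz_mid zz).
rewrite bx_mid //; case: (bz) => /=; last by rewrite scaler0.
case: eqVneq => [_|/Vmis ->]; last by rewrite !scaler0.
have [e1 e2] : tgt am = o2 /\ src (last am mid') = o1.
  have := @endpoints_ends _ _ Q am mid' o2 (b ++ flatten (rev X2) ++ rcons a o1).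
  rewrite !last_cat last_rcons; apply; rewrite (eqP byy); congr pairs.
  by rewrite rev_cons rev_rcons flatten_rcons /= -!catA.
have dlE : dual_letter = @Arrow _ _ Q o2 o1 D (0, jD split mid eF (F xx) o2 o1 D).
  by rewrite /dual_letter e1 e2 dual_degree.
have jE : jD split mid eF (F xx) o2 o1 D =
    to_form (fun u => (-1) ^ jD_sign (L :: rcons FF R) TF FF R eF (d - 1 + D) *: T u).
  by rewrite midE (jD_assemble split_fits_word _ _ _ _ _ erefl) -midE byy.
have pe u : pairing dual_letter u = (-1) ^ jD_sign (L :: rcons FF R) TF FF R eF (d - 1 + D) * pairing oi u.
  have -> : pairing oi u = T (component o1 o2 (- (d - 1 + D)) u) by rewrite pairing_outer_input; exact: gE.
  rewrite dlE.
  transitivity ((jD split mid eF (F xx) o2 o1 D : Defs.form _) (component o1 o2 (- (d - 1 + D)) u)); first by [].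
  rewrite jE to_formE // => x y z; rewrite lT.
  by rewrite scalerDr !scalerA mulrC.
have -> : tlift (read (TG1 ++ dual_letter :: TG2) h) (G yy (flatten GG)) =
    (-1) ^ jD_sign (L :: rcons FF R) TF FF R eF (d - 1 + D) *: tlift (read (TG1 ++ oi :: TG2) h) (G yy (flatten GG)).
  rewrite -tlift_scaler; apply: (eq_tlift_spanned (mr _) _ (multi_spanned _ _ G_multi)).
    by apply: (@multilinear_linear _ _ _ W W (fun x => _ *: x)) => // x y z; rewrite scalerDr !scalerA mulrC.
  move=> us /andP[/size_out_of_type su _].
  by rewrite !read_letter // pe mulrCA -!scalerA.
rewrite !scalerA !sign_mul; congr (_ *: _); apply: eq_sign.
by rewrite signs addrA.
Qed.

End OuterTransfer.

(** * Outer compositions on words of the composed type *)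
Section NthRot.
Variables (T : Type) (x0 : T).
Implicit Type s : seq T.

(** The right end of the output number [i] is read off the next block, cyclically. *)
Lemma nth_rot1 s i : (i.+1 < size s)%N -> nth x0 (rot 1 s) i = nth x0 s i.+1.
Proof. by case: s => //= t s; rewrite rot1_cons nth_rcons ltnS => ->. Qed.

Lemma nth_rot1_last s : nth x0 (rot 1 s) (size s).-1 = head x0 s.
Proof. by case: s => //= t s; rewrite rot1_cons nth_rcons ltnn eqxx. Qed.

End NthRot.

Lemma rt_obj_cat_rcons (O : choiceType) (s t : seq O) p : rt_obj (s ++ rcons t p) = Some p.
Proof. by rewrite /rt_obj -rcons_cat rev_rcons. Qed.

(** Replacing a subword by a single letter [q] between two blocks. *)
Lemma cross_letter (k : fieldType) (O : choiceType) (A : quiver k O) (d : int)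
    (TT1 TT2 : seq (arrow (ext A d))) FF1 s1 s2 FF2 (q : arrow (ext A d)) : size FF1 = size TT1 ->
  cross (TT1 ++ q :: TT2) (FF1 ++ s1 :: s2 :: FF2) =
  cross TT1 FF1 + cross TT2 ([::] :: FF2) + sdeg TT1 * (sdeg s1 + sdeg s2 + sdegs FF2)
  + sdeg [:: q] * (sdeg s2 + sdegs FF2).
Proof.
move=> e; rewrite (cross_cat _ _ (esym e)) -(cat1s q) -(cat1s s1).
rewrite (@cross_cat _ _ _ _ [:: q] TT2 [:: s1] (s2 :: FF2)) //.
rewrite (cross_head TT2 s2) (_ : cross [:: q] [:: s1] = 0); last first.
  by rewrite /cross /= sumz_nil mulr0 addr0.
rewrite !sdegs_cons; ring.
Qed.

Section OuterPart.
Variables (k : fieldType) (O : choiceType) (A : quiver k O) (d eF eG : int).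
Local Notation Q := (ext A d).
Local Notation toA := (@toA k O A d).
Local Notation toAs := (map (map toA)).
Variables (F G : multi_family A).
Hypotheses (F_multi : multi d eF F) (G_multi : multi d eG G).
Variables (X2 Y1 Y2 : seq (seq O)) (a b ya yb : seq O) (o1 o2 r p : O).
Local Notation xv := (a ++ o1 :: o2 :: b).
Local Notation xx := (xv :: X2).
Local Notation yy := (Y1 ++ (r :: ya) :: rcons yb p :: Y2).
Local Notation j := (size a).+2.
Local Notation v := (size Y1).+1.
Local Notation zz := (out_type xx yy v j).
Local Notation split := (rcons a o1 :: rcons X2 (o2 :: b)).
Variables (FF G1 G2 : seq (seq (arrow Q))) (L R ga gb TF TG1 TG2 : seq (arrow Q)).
Hypothesis sF : map size X2 = [seq (size s).+1 | s <- FF].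
Hypothesis sTF : (size FF).+1 = size TF.
Hypothesis sL : size L = size a.
Hypothesis sR : size R = size b.
Hypothesis sG1 : map size Y1 = [seq (size s).+1 | s <- G1].
Hypothesis sG2 : map size Y2 = [seq (size s).+1 | s <- G2].
Hypothesis sTG1 : size G1 = size TG1.
Hypothesis sTG2 : size G2 = size TG2.
Hypothesis sga : size ga = size ya.
Hypothesis sgb : size gb = size yb.

Local Notation wl := (assemble (gb :: G2) TG2).
Local Notation wr := (assemble (rcons G1 ga) TG1).
Variables (am : arrow Q) (mid' : seq (arrow Q)).
Local Notation mid := (am :: mid').
Hypothesis midE : mid = assemble (L :: rcons FF R) TF.
Local Notation dual := (dual_letter eF F X2 a b o1 o2 am mid').
Local Notation SZ := (G1 ++ graft gb ga (L :: rcons FF R) ++ G2).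
Local Notation TZ := (TG1 ++ TF ++ TG2).
Local Notation SG := (G1 ++ ga :: gb :: G2).
Local Notation TG := (TG1 ++ dual :: TG2).
Local Notation w := (wl ++ mid ++ wr).
Local Notation wG := (wl ++ dual :: wr).
Local Notation bz := (block_word zz w).
Local Notation bx := (block_word yy wG).
Local Notation e := (eF + eG - (d + 1)).

Lemma out_type_cat : zz = Y1 ++ (a ++ r :: ya) :: X2 ++ (rcons yb p ++ b) :: Y2.
Proof.
rewrite /out_type; have -> : take v.-1 yy = Y1 by rewrite take_size_cat.
have -> : blk yy v = r :: ya by rewrite /blk nth_cat ltnn subnn.
have -> : blk yy v.+1 = rcons yb p by rewrite /blk nth_cat ltnNge leqnSn /= subSnn.
have -> : drop v.+1 yy = Y2.
  by rewrite -[v.+1]addn2 addnC -drop_drop drop_size_cat //= drop0.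
have -> : take (j - 2) (blk xx 1) = a by rewrite !subSS subn0 take_size_cat.
have -> : drop j (blk xx 1) = b.
  by rewrite -[j]addn2 addnC -drop_drop drop_size_cat //= drop0.
by [].
Qed.

Lemma out_type_fits : fits zz SZ TZ.
Proof.
rewrite out_type_cat graft2; split; last first.
  by rewrite !size_cat /= ?size_cat /= ?size_rcons sTG1 sTG2 -sTF; lia.
rewrite !map_cat /= !map_cat ?map_rcons sG1 sF /= sG2 cat_rcons !size_cat /= ?size_rcons.
by rewrite sga sgb sL sR !addnS cat_rcons.
Qed.

Lemma dual_inserted_fits : fits yy SG TG.
Proof.
split; last by rewrite !size_cat /= sTG1 sTG2 !addnS.
by rewrite !map_cat /= sG1 sG2 size_rcons sga sgb.
Qed.

Lemma out_word_assemble : w = assemble SZ TZ.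
Proof. by rewrite midE assemble_graft //= size_rcons sTF. Qed.

Lemma dual_word_assemble : wG = assemble SG TG.
Proof.
rewrite -[dual :: TG2]cat1s -[ga :: gb :: G2]/(([::] ++ ga) :: gb :: G2).
rewrite assemble_cat // assemble_head /= -!catA; congr (_ ++ _).
rewrite /=; congr (_ :: _).
by rewrite -{1}[TG1]cats0 -[in LHS]cats1 assemble_cat.
Qed.

Lemma flatten_rev_zz_outer : flatten (rev zz) =
  (flatten (rev Y2) ++ yb) ++ (p :: (b ++ flatten (rev X2) ++ rcons a r)) ++ (ya ++ flatten (rev Y1)).
Proof.
rewrite out_type_cat rev_cat rev_cons rev_cat rev_cons !flatten_cat !flatten_rcons !flatten_cat !flatten_rcons.
by rewrite -!catA /= ?cat_rcons -!catA cat_rcons.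
Qed.

Lemma flatten_rev_yy_outer : flatten (rev yy) =
  (flatten (rev Y2) ++ yb) ++ (p :: [:: r]) ++ (ya ++ flatten (rev Y1)).
Proof.
by rewrite rev_cat !rev_cons flatten_cat !flatten_rcons -!catA cat_rcons -?catA.
Qed.

Lemma size_wl_outer : size wl = size (flatten (rev Y2) ++ yb).
Proof. exact: size_left. Qed.

Lemma size_wr_outer : size wr = size (ya ++ flatten (rev Y1)).
Proof. exact: size_right. Qed.

Lemma flatten_rev_split : flatten (rev split) = o2 :: (b ++ flatten (rev X2) ++ rcons a o1).
Proof. by rewrite rev_cons rev_rcons flatten_rcons /= -!catA. Qed.

Lemma size_mid_outer : size mid = size (b ++ flatten (rev X2) ++ rcons a r).
Proof. by rewrite midE (size_fits_word (split_fits_word o1 o2 sF sTF sL sR)) flatten_rev_split /= !size_cat !size_rcons. Qed.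

Lemma out_word_mid : bz -> (p, r) = (o2, o1) -> block_word split mid.
Proof.
rewrite /block_word flatten_rev_zz_outer (objects_insert _ size_wl_outer size_wr_outer) ?size_mid_outer //.
by case/and3P=> _ + _ [e1 e2]; rewrite flatten_rev_split e1 e2.
Qed.

Lemma dual_word_match : block_word split mid -> bx = bz && ((p, r) == (o2, o1)).
Proof.
move=> bs; have [e1 e2] : tgt am = o2 /\ src (last am mid') = o1.
  have := @endpoints_ends _ _ Q am mid' o2 (b ++ flatten (rev X2) ++ rcons a o1).
  by rewrite !last_cat last_rcons; apply; rewrite -flatten_rev_split; apply/eqP.
rewrite /block_word flatten_rev_zz_outer flatten_rev_yy_outer.
rewrite (objects_insert _ size_wl_outer size_wr_outer) ?size_mid_outer //.
rewrite (@objects_insert _ _ _ _ p [:: r] _ wl [:: dual] wr size_wl_outer size_wr_outer) //.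
have ei : (map (@endpoints _ _ Q) [:: dual] == pairs [:: p; r]) = ((p, r) == (o2, o1)).
  have [t1 t2] : tgt dual = tgt am /\ src dual = src (last am mid') by [].
  by rewrite /pairs /= eqseq_cons andbT /endpoints t1 t2 e1 e2 eq_sym.
rewrite ei !last_cat last_rcons [last p [:: r]]/=.
have [[-> ->]|_] := eqVneq (p, r) (o2, o1); last by rewrite !(andbF, andFb).
have -> : (map (@endpoints _ _ Q) mid == pairs (o2 :: b ++ flatten (rev X2) ++ rcons a o1)) = true.
  by rewrite -flatten_rev_split.
by rewrite andbT.
Qed.

Lemma sdeg_wl_outer : sdeg wl = sdeg gb + sdegs G2 + sdeg TG2.
Proof. by rewrite sdeg_assemble /= ?sTG2 // -/(sdegs (gb :: G2)) sdegs_cons. Qed.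

Lemma sdeg_dual t : sdeg (dual :: t) =
  eF - (d + 1) + (sdeg L + sdegs FF + sdeg R + sdeg TF) + sdeg t.
Proof. by rewrite sdeg_cons -(sdeg_split sTF midE) /deg /=; ring. Qed.

Ltac expand_degrees := expand_degrees_with sdeg_dual.

(** The root is the last output of G, so the forms on both sides of the subword
    contract the outputs of G on both sides of the connected one. *)
Lemma outer_comp_A y x i :
  jA zz w e (out_comp d eF F G xx yy v j) y x i =
  (-1) ^ (1 + (eF + d + 1) * (eG + d + 1) + (eF - (d + 1)) * sdeg wl) *: jA yy wG eG (G yy) y x i.
Proof.
rewrite {1}out_word_assemble (jA_assemble out_type_fits) -out_word_assemble {1}dual_word_assemble (jA_assemble dual_inserted_fits) -dual_word_assemble.
have -> : flatten (toAs SZ) = flatten (map (group_piece [::] (toAs FF) (toAs G1) [:: map toA ga]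
      [:: map toA gb] (toAs G2) (map toA L) (map toA R)) [:: 0; 4; 1; 5; 3; 6; 2; 7]%N).
  by rewrite graft2 cat_cons cat_rcons !(map_cat, flatten_cat) /= !(map_cat, flatten_cat) /= !map_cat !cats0 -!catA.
have -> : flatten (toAs SG) = flatten (toAs G1 ++ [:: map toA ga] ++ [:: map toA gb] ++ toAs G2).
  by rewrite map_cat.
have vm : (0 < v < size yy)%N by rewrite !size_cat /=; lia.
have c_b : (0 < v <= size yy)%N by rewrite !size_cat /=; lia.
have sG1' : size G1 = size Y1 by rewrite (size_blocks sG1).
have sG2' : size G2 = size Y2 by rewrite (size_blocks sG2).
have out_arr : rot (out_rot xx yy v) (frees xx yy v 1) =
    flatten (map (out_group (size xx) (size yy) v 1) [:: 0; 2; 1; 4]%N).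
  by rewrite out_rot_outer // frees_outer.
rewrite /out_comp.
apply: (@outer_transfer _ _ _ d eF eG F G F_multi G_multi X2 a b o1 o2 yy v FF (toAs G1) [:: map toA ga]
      [:: map toA gb] (toAs G2) L R TF TG1 TG2 sF sTF sL sR _ c_b _ _ _ (read_component_multilinear y x i)
      _ _ _ out_arr _ _ _ midE p r _ _ _ _ dual_word_match out_word_mid) => //.
- rewrite /shape !map_cat /= -/(shape (toAs G1)) -/(shape (toAs G2)) (shape_preds sG1) (shape_preds sG2).
  by rewrite !size_map size_rcons sga sgb.
- by rewrite -sTG1 sG1'.
- rewrite out_rot_outer // sectors_outer //.
  by congr (flatten (map (in_group _ _ _ _ _ _) _)); rewrite /= ?size_map sG1'; lia.
- exact/perm_mem.
- by rewrite /= nth_cat ltnn subnn.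
- rewrite nth_rot1; last by rewrite size_cat /=; lia.
  by rewrite /= nth_cat ltnNge leqnSn /= subSnn; exact: (rt_obj_cat_rcons [::]).
- rewrite !jA_signE jD_signE /outer_sign /outer_degree koszul_outer /group_piece sdeg_wl_outer.
  rewrite (cross_letter _ _ _ _ _ sTG1) (cross_graft _ _ _ _ _ _ sTG1 (esym sTF)) (cross_inner _ _ (esym sTF)) graft2.
  expand_degrees; rewrite /= -addn1; expand_degrees; parity_ring.
Qed.

End OuterPart.

Section OuterDual.
Variables (k : fieldType) (O : choiceType) (A : quiver k O) (d eF eG : int).
Local Notation Q := (ext A d).
Local Notation toA := (@toA k O A d).
Local Notation toAs := (map (map toA)).
Variables (F G : multi_family A).
Hypotheses (F_multi : multi d eF F) (G_multi : multi d eG G).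
Variables (X2 : seq (seq O)) (a b ya yb : seq O) (o1 o2 r p : O).
Local Notation xv := (a ++ o1 :: o2 :: b).
Local Notation xx := (xv :: X2).
Local Notation j := (size a).+2.
Local Notation split := (rcons a o1 :: rcons X2 (o2 :: b)).
Variables (FF : seq (seq (arrow Q))) (L R ga gb TF TG1 TG2 : seq (arrow Q)).
Hypothesis sF : map size X2 = [seq (size s).+1 | s <- FF].
Hypothesis sTF : (size FF).+1 = size TF.
Hypothesis sL : size L = size a.
Hypothesis sR : size R = size b.
Hypothesis sga : size ga = size ya.
Hypothesis sgb : size gb = size yb.
Variables (am : arrow Q) (mid' : seq (arrow Q)).
Local Notation mid := (am :: mid').
Hypothesis midE : mid = assemble (L :: rcons FF R) TF.
Local Notation dual := (dual_letter eF F X2 a b o1 o2 am mid').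
Variables (bz bx : bool).
Hypothesis bx_mid : block_word split mid -> bx = bz && ((p, r) == (o2, o1)).
Hypothesis bz_mid : bz -> (p, r) = (o2, o1) -> block_word split mid.
Variables (c : int) (x y : O) (bb : A x y (- c)).
Local Notation e := (eF + eG - (d + 1)).
Local Notation E wl := (1 + (eF + d + 1) * (eG + d + 1) + (eF - (d + 1)) * wl).
Local Notation gg := (L :: rcons FF R).

Let sdeg_dual t : sdeg (dual :: t) =
  eF - (d + 1) + (sdeg L + sdegs FF + sdeg R + sdeg TF) + sdeg t.
Proof. by rewrite sdeg_cons -(sdeg_split sTF midE) /deg /=; ring. Qed.

Let sdeg_form_arrow t : sdeg (Arrow bb :: t) = - c - 1 + sdeg t.
Proof. exact: sdeg_cons. Qed.

Ltac expand_degrees := expand_degrees_with (sdeg_dual, sdeg_form_arrow).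

Section Both.
Variables (Y1 Y2 : seq (seq O)) (y1 ym : seq O).
Variables (G1 G2 : seq (seq (arrow Q))) (g1 gm : seq (arrow Q)).
Hypothesis sG1 : map size Y1 = [seq (size s).+1 | s <- G1].
Hypothesis sG2 : map size Y2 = [seq (size s).+1 | s <- G2].
Hypothesis sy1 : size y1 = (size g1).+1.
Hypothesis sym : size ym = (size gm).+1.
Hypothesis sTG1 : (size G1).+1 = size TG1.
Hypothesis sTG2 : (size G2).+1 = size TG2.
Local Notation pyy := (((y1 ++ ym) :: Y1) ++ (r :: ya) :: rcons yb p :: Y2).
Local Notation v := (size Y1).+2.
Local Notation SG := ((g1 :: G1) ++ ga :: gb :: rcons G2 gm).
Local Notation SZ := ((g1 :: G1) ++ graft gb ga gg ++ rcons G2 gm).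
Local Notation MZ := (G1 ++ graft gb ga gg ++ G2).
Local Notation MG := (G1 ++ ga :: gb :: G2).

(** [b] lies between a first and a last block of G that are not adjacent to the
    connected output. *)
Lemma outer_dual_both :
  (if bz then (-1) ^ jD_sign SZ (TG1 ++ TF ++ TG2) MZ gm e c *:
     tlift (read (TG1 ++ TF ++ TG2) read_nil)
       (diagram d xx pyy v 1 j false eF (F xx) (G pyy) (starting_at xx pyy v 1 (InG 1))
         (map toA g1 ++ Arrow bb :: map toA gm ++ flatten (toAs MZ))) else 0) =
  (-1) ^ E (sdeg gb + sdegs G2 + sdeg gm + sdeg TG2) *:
  (if bx then (-1) ^ jD_sign SG (TG1 ++ dual :: TG2) MG gm eG c *:
     tlift (read (TG1 ++ dual :: TG2) read_nil)
       (G pyy (map toA g1 ++ Arrow bb :: map toA gm ++ flatten (toAs MG))) else 0).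
Proof.
set g1b := map toA g1 ++ Arrow bb :: map toA gm.
have -> : map toA g1 ++ Arrow bb :: map toA gm ++ flatten (toAs MZ) =
    flatten (map (group_piece [::] (toAs FF) (g1b :: toAs G1) [:: map toA ga]
      [:: map toA gb] (toAs G2) (map toA L) (map toA R)) [:: 0; 4; 1; 5; 3; 6; 2; 7]%N).
  rewrite graft2 cat_cons cat_rcons /= !(map_cat, flatten_cat) /= !(map_cat, flatten_cat) /= !map_cat !cats0.
  by rewrite /g1b; reassociate.
have -> : map toA g1 ++ Arrow bb :: map toA gm ++ flatten (toAs MG) =
    flatten ((g1b :: toAs G1) ++ [:: map toA ga] ++ [:: map toA gb] ++ toAs G2).
  by rewrite /= map_cat /g1b -?catA ?cat_cons -?catA.
have vm : (0 < v < size pyy)%N by rewrite !size_cat /=; lia.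
have c_b : (0 < v <= size pyy)%N by rewrite !size_cat /=; lia.
have sG1' : size G1 = size Y1 by rewrite (size_blocks sG1).
have st := starting_InG1 xx c_b.
have sT1 : size (g1 :: G1) = size TG1 by rewrite -sTG1.
apply: (@outer_transfer _ _ _ d eF eG F G F_multi G_multi X2 a b o1 o2 pyy v FF (g1b :: toAs G1) [:: map toA ga]
      [:: map toA gb] (toAs G2) L R TF TG1 TG2 sF sTF sL sR _ c_b _ _ _ (@read_nil_multilinear _ _ _)
      _ _ _ _ _ _ _ midE p r _ _ _ _ bx_mid bz_mid) => //.
- rewrite /shape !map_cat /= -/(shape (toAs G1)) -/(shape (toAs G2)) (shape_preds sG1) (shape_preds sG2).
  by rewrite /g1b !size_cat /= !size_map size_rcons sga sgb sy1 sym.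
- by rewrite -sTG1 sG1'.
- rewrite st sectors_outer //.
  by congr (flatten (map (in_group _ _ _ _ _ _) _)); rewrite /= ?size_map sG1'; lia.
- by rewrite st frees_outer.
- exact/perm_mem.
- by rewrite /= nth_cat ltnn subnn.
- rewrite nth_rot1; last by rewrite size_cat /=; lia.
  by rewrite /= nth_cat ltnNge leqnSn /= subSnn; exact: (rt_obj_cat_rcons [::]).
- rewrite !jD_signE /outer_sign /outer_degree koszul_outer /group_piece /g1b.
  rewrite (cross_letter _ _ _ _ _ sT1) (cross_graft _ _ _ _ _ _ sT1 (esym sTF)) (cross_inner _ _ (esym sTF)) graft2.
  expand_degrees; rewrite /= -addn1; expand_degrees; parity_ring.
Qed.

End Both.

Section RightOnly.
Variables (Y2 : seq (seq O)) (ym : seq O) (G2 : seq (seq (arrow Q))) (gm : seq (arrow Q)).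
Hypothesis sG2 : map size Y2 = [seq (size s).+1 | s <- G2].
Hypothesis sym : size ym = (size gm).+1.
Local Notation pyy := (((r :: ya) ++ ym) :: rcons yb p :: Y2).
Local Notation SG := (ga :: gb :: rcons G2 gm).
Local Notation SZ := (graft gb ga gg ++ rcons G2 gm).
Local Notation MZ := (rcons FF (gb ++ R) ++ G2).

(** The first block of G is the one preceding the connected output, so that [b]
    shares a block with its inputs. *)
Lemma outer_dual_right :
  (if bz then (-1) ^ jD_sign SZ (TF ++ TG2) MZ gm e c *:
     tlift (read (TF ++ TG2) read_nil)
       (diagram d xx pyy 1 1 j false eF (F xx) (G pyy) (starting_at xx pyy 1 1 (InG 1))
         (map toA (L ++ ga) ++ Arrow bb :: map toA gm ++ flatten (toAs MZ))) else 0) =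
  (-1) ^ E (sdeg gb + sdegs G2 + sdeg gm + sdeg TG2) *:
  (if bx then (-1) ^ jD_sign SG (dual :: TG2) (gb :: G2) gm eG c *:
     tlift (read (dual :: TG2) read_nil)
       (G pyy (map toA ga ++ Arrow bb :: map toA gm ++ flatten (toAs (gb :: G2)))) else 0).
Proof.
set gab := map toA ga ++ Arrow bb :: map toA gm.
have -> : map toA (L ++ ga) ++ Arrow bb :: map toA gm ++ flatten (toAs MZ) =
    flatten (map (group_piece [::] (toAs FF) [::] [:: gab]
      [:: map toA gb] (toAs G2) (map toA L) (map toA R)) [:: 0; 4; 1; 5; 3; 6; 2; 7]%N).
  rewrite cat_rcons /= !(map_cat, flatten_cat) /= !map_cat !cats0.
  by rewrite /gab; reassociate.
have -> : map toA ga ++ Arrow bb :: map toA gm ++ flatten (toAs (gb :: G2)) =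
    flatten ([::] ++ [:: gab] ++ [:: map toA gb] ++ toAs G2).
  by rewrite /= /gab -?catA ?cat_cons -?catA.
have vm : (0 < 1 < size pyy)%N by [].
have c_b : (0 < 1 <= size pyy)%N by [].
have st := starting_InG1 xx c_b.
apply: (@outer_transfer _ _ _ d eF eG F G F_multi G_multi X2 a b o1 o2 pyy 1 FF [::] [:: gab]
      [:: map toA gb] (toAs G2) L R TF [::] TG2 sF sTF sL sR _ c_b _ _ _ (@read_nil_multilinear _ _ _)
      _ _ _ _ _ _ _ midE p r _ _ _ _ bx_mid bz_mid) => //.
- rewrite /shape /= -/(shape (toAs G2)) (shape_preds sG2).
  by rewrite /gab !size_cat /= !size_map size_rcons sga sgb sym addnS.
- by rewrite st sectors_outer.
- by rewrite st frees_outer.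
- exact/perm_mem.
- by rewrite nth_rot1 //=; exact: (rt_obj_cat_rcons [::]).
- rewrite !jD_signE /outer_sign /outer_degree koszul_outer /group_piece /gab.
  have -> : cross (dual :: TG2) SG = _ := @cross_letter k O A d [::] TG2 [::] ga gb (rcons G2 gm) dual erefl.
  have -> : cross (TF ++ TG2) SZ = _ :=
    @cross_graft k O A d [::] TG2 TF [::] gb ga L FF R (rcons G2 gm) erefl (esym sTF).
  rewrite (cross_inner _ _ (esym sTF)) graft2.
  expand_degrees; rewrite /= -(addn1 (size TG2)); expand_degrees; parity_ring.
Qed.

End RightOnly.

Section LeftOnly.
Variables (Y1 : seq (seq O)) (y1 : seq O) (G1 : seq (seq (arrow Q))) (g1 : seq (arrow Q)).
Hypothesis sG1 : map size Y1 = [seq (size s).+1 | s <- G1].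
Hypothesis sy1 : size y1 = (size g1).+1.
Hypothesis sTG1 : (size G1).+1 = size TG1.
Local Notation pyy := (((y1 ++ rcons yb p) :: Y1) ++ [:: r :: ya]).
Local Notation v := (size Y1).+2.
Local Notation SG := ((g1 :: G1) ++ [:: ga; gb]).
Local Notation SZ := ((g1 :: G1) ++ graft gb ga gg).
Local Notation MZ := (G1 ++ (L ++ ga) :: FF).

(** The last block of G is the one following the connected output.  After joining it
    to the first one, the connected output is the last output of G, which gives
    the order of the inputs of an inner composition. *)
Lemma outer_dual_left :
  (if bz then (-1) ^ jD_sign SZ (TG1 ++ TF) MZ (gb ++ R) e c *:
     tlift (read (TG1 ++ TF) read_nil)
       (diagram d xx pyy v 1 j false eF (F xx) (G pyy) (starting_at xx pyy v 1 (InG 1))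
         (map toA g1 ++ Arrow bb :: map toA (gb ++ R) ++ flatten (toAs MZ))) else 0) =
  (-1) ^ E (sdeg gb) *:
  (if bx then (-1) ^ jD_sign SG (TG1 ++ [:: dual]) (rcons G1 ga) gb eG c *:
     tlift (read (TG1 ++ [:: dual]) read_nil)
       (G pyy (map toA g1 ++ Arrow bb :: map toA gb ++ flatten (toAs (rcons G1 ga)))) else 0).
Proof.
set g1b := map toA g1 ++ Arrow bb :: map toA gb.
have -> : map toA g1 ++ Arrow bb :: map toA (gb ++ R) ++ flatten (toAs MZ) =
    flatten (map (group_piece [::] (toAs FF) [:: g1b] (toAs G1) [:: map toA ga]
      [::] (map toA L) (map toA R)) [:: 0; 4; 2; 5; 1; 6; 7; 3]%N).
  rewrite /= !(map_cat, flatten_cat) /= !map_cat !cats0.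
  by rewrite /g1b; reassociate.
have -> : map toA g1 ++ Arrow bb :: map toA gb ++ flatten (toAs (rcons G1 ga)) =
    flatten ([:: g1b] ++ toAs G1 ++ [:: map toA ga] ++ [::]).
  by rewrite /= map_rcons flatten_rcons flatten_cat /= !cats0 /g1b -?catA ?cat_cons -?catA.
have sm : size pyy = v by rewrite size_cat /= addn1.
have c_b : (0 < v <= size pyy)%N by rewrite sm leqnn.
have sG1' : size G1 = size Y1 by rewrite (size_blocks sG1).
have st := starting_InG1 xx c_b.
have sT1 : size (g1 :: G1) = size TG1 by rewrite -sTG1.
rewrite -[TG1 ++ TF]cats0 -catA.
apply: (@outer_transfer _ _ _ d eF eG F G F_multi G_multi X2 a b o1 o2 pyy v FF [:: g1b] (toAs G1) [:: map toA ga]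
      [::] L R TF TG1 [::] sF sTF sL sR _ c_b _ _ _ (@read_nil_multilinear _ _ _)
      _ _ _ _ _ _ _ midE p r _ _ _ _ bx_mid bz_mid) => //.
- rewrite /shape /= !map_cat /= -/(shape (toAs G1)) (shape_preds sG1).
  by rewrite /g1b !size_cat /= !size_map size_rcons sga sgb sy1.
- by rewrite -sTG1 sG1'.
- rewrite st {1}sm subnn rot0 -{1}sm sectors_inner ?sm //.
  by congr (flatten (map (in_group _ _ _ _ _ _) _)); rewrite /= ?size_map sG1'; lia.
- by rewrite st frees_outer.
- exact/perm_mem.
- by rewrite /= nth_cat ltnn subnn.
- by rewrite -[v.-1]/(v.-1) -{1}sm nth_rot1_last; exact: rt_obj_cat_rcons.
- rewrite !jD_signE /outer_sign /outer_degree koszul_inner /group_piece /g1b.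
  rewrite (cross_letter [::] ga gb [::] dual sT1) cats0.
  have cZ := @cross_graft k O A d TG1 [::] TF (g1 :: G1) gb ga L FF R [::] sT1 (esym sTF).
  rewrite !cats0 in cZ; rewrite cZ.
  rewrite (cross_inner _ _ (esym sTF)) graft2.
  expand_degrees; rewrite /=; expand_degrees; parity_ring.
Qed.

End LeftOnly.

Section Neither.
Local Notation pyy := [:: (r :: ya) ++ rcons yb p].
Local Notation SG := [:: ga; gb].
Local Notation SZ := (graft gb ga gg).

(** Both neighbours of the connected output are joined by [b] into the only block
    of G. *)
Lemma outer_dual_single :
  (if bz then (-1) ^ jD_sign SZ TF FF (gb ++ R) e c *:
     tlift (read TF read_nil)
       (diagram d xx pyy 1 1 j false eF (F xx) (G pyy) (starting_at xx pyy 1 1 (InG 1))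
         (map toA (L ++ ga) ++ Arrow bb :: map toA (gb ++ R) ++ flatten (toAs FF))) else 0) =
  (-1) ^ E (sdeg gb) *:
  (if bx then (-1) ^ jD_sign SG [:: dual] [::] gb eG c *:
     tlift (read [:: dual] read_nil)
       (G pyy (map toA ga ++ Arrow bb :: map toA gb ++ flatten (toAs [::]))) else 0).
Proof.
set gab := map toA ga ++ Arrow bb :: map toA gb.
have -> : map toA (L ++ ga) ++ Arrow bb :: map toA (gb ++ R) ++ flatten (toAs FF) =
    flatten (map (group_piece [::] (toAs FF) [:: gab] [::] [::]
      [::] (map toA L) (map toA R)) [:: 0; 1; 4; 5; 6; 7; 2; 3]%N).
  rewrite /= !map_cat !cats0.
  by rewrite /gab; reassociate.
have -> : map toA ga ++ Arrow bb :: map toA gb ++ flatten (toAs [::]) =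
    flatten ([:: gab] ++ [::] ++ [::] ++ [::]).
  by rewrite /= !cats0.
have c_b : (0 < 1 <= size pyy)%N by [].
have st := starting_InG1 xx c_b.
rewrite -[TF in read TF]cats0.
apply: (@outer_transfer _ _ _ d eF eG F G F_multi G_multi X2 a b o1 o2 pyy 1 FF [:: gab] [::] [::]
      [::] L R TF [::] [::] sF sTF sL sR _ c_b _ _ _ (@read_nil_multilinear _ _ _)
      _ _ _ _ _ _ _ midE p r _ _ _ _ bx_mid bz_mid) => //.
- by rewrite /shape /gab /= !size_cat /= !size_map size_rcons sga sgb.
- by rewrite st rot0 sectors_one.
- exact/perm_mem.
- exact: (rt_obj_cat_rcons (r :: ya)).
- rewrite !jD_signE /outer_sign /outer_degree koszul_single /group_piece /gab.
  have -> : cross [:: dual] SG = _ := @cross_letter k O A d [::] [::] [::] ga gb [::] dual erefl.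
  have cZ := @cross_graft k O A d [::] [::] TF [::] gb ga L FF R [::] erefl (esym sTF).
  rewrite !cats0 !cat0s in cZ; rewrite cZ.
  rewrite (cross_inner _ _ (esym sTF)) graft2.
  expand_degrees; rewrite /=; expand_degrees; parity_ring.
Qed.

End Neither.

End OuterDual.

(** * Outer compositions: both parts on all words *)
Section OuterAssembly.
Variables (k : fieldType) (O : choiceType) (A : quiver k O) (d eF eG : int).
Local Notation Q := (ext A d).
Local Notation toA := (@toA k O A d).
Local Notation toAs := (map (map toA)).
Variables (F G : multi_family A).
Hypotheses (F_multi : multi d eF F) (G_multi : multi d eG G).
Variables (X2 : seq (seq O)) (a b ya yb : seq O) (o1 o2 r p : O).
Local Notation xv := (a ++ o1 :: o2 :: b).
Local Notation xx := (xv :: X2).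
Local Notation j := (size a).+2.
Local Notation split := (rcons a o1 :: rcons X2 (o2 :: b)).
Local Notation e := (eF + eG - (d + 1)).

(** The block of G containing [b] may be adjacent to the connected output on either
    side. *)
Lemma outer_comp_D (Y1 Y2 : seq (seq O)) (FF G1 G2 : seq (seq (arrow Q))) (L R ga gb TF TG1 TG2 : seq (arrow Q)) am mid' y x i :
  map size X2 = [seq (size s).+1 | s <- FF] -> (size FF).+1 = size TF ->
  size L = size a -> size R = size b ->
  map size Y1 = [seq (size s).+1 | s <- G1] -> map size Y2 = [seq (size s).+1 | s <- G2] ->
  size G1 = size TG1 -> size G2 = size TG2 -> size ga = size ya -> size gb = size yb ->
  am :: mid' = assemble (L :: rcons FF R) TF ->
  let yy := Y1 ++ (r :: ya) :: rcons yb p :: Y2 in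
  let wl := assemble (gb :: G2) TG2 in
  let wr := assemble (rcons G1 ga) TG1 in
  jD (out_type xx yy (size Y1).+1 j) (wl ++ (am :: mid') ++ wr) e (out_comp' d eF F G xx yy (size Y1).+1 j) y x i =
  (-1) ^ (1 + (eF + d + 1) * (eG + d + 1) + (eF - (d + 1)) * sdeg wl) *:
  jD yy (wl ++ dual_letter eF F X2 a b o1 o2 am mid' :: wr) eG (G (prime yy)) y x i.
Proof.
move=> sF sTF sL sR sG1 sG2 sTG1 sTG2 sga sgb midE /=.
have bzm := out_word_mid (r := r) (p := p) (o1 := o1) (o2 := o2) sF sTF sL sR sG1 sG2 sTG1 sTG2 sga sgb midE.
have bxm := dual_word_match eF F (o1 := o1) (o2 := o2) r p sF sTF sL sR sG1 sG2 sTG1 sTG2 sga sgb midE.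
have zf := out_type_fits o1 o2 r p sF sTF sL sR sG1 sG2 sTG1 sTG2 sga sgb.
have yf := dual_inserted_fits eF F X2 a b o1 o2 r p sG1 sG2 sTG1 sTG2 sga sgb am mid'.
rewrite (sdeg_wl_outer _ sTG2).
rewrite (out_word_assemble G2 ga gb TG2 sTF sTG1 midE) in bzm bxm *.
rewrite (dual_word_assemble eF F X2 a b o1 o2 G2 ga gb TG2 sTG1 am mid') in bxm *.
have mG xx' := multi_linear G_multi xx'.
rewrite /out_comp'.
case: Y1 G1 sG1 sTG1 bzm bxm zf yf => [|y1 Y1] [|g1 G1] // sG1 sTG1;
  case/lastP: Y2 sG2 => [|Y2 ym]; case/lastP: G2 sTG2 => [|G2 gm] sTG2 sG2;
  try (by move: (congr1 size sG2); rewrite ?map_rcons ?size_rcons).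
- case: TG1 sTG1 => // _; case: TG2 sTG2 => // _ bzm bxm zf yf.
  apply: (jD_pointwise zf _ yf (erefl : _ = ga :: rcons [::] gb)).
  + by rewrite graft2 cats0 /=; reflexivity.
  + exact: mG.
  move=> bb. rewrite sdegs_nil sdeg_nil !addr0.
  rewrite [prime _](_ : _ = [:: (r :: ya) ++ rcons yb p]) //.
  have := outer_dual_single F_multi G_multi sF sTF sL sR sga sgb midE bxm bzm bb.
  by rewrite !cats0.
- case: TG1 sTG1 => // _ bzm bxm zf yf.
  move: sG2; rewrite map_rcons map_rcons => /rcons_inj [sG2 sym].
  have eZ : [::] ++ graft gb ga (L :: rcons FF R) ++ rcons G2 gm =
      (L ++ ga) :: rcons (rcons FF (gb ++ R) ++ G2) gm by rewrite graft2 /= rcons_cat.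
  have eSG : [::] ++ ga :: gb :: rcons G2 gm = ga :: rcons (gb :: G2) gm by [].
  apply: (jD_pointwise zf eZ yf eSG (mG _)) => bb; rewrite sdegs_rcons addrA.
  have -> : prime ([::] ++ (r :: ya) :: rcons yb p :: rcons Y2 ym) = ((r :: ya) ++ ym) :: rcons yb p :: Y2.
    by rewrite -rcons_cons prime_ends.
  exact: (outer_dual_right F_multi G_multi TG2 sF sTF sL sR sga sgb midE bxm bzm bb sG2 sym).
- case: TG2 sTG2 => // _ bzm bxm zf yf.
  case: sG1 => sy1 sG1; rewrite /= in sTG1.
  have eZ : (g1 :: G1) ++ graft gb ga (L :: rcons FF R) ++ [::] =
      g1 :: rcons (G1 ++ (L ++ ga) :: FF) (gb ++ R) by rewrite graft2 cats0 rcons_cat.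
  have eSG : (g1 :: G1) ++ [:: ga; gb] = g1 :: rcons (rcons G1 ga) gb by rewrite -!cats1 -catA.
  apply: (jD_pointwise zf eZ yf eSG (mG _)) => bb; rewrite sdegs_nil sdeg_nil !addr0.
  have -> : prime ((y1 :: Y1) ++ [:: r :: ya; rcons yb p]) = ((y1 ++ rcons yb p) :: Y1) ++ [:: r :: ya].
    by rewrite -[(y1 :: Y1) ++ _]/(y1 :: Y1 ++ _) -cat_rcons cats1 prime_ends cats1.
  have := outer_dual_left F_multi G_multi sF sTF sL sR sga sgb midE bxm bzm bb sG1 sy1 sTG1.
  by rewrite !cats0.
move=> bzm bxm zf yf.
move: sG2; rewrite map_rcons map_rcons => /rcons_inj [sG2 sym].
case: sG1 => sy1 sG1; rewrite /= in sTG1; rewrite size_rcons in sTG2.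
have eZ : (g1 :: G1) ++ graft gb ga (L :: rcons FF R) ++ rcons G2 gm =
    g1 :: rcons (G1 ++ graft gb ga (L :: rcons FF R) ++ G2) gm by rewrite !rcons_cat.
have eSG : (g1 :: G1) ++ ga :: gb :: rcons G2 gm = g1 :: rcons (G1 ++ ga :: gb :: G2) gm.
  by rewrite rcons_cat.
apply: (jD_pointwise zf eZ yf eSG (mG _)) => bb; rewrite sdegs_rcons addrA.
have -> : prime ((y1 :: Y1) ++ (r :: ya) :: rcons yb p :: rcons Y2 ym) =
    ((y1 ++ ym) :: Y1) ++ (r :: ya) :: rcons yb p :: Y2.
  by rewrite -[(y1 :: Y1) ++ _]/(y1 :: Y1 ++ _) -!rcons_cons -rcons_cat prime_ends.
exact: (outer_dual_both F_multi G_multi sF sTF sL sR sga sgb midE bxm bzm bb sG1 sG2 sy1 sym sTG1 sTG2).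
Qed.

Lemma prime_split : prime split = xx.
Proof. by rewrite prime_ends cat_rcons. Qed.

Lemma read_zero_letter (W : lmodType k) (h : seq (arrow A) -> W) (q : arrow Q) us :
  (forall u, pairing q u = 0) -> read [:: q] h us = 0.
Proof.
move=> q0; rewrite /read; case: us => [|u us] //=.
by rewrite /pairings /= big_cons q0 mul0r scale0r.
Qed.

Section Structured.
Variables (Y1 Y2 : seq (seq O)).
Hypothesis X2_ne : all (fun x => 0 < size x)%N X2.
Hypothesis Y1_ne : all (fun x => 0 < size x)%N Y1.
Hypothesis Y2_ne : all (fun x => 0 < size x)%N Y2.
Local Notation yy := (Y1 ++ (r :: ya) :: rcons yb p :: Y2).
Local Notation v := (size Y1).+1.
Local Notation zz := (out_type xx yy v j).
Local Notation q := (size (flatten xx)).-1.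
Local Notation X := ((eF + d + 1) * (eG + d + 1)).

Lemma slot_size_outer : (size (flatten (take v yy))).-1 = (size ya + size (flatten Y1))%N.
Proof.
have -> : take v yy = rcons Y1 (r :: ya) by rewrite -cat_rcons take_size_cat ?size_rcons.
by rewrite flatten_rcons size_cat /= addnS addnC.
Qed.

Lemma size_flatten_zz_outer :
  size (flatten zz) = (size (flatten Y1) + size ya + size yb + size (flatten Y2) + q + 1)%N.
Proof. by rewrite out_type_cat !flatten_cat /= !size_cat /= flatten_cat /= !size_cat size_rcons /=; lia. Qed.

Lemma size_flatten_split : size (flatten split) = size (flatten xx).
Proof. by rewrite /= flatten_rcons !size_cat size_rcons /=; lia. Qed.

(** In the exceptional case of a single letter, this letter is the zero form. *)
Lemma outer_part_size w y x i : size w != (size (flatten zz)).-1 ->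
  j_parts d e zz (out_comp d eF F G xx yy v j) (out_comp' d eF F G xx yy v j) w y x i
  = - (-1) ^ X *: insertion (eF - (d + 1)) q (size (flatten (take v yy))).-1
      (j_comp d eG yy G) (piD (j_comp d eF split F)) w y x i.
Proof.
move=> sw; rewrite j_parts_block; last by apply: contra sw => /block_word_size ->.
rewrite slot_size_outer (@insertion_size _ _ _ _ _ _ _ _ _ _ _ _ _ (size (flatten yy)).-1) ?scaler0 //.
- rewrite flatten_cat !size_cat /= ?size_cat size_rcons; lia.
- by move=> w' sw'; apply: j_parts_block; apply: contra sw' => /block_word_size ->.
- move=> am mid' sm; rewrite /j_comp.
  have nb : ~~ block_word split (am :: mid').
    by apply: contra sm => /block_word_size ->; rewrite size_flatten_split.
  have j0 y' x' i' : jD split (am :: mid') eF (F (prime split)) y' x' i' = 0 by rewrite /jD nb.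
  rewrite /piD /j_parts j0.
  set u := Arrow _; have [bw|nbw] := boolP (block_word yy [:: u]); last first.
    by rewrite /jA /jD nbw.
  have sF := block_word_size bw; move: sF; rewrite flatten_cat size_cat /= !size_cat size_rcons => sF.
  have nil (S : seq (seq O)) : all (fun x => 0 < size x)%N S -> size (flatten S) = 0%N -> S = [::].
    by case: S => //= x0 S /andP[x0S _]; rewrite size_cat; lia.
  have E1 := nil _ Y1_ne ltac:(lia); have E2 := nil _ Y2_ne ltac:(lia).
  have Ea : ya = [::] by apply/size0nil; lia.
  have Eb : yb = [::] by apply/size0nil; lia.
  have ff : fits [:: [:: r]; [:: p]] [:: [::]; [::]] [:: u] by [].
  have u0 v : pairing u v = 0 by [].
  have z (W : lmodType k) (h : seq (arrow A) -> W) U : tlift (read [:: u] h) U = 0.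
    by rewrite (@eq_tlift _ _ _ _ _ (fun=> 0)) ?tlift0 // => us; apply: read_zero_letter.
  rewrite E1 E2 Ea Eb /=; congr (_, _).
    by rewrite [LHS](jA_assemble ff) z scaler0 if_same.
  rewrite [LHS](jD_assemble ff _ _ _ _ _ (erefl : _ = [::] :: rcons [::] [::])) to_form_if.
  apply: form_ext => v; rewrite to_formE.
    by rewrite z scaler0 if_same.
  by move=> c' u' v'; rewrite !z !scaler0 !if_same scaler0 addr0.
- move: sw; rewrite size_flatten_zz_outer; move: q => q0; rewrite flatten_cat size_cat /= !size_cat size_rcons; lia.
Qed.

Lemma outer_part w y x i :
  j_parts d e zz (out_comp d eF F G xx yy v j) (out_comp' d eF F G xx yy v j) w y x i
  = - (-1) ^ X *: insertion (eF - (d + 1)) q (size (flatten (take v yy))).-1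
      (j_comp d eG yy G) (piD (j_comp d eF split F)) w y x i.
Proof.
have [sw|/outer_part_size //] := eqVneq (size w) (size (flatten zz)).-1.
rewrite size_flatten_zz_outer in sw.
set n := (size yb + size (flatten Y2))%N.
have wE0 : w = take n w ++ take q (drop n w) ++ drop q (drop n w) by rewrite !cat_take_drop.
have s1 : size (take n w) = n by rewrite size_takel // sw /n; lia.
have s2 : size (take q (drop n w)) = q by rewrite size_takel // size_drop sw /n; lia.
have s3 : size (drop q (drop n w)) = (size ya + size (flatten Y1))%N.
  by rewrite !size_drop sw /n; lia.
have [gb [G2 [TG2 [wlE sG2 sTG2 sgb]]]] := split_left Y2_ne s1.
have [ga [G1 [TG1 [wrE sG1 sTG1 sga]]]] := split_right Y1_ne s3.
have s2' : size (take q (drop n w)) = (size (flatten split)).-1 by rewrite size_flatten_split.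
have split_ne : all (fun x => 0 < size x)%N split.
  by rewrite /= all_rcons size_rcons /= X2_ne.
have [SS [TF [midE ff]]] := split_fits (isT : split != [::]) split_ne s2'.
have [L [FF [R [eS sL sF sR]]]] : exists L FF R, [/\ SS = L :: rcons FF R, size L = size a,
    map size X2 = [seq (size s).+1 | s <- FF] & size R = size b].
  case: ff => + _; case: SS {midE} => [|L SS] //; case/lastP: SS => [|FF R] /=.
    by case: (X2).
  rewrite !map_rcons => -[]; rewrite size_rcons => -[e1] /rcons_inj [e2 e3].
  by exists L, FF, R; split => //; move: e3 => -[].
have sTF : (size FF).+1 = size TF by have := ff.2; rewrite eS /= size_rcons => -[].
rewrite eS in midE.
move: wE0 s2 s3 midE; rewrite wlE wrE; case: (take q (drop n w)) => [|am mid'] -> s2 s3 midE.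
  by move: s2 => /=; rewrite !size_cat /=; lia.
rewrite slot_size_outer insertion_split //.
rewrite -[j_comp _ _ _ _ _ _ _ _]/(jA yy _ eG (G yy) y x i, jD yy _ eG (G (prime yy)) y x i).
rewrite /piD /= prime_split scalerA.
have -> : - (-1 : k) ^ X * (-1) ^ ((eF - (d + 1)) * sdeg (assemble (gb :: G2) TG2)) =
    (-1) ^ (1 + X + (eF - (d + 1)) * sdeg (assemble (gb :: G2) TG2)).
  by rewrite -!sign_mul expr1z mulN1r.
congr (_, _).
  exact: (outer_comp_A F_multi G_multi o1 o2 r p sF sTF sL sR sG1 sG2 sTG1 sTG2 sga sgb midE).
exact: (outer_comp_D _ _ _ sF sTF sL sR sG1 sG2 sTG1 sTG2 sga sgb midE).
Qed.

End Structured.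

End OuterAssembly.

(** * The two identities *)
Lemma cut_at (T : Type) (s : seq T) i : (i < size s)%N ->
  exists s1 t s2, s = s1 ++ t :: s2 /\ size s1 = i.
Proof.
case: s => // t0 s' si; exists (take i (t0 :: s')), (nth t0 (t0 :: s') i), (drop i.+1 (t0 :: s')).
by rewrite -drop_nth // cat_take_drop size_takel // ltnW.
Qed.

Lemma cut_input (T : Type) (x : seq T) j : (2 <= j <= size x)%N ->
  exists a o1 o2 b, x = a ++ o1 :: o2 :: b /\ j = (size a).+2.
Proof.
move=> /andP[j2 jx]; have [|a [o1 [[|o2 b] [e sa]]]] := @cut_at _ x (j - 2)%N; first by lia.
  by move: jx; rewrite e size_cat /=; lia.
by exists a, o1, o2, b; split => //; lia.
Qed.

Theorem proposition4p31
  (k : fieldType) (char_neq2 : (2%:R : k) != 0) (char_neq3 : (3%:R : k) != 0)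
  (O : choiceType) (A : quiver k O) (d eF eG : int) (F G : multi_family A)
  (F_multi : multi d eF F) (F_cyclic : cyclic d F)
  (G_multi : multi d eG G) (G_cyclic : cyclic d G)
  (xx yy : seq (seq O)) (xx_type : is_type xx) (yy_type : is_type yy) :
  (forall v j : nat, (1 <= v <= size xx)%N -> (2 <= j <= size (blk xx v))%N ->
    forall (w : seq (arrow (ext A d))) (y x : O) (i : int),
      j_parts d (eF + eG - (d + 1)) (inn_type xx yy v j)
        (inn_comp d eF F G xx yy v j) (inn_comp' d eF F G xx yy v j) w y x i
      = insertion (eG - (d + 1)) (size (flatten yy)).-1
          (size (flatten (take v xx)) - j)
          (j_comp d eF xx F) (piA (j_comp d eG yy G)) w y x i)
  /\
  (forall v j : nat, (1 <= v <= (size yy).-1)%N -> (2 <= j <= size (blk xx 1))%N ->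
    forall (w : seq (arrow (ext A d))) (y x : O) (i : int),
      j_parts d (eF + eG - (d + 1)) (out_type xx yy v j)
        (out_comp d eF F G xx yy v j) (out_comp' d eF F G xx yy v j) w y x i
      = - (-1) ^ ((eF + d + 1) * (eG + d + 1)) *:
        insertion (eF - (d + 1)) (size (flatten xx)).-1
          (size (flatten (take v yy))).-1
          (j_comp d eG yy G) (piD (j_comp d eF (split_block1 xx j) F)) w y x i).
Proof.
have [_ xx_ne] := yy_nonempty xx_type; have [_ yy_ne] := yy_nonempty yy_type.
split=> v j hv hj w y x i.
  have [|X1 [xv [X2 [ex s1]]]] := @cut_at _ xx v.-1; first by lia.
  have ev : v = (size X1).+1 by lia.
  rewrite ev ex /blk nth_cat ltnn subnn /= in hj.
  have [a [o1 [o2 [b [exv ej]]]]] := cut_input hj.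
  move: xx_ne; rewrite ex all_cat => /and3P[X1_ne _ X2_ne].
  by rewrite ev ej exv; apply: inner_part.
case: xx xx_type xx_ne hj => [|xv X2] // _ /andP[_ X2_ne]; rewrite {1}/blk /= => hj.
have [a [o1 [o2 [b [exv ej]]]]] := cut_input hj.
have [|Y1 [y1 [[|y2 Y2] [ey s1]]]] := @cut_at _ yy v.-1; first by lia.
  by move: hv; rewrite ey size_cat /=; lia.
have ev : v = (size Y1).+1 by lia.
move: yy_ne; rewrite ey all_cat => /and4P[Y1_ne].
case: y1 ey => [|r ya] ey //; case/lastP: y2 ey => [|yb p] ey // _ _ Y2_ne.
have -> : split_block1 (xv :: X2) j = rcons a o1 :: rcons X2 (o2 :: b).
  rewrite /split_block1 {1 2}/blk /= exv ej -cat_rcons.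
  by rewrite take_size_cat ?drop_size_cat ?size_rcons.
by rewrite ev ej exv; apply: outer_part.
Qed.
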